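(* Let $(T,X,\mu)$ be an ergodic measure-preserving dynamical system on a probability space, with $X$ embedded in a Riemannian manifold and $\mu$ absolutely continuous with respect to Lebesgue measure. Let $M\subset X$ be measurable with $\mu(M)>0$, let $F:M\to M$ be the first return map, $F(x)=T^{r_M(x)}(x)$ with $r_M(x)=\min\{j\ge1:T^j(x)\in M\}$, and let $\hat\mu=\mu_M$ be the $F$-invariant probability $\hat\mu(B)=\mu(B\cap M)/\mu(M)$. For $\zeta\in M$ let $\varphi=\varphi_\zeta$ be an admissible observable at $\zeta$, let $(u_n)_{n\in\mathbb{N}}$ be a sequence with $\lim_{n\to\infty}n\,\mu(X_0>u_n)=\tau$ for some $\tau\ge0$, where $X_j=\varphi\circ T^j$ and $\hat X_j=\varphi\circ F^j$, and let $N_n$ and $\hat N_n$ be the rare event point processes of $(X_j)$ and $(\hat X_j)$. Assume that for $\hat\mu$-a.e. $\zeta\in M$, $\hat N_n$ converges in distribution (with respect to $\hat\mu$) to a standard Poisson process $N$. Then for $\mu$-a.e. $\zeta\in M$, $N_n$ converges in distribution (with respect to $\mu$) to a standard Poisson process.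
   Context: **Admissible observables.** $\varphi:X\to\mathbb{R}\cup\{\pm\infty\}$ is admissible at $\zeta$ if it achieves a global maximum $u_F:=\varphi(\zeta)$ at $\zeta$ (the value $+\infty$ is allowed), if for $u<u_F$ sufficiently close to $u_F$ the set $U(u)=\{x:\varphi(x)>u\}$ is a metric ball centred at $\zeta$, and if $\mu(U(u))$ is a continuous function of $u$ on a neighbourhood of $u_F$. Example: $\varphi(x)=-\log \mathrm{dist}(x,\zeta)$. **Rare event point processes.** $\mathcal{S}$ is the semi-ring of intervals $[a,b)$, $a,b\in[0,\infty)$, and $\mathcal{R}$ is the ring it generates. Put $v_n=1/\mu(X_0>u_n)$ and $\hat v_n=1/\hat\mu(\hat X_0>u_n)$. For $J\in\mathcal{R}$, $$N_n(J)=\sum_{j\in v_nJ\cap\mathbb{N}_0}\mathbf{1}_{\{X_j>u_n\}},\qquad \hat N_n(J)=\sum_{j\in \hat v_nJ\cap\mathbb{N}_0}\mathbf{1}_{\{\hat X_j>u_n\}},$$ where $\alpha J=\{\alpha x:x\in J\}$. **Poisson process.** Let $T_1,T_2,\dots$ be i.i.d. exponential random variables with mean $1$. The standard Poisson process is $N(J)=\#\{i\ge1: T_1+\dots+T_i\in J\}$. **Convergence in distribution.** A sequence of point processes $N_n$ converges in distribution to $N$ if $(N_n(J_1),\dots,N_n(J_k))$ converges in distribution to $(N(J_1),\dots,N(J_k))$ for every $k\in\mathbb{N}$ and all $J_1,\dots,J_k\in\mathcal{S}$ with $N(\partial J_i)=0$ a.s. for each $i$. *)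

(* Defs.v *)
From HB Require Import structures.
From mathcomp Require Import all_boot all_order all_algebra finmap.
From mathcomp Require Import all_classical all_reals all_analysis.
From mathcomp Require Import measurable_realfun.

Set Implicit Arguments.
Unset Strict Implicit.
Unset Printing Implicit Defensive.

Import Order.TTheory GRing.Theory Num.Theory.
Import numFieldNormedType.Exports.

Local Open Scope classical_set_scope.
Local Open Scope ring_scope.

(* f is of class C^k on U, through continuity of the iterated partial
   derivatives. It is only used for open U, where the continuity and the
   derivatives taken in the whole space are those of f restricted to U. *)
Fixpoint Ck_on (R : realType) (d k : nat) (U : set 'rV[R]_d)
    (f : 'rV[R]_d -> R) : Prop :=
  (forall x, U x -> {for x, continuous f}) /\
  if k is k'.+1 then
    forall j : 'I_d, (forall x, U x -> derivable f x (delta_mx 0 j)) /\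
                     Ck_on k' U (fun x => 'D_(delta_mx 0 j) f x)
  else True.

Definition smooth_on (R : realType) (d : nat) (U : set 'rV[R]_d)
    (f : 'rV[R]_d -> R) : Prop := forall k, Ck_on k U f.

(* A smooth Riemannian manifold of dimension d on the space S, connected or
   not. The matrix [metric i y] is the Riemannian metric at the point with
   coordinates y, written in the chart i; vectors are rows, so that
   v *m 'J f y = 'd f y v. *)
Record riemannian_manifold (R : realType) (d : nat) (S : topologicalType) :=
  RiemannianManifold {
    chart_index : Type;
    dom : chart_index -> set S;
    chart : chart_index -> S -> 'rV[R]_d;
    chart_inv : chart_index -> 'rV[R]_d -> S;
    metric : chart_index -> 'rV[R]_d -> 'M[R]_d;
    manifold_hausdorff : hausdorff_space S;
    manifold_second_countable : @second_countable S;
    dom_open : forall i, open (dom i);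
    dom_cover : forall x, exists i, dom i x;
    chart_image_open : forall i, open (chart i @` dom i);
    chartK : forall i x, dom i x -> chart_inv i (chart i x) = x;
    chart_continuous : forall i x, dom i x -> {for x, continuous (chart i)};
    chart_inv_continuous : forall i y, (chart i @` dom i) y ->
      {for y, continuous (chart_inv i)};
    transition_smooth : forall i j (k : 'I_d),
      smooth_on (chart i @` (dom i `&` dom j))
                (fun y => chart j (chart_inv i y) 0 k);
    metric_smooth : forall i (k l : 'I_d),
      smooth_on (chart i @` dom i) (fun y => metric i y k l);
    metric_sym : forall i y, (chart i @` dom i) y ->
      (metric i y)^T = metric i y;
    metric_posdef : forall i y, (chart i @` dom i) y ->
      forall v : 'rV[R]_d, v != 0 -> 0 < (v *m metric i y *m v^T) 0 0;
    metric_transition : forall i j y, (chart i @` (dom i `&` dom j)) y ->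
      let f := fun z => chart j (chart_inv i z) in
      metric i y = 'J f y *m metric j (f y) *m ('J f y)^T }.

(* Length of the curve with coordinates c in the chart i, over [0, 1]. *)
Definition arc_length (R : realType) (d : nat) (S : topologicalType)
    (g : riemannian_manifold R d S) (i : chart_index g)
    (c : R -> 'rV[R]_d) : R :=
  \int[lebesgue_measure]_(t in `[0, 1])
    Num.sqrt ((derive1 c t *m metric i (c t) *m (derive1 c t)^T) 0 0).

(* [joined g x y l]: some piecewise C^1 curve from x to y has length l. A curve
   is cut into finitely many C^1 arcs, each inside one chart and parametrized
   by [0, 1]; a C^1 map on [0, 1] is given by a C^1 extension to the line. *)
Inductive joined (R : realType) (d : nat) (S : topologicalType)
    (g : riemannian_manifold R d S) : S -> S -> R -> Prop :=
| joined_refl x : joined g x x 0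
| joined_arc i (c : R -> 'rV[R]_d) z l :
    (forall t, derivable c t 1) -> continuous (derive1 c) ->
    (forall t, 0 <= t <= 1 -> (@chart _ _ _ g i @` dom i) (c t)) ->
    joined g (chart_inv i (c 1)) z l ->
    joined g (chart_inv i (c 0)) z (arc_length i c + l).

(* Infinite between distinct connected components. *)
Definition riemannian_dist (R : realType) (d : nat) (S : topologicalType)
    (g : riemannian_manifold R d S) (x y : S) : \bar R :=
  ereal_inf [set l%:E | l in joined g x y].

(* Lebesgue outer measure on R^d: infimum of the total volume of the countable
   coverings by boxes. *)
Definition lebesgue_outer (R : realType) (d : nat) (A : set 'rV[R]_d) : \bar R :=
  ereal_inf [set s | exists (K : set nat) (a b : nat -> 'rV[R]_d),
    [/\ forall k j, a k 0 j <= b k 0 j,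
        A `<=` \bigcup_(k in K)
                 [set x | forall j, a k 0 j <= x 0 j <= b k 0 j] &
        s = \esum_(k in K) (\prod_j (b k 0 j - a k 0 j))%:E]].

Definition lebesgue_null (R : realType) (d : nat) (S : topologicalType)
    (g : riemannian_manifold R d S) (A : set S) : Prop :=
  forall i : chart_index g, lebesgue_outer (chart i @` (A `&` dom i)) = 0%E.

Definition borel (S : topologicalType) : set (set S) := <<s @open S >>.
Arguments borel : clear implicits.

(* iota embeds X in S, and the sigma-algebra of X is its Borel sigma-algebra
   for the topology induced by S. *)
Definition borel_embedding (S : topologicalType) (dX : measure_display)
    (X : measurableType dX) (iota : X -> S) : Prop :=
  injective iota /\
  forall A : set X,
    measurable A <-> exists2 B, borel S B & A = iota @^-1` B.

(* mu, carried to S by iota, is absolutely continuous with respect to Lebesgue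
   measure. *)
Definition lebesgue_abs_cont (R : realType) (d : nat) (S : topologicalType)
    (g : riemannian_manifold R d S) (dX : measure_display)
    (X : measurableType dX) (iota : X -> S) (mu : probability X R) : Prop :=
  forall B, borel S B -> lebesgue_null g B -> mu (iota @^-1` B) = 0%E.

Definition measure_preserving (R : realType) (dX : measure_display)
    (X : measurableType dX) (mu : probability X R) (T : X -> X) : Prop :=
  measurable_fun setT T /\
  forall A, measurable A -> mu (T @^-1` A) = mu A.

Definition ergodic (R : realType) (dX : measure_display)
    (X : measurableType dX) (mu : probability X R) (T : X -> X) : Prop :=
  forall A, measurable A -> T @^-1` A = A -> mu A = 0%E \/ mu A = 1%E.

(* The least j >= 1 with T^j x in M; 0 if there is none. *)
Definition return_time (X : Type) (M : set X) (T : X -> X) (x : X) : nat :=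
  if pselect (exists j, (0 < j)%N && `[< M (iter j T x) >]) is left h
  then ex_minn h else 0%N.

(* Only its values on the points of M that return to M are meaningful; by
   Poincare recurrence these points have full measure in M, and they are
   almost all of X for the induced measure below. *)
Definition return_map (X : Type) (M : set X) (T : X -> X) (x : X) : X :=
  iter (return_time M T x) T x.

(* B |-> mu (B `&` M) / mu M, as a measure on X; the last argument of
   mnormalize is irrelevant when mu M > 0. *)
Definition induced_measure (R : realType) (dX : measure_display)
    (X : measurableType dX) (mu : probability X R) (M : set X)
    (mM : measurable M) : probability X R :=
  mnormalize (mrestr mu mM) mu.

(* Both neighbourhoods of the maximum are taken in [-oo, +oo], so that the
   maximum may be +oo. *)
Definition admissible (R : realType) (d : nat) (S : topologicalType)
    (g : riemannian_manifold R d S) (dX : measure_display)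
    (X : measurableType dX) (iota : X -> S) (mu : probability X R)
    (zeta : X) (phi : X -> \bar R) : Prop :=
  [/\ forall x, (phi x <= phi zeta)%E,
      \forall u \near phi zeta, (u < phi zeta)%E ->
        exists2 r : R, 0 < r &
          [set x | (u < phi x)%E] =
          [set x | (riemannian_dist g (iota zeta) (iota x) < r%:E)%E] &
      \forall u \near phi zeta,
        {for u, continuous (fun w : \bar R => mu [set x | (w < phi x)%E])}].

(* A point process sends a set of times to a (possibly infinite) random
   number of points. *)
Definition point_process (R : realType) (Omega : Type) :=
  set R -> Omega -> \bar R.

Definition dilate (R : realType) (v : R) (J : set R) : set R :=
  [set v * x | x in J].

(* The process counting the j with phi (T^j x) > u, in time rescaled by
   v = 1 / mu (phi > u). When mu (phi > u) = 0 the library sets v = 0. *)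
Definition rare_event_process (R : realType) (dX : measure_display)
    (X : measurableType dX) (mu : probability X R) (T : X -> X)
    (phi : X -> \bar R) (u : R) : point_process R X :=
  let v := (fine (mu [set x | (u%:E < phi x)%E]))^-1 in
  fun J x => \esum_(j in [set j : nat | dilate v J j%:R])
    (\1_[set y | (u%:E < phi (iter j T y))%E] x)%:E.

(* The sequence is indexed from 0: W i is T_(i + 1). *)
Definition iid_exponential1 (R : realType) (dO : measure_display)
    (Omega : measurableType dO) (P : probability Omega R)
    (W : nat -> {RV P >-> R}) : Prop :=
  (forall i A, measurable A -> distribution P (W i) A = exponential_prob 1 A) /\
  (forall (I : {fset nat}) (A : nat -> set R), (forall i, measurable (A i)) ->
     P (\bigcap_(i in [set` I]) (W i @^-1` A i)) =
     (\prod_(i <- I) P (W i @^-1` A i))%E).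

Definition poisson_process (R : realType) (Omega : Type) (W : nat -> Omega -> R)
    : point_process R Omega :=
  fun J w => counting [set i : nat | J (\sum_(l < i.+1) W l w)].

(* Convergence in distribution of random vectors, possibly on different
   probability spaces. *)
Definition cvg_in_distribution (R : realType) (k : nat)
    (d1 : measure_display) (O1 : measurableType d1) (P : probability O1 R)
    (Y_ : nat -> O1 -> 'rV[R]_k)
    (d2 : measure_display) (O2 : measurableType d2) (Q : probability O2 R)
    (Y : O2 -> 'rV[R]_k) : Prop :=
  forall f : 'rV[R]_k -> R, continuous f ->
    (exists C : R, forall y, `|f y| <= C) ->
    (fun n => \int[P]_x (f (Y_ n x))%:E)%E @ \oo -->
      (\int[Q]_w (f (Y w))%:E)%E.

Definition time_interval (R : realType) (J : set R) : Prop :=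
  exists a b : R, [/\ 0 <= a, 0 <= b & J = [set x | a <= x < b]].

Definition boundary (R : realType) (J : set R) : set R :=
  closure J `\` interior J.

(* The counts of the bounded sets J i are almost surely finite, which makes
   [fine] harmless. *)
Definition cvg_point_process (R : realType)
    (d1 : measure_display) (O1 : measurableType d1) (P : probability O1 R)
    (N_ : nat -> point_process R O1)
    (d2 : measure_display) (O2 : measurableType d2) (Q : probability O2 R)
    (N : point_process R O2) : Prop :=
  forall (k : nat) (J : 'I_k -> set R),
    (forall i, time_interval (J i)) ->
    (forall i, {ae Q, forall w, N (boundary (J i)) w = 0%E}) ->
    cvg_in_distribution P (fun n x => \row_i fine (N_ n (J i) x))
                        Q (fun w => \row_i fine (N (J i) w)).

(* Main.v *)
Require Import Defs.
From HB Require Import structures.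
From mathcomp Require Import all_boot all_order all_algebra finmap.
From mathcomp Require Import all_classical all_reals all_analysis.
From mathcomp Require Import measurable_realfun.
From mathcomp Require Import zify ring lra.

Set Implicit Arguments.
Unset Strict Implicit.
Unset Printing Implicit Defensive.

Import Order.TTheory GRing.Theory Num.Theory.
Import numFieldNormedType.Exports.

Local Open Scope classical_set_scope.
Local Open Scope ring_scope.

(** Write U = {phi > u_n}: for large n this is a small metric ball around zeta.
    Along the orbit of a point of M, the visits of F to U are the visits of T to
    the intersection of U with M. If zeta is a density point of M, then
    mu (U \ M) = o(mu U), so that in a time window of length O(1 / mu U) the
    T-orbit rarely meets U outside M. By the ergodic theorem for M, the first k
    steps of the T-orbit contain about k mu(M) visits to M, which matches the
    ratio of the time scales of the two processes, about mu(M). Hence the two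
    processes agree at most points of M. To replace the measure mu restricted to
    M by mu, note that N_n is almost T-invariant: averaging the indicator of M
    along the orbit then turns it into the constant mu(M).

    Almost every point of M is a density point because mu does not charge
    Lebesgue null sets. In a chart, compare mu with the volume on the dyadic
    cells. At almost every point, the cells around it have mass at least a
    constant times their volume; and the points of M near which arbitrarily
    small cells meet the complement of M in a mass proportional to their volume
    form a Lebesgue null set, by outer regularity. Finally, the Riemannian
    metric being comparable to the Euclidean one in a chart, metric balls lie
    between coordinate boxes whose radii have a bounded ratio. *)

(** * The ergodic theorem in probability for visits to a set *)

(** The density statement that the argument requires is stronger than the classical one. A
    superlevel set is a metric ball, known only to lie between coordinate boxes of radii [c * r] and
    [C * r], and [mu] need not be doubling; so the mass outside [M] of the large box must be small
    against the mass of the small box. This is why both are measured against volume. Dyadic cells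
    serve because two of them are nested or disjoint, so that maximal cells can be summed directly.
    The price is that a box around a point also meets the neighbours of its cell, hence the
    parameter [kappa]. On the dynamical side, a fixed time for [F] is a random time for [T]. Counts
    are monotone in time, so it is enough to control the number of visits to [M] at two
    deterministic times around each end of a window, and convergence in probability suffices. All
    thresholds, including the number of steps over which the indicator of [M] is averaged, are fixed
    before the level [u_n], so the estimates are uniform in the set that is hit. *)

Section bounded_functions.
Context (R : realType) (dX : measure_display) (X : measurableType dX).
Variable mu : probability X R.

(** A class stable under all the operations below and contained in the integrable functions, so that
    real-valued integrals can be manipulated linearly. *)
Definition bounded_measurable (f : X -> R) : Prop :=
  measurable_fun setT f /\ exists C : R, forall x, `|f x| <= C.

Lemma measurable_superlevel (f : X -> R) c : measurable_fun setT f ->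
  measurable [set x | c < f x].
Proof.
move=> mf; have : measurable (f @^-1` `]c, +oo[%classic).
  by rewrite -[X in measurable X]setTI; exact: mf.
congr measurable; apply/seteqP; split => x; rewrite /preimage/= in_itv/= andbT//.
Qed.

Lemma bounded_measurable_cst c : bounded_measurable (fun=> c).
Proof. by split; [exact: measurable_cst|exists `|c|]. Qed.

Lemma bounded_measurableD f g : bounded_measurable f ->
  bounded_measurable g -> bounded_measurable (fun x => f x + g x).
Proof.
move=> [mf [C fC]] [mg [D gD]]; split; first exact: measurable_funD.
by exists (C + D) => x; rewrite (le_trans (ler_normD _ _))// lerD.
Qed.

Lemma bounded_measurableM f g : bounded_measurable f ->
  bounded_measurable g -> bounded_measurable (fun x => f x * g x).
Proof.
move=> [mf [C fC]] [mg [D gD]]; split; first exact: measurable_funM.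
by exists (C * D) => x; rewrite normrM ler_pM.
Qed.

Lemma bounded_measurableN f : bounded_measurable f ->
  bounded_measurable (fun x => - f x).
Proof.
move=> [mf [C fC]]; split; first exact: measurableT_comp.
by exists C => x; rewrite normrN.
Qed.

Lemma bounded_measurableB f g : bounded_measurable f ->
  bounded_measurable g -> bounded_measurable (fun x => f x - g x).
Proof.
by move=> bf bg; apply: bounded_measurableD => //; exact: bounded_measurableN.
Qed.

Lemma bounded_measurable_norm f : bounded_measurable f ->
  bounded_measurable (fun x => `|f x|).
Proof.
move=> [mf [C fC]]; split; first exact: measurableT_comp.
by exists C => x; rewrite normr_id.
Qed.

Lemma bounded_measurable_max f g : bounded_measurable f ->
  bounded_measurable g -> bounded_measurable (fun x => Num.max (f x) (g x)).
Proof.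
move=> [mf [C fC]] [mg [D gD]]; split; first exact: measurable_maxr.
exists (Num.max C D) => x.
by rewrite maxEle; case: ifP => _; rewrite le_max ?fC ?gD ?orbT.
Qed.

Lemma bounded_measurable_indic A : measurable A ->
  bounded_measurable (\1_A : X -> R).
Proof.
move=> mA; split; first exact: measurable_indic.
by exists 1 => x; rewrite indicE; case: (_ \in _); rewrite ?normr1 ?normr0.
Qed.

Lemma bounded_measurable_comp f (T : X -> X) : measurable_fun setT T ->
  bounded_measurable f -> bounded_measurable (f \o T).
Proof.
move=> mT [mf [C fC]]; split; first exact: measurableT_comp.
by exists C => x /=.
Qed.

Lemma bounded_measurable_sum (I : Type) (r : seq I) (F : I -> X -> R) :
  (forall i, bounded_measurable (F i)) ->
  bounded_measurable (fun x => \sum_(i <- r) F i x).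
Proof.
move=> bF; elim: r => [|i r IH].
  by under eq_fun do rewrite big_nil; exact: bounded_measurable_cst.
by under eq_fun do rewrite big_cons; exact: bounded_measurableD.
Qed.

Lemma bounded_measurable_integrable f : bounded_measurable f ->
  mu.-integrable setT (EFin \o f).
Proof.
move=> [mf [C fC]]; apply: measurable_bounded_integrable => //.
  by rewrite [X in (X < _)%E]probability_setT ltry.
exists C; split; first by rewrite num_real.
by move=> D CD x _ /=; rewrite (le_trans (fC x))// ltW.
Qed.

Lemma expD f g : bounded_measurable f -> bounded_measurable g ->
  \int[mu]_x (f x + g x) = \int[mu]_x f x + \int[mu]_x g x.
Proof.
by move=> ? ?; rewrite RintegralD//; exact: bounded_measurable_integrable.
Qed.

Lemma expB f g : bounded_measurable f -> bounded_measurable g ->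
  \int[mu]_x (f x - g x) = \int[mu]_x f x - \int[mu]_x g x.
Proof.
by move=> ? ?; rewrite RintegralB//; exact: bounded_measurable_integrable.
Qed.

Lemma expZ c f : bounded_measurable f ->
  \int[mu]_x (c * f x) = c * \int[mu]_x f x.
Proof.
by move=> ?; rewrite RintegralZl//; exact: bounded_measurable_integrable.
Qed.

Lemma exp_cst c : \int[mu]_x c = c.
Proof.
rewrite Rintegral_cst// [X in fine X](_ : _ = 1%E) ?mulr1//.
exact: probability_setT.
Qed.

Lemma exp_indic A : measurable A -> \int[mu]_x (\1_A x : R) = fine (mu A).
Proof. by move=> mA; rewrite /Rintegral integral_indic// setIT. Qed.

Lemma exp_sum (I : Type) (r : seq I) (F : I -> X -> R) :
  (forall i, bounded_measurable (F i)) ->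
  \int[mu]_x (\sum_(i <- r) F i x) = \sum_(i <- r) \int[mu]_x F i x.
Proof.
move=> bF; elim: r => [|i r IH].
  by rewrite big_nil; under eq_Rintegral do rewrite big_nil; exact: exp_cst.
under eq_Rintegral do rewrite big_cons.
by rewrite expD//; [rewrite IH big_cons|exact: bounded_measurable_sum].
Qed.

Lemma le_exp f g : bounded_measurable f -> bounded_measurable g ->
  (forall x, f x <= g x) -> \int[mu]_x f x <= \int[mu]_x g x.
Proof.
by move=> ? ? fg; apply: le_Rintegral => //; exact: bounded_measurable_integrable.
Qed.

Lemma ler_norm_exp f : bounded_measurable f ->
  `|\int[mu]_x f x| <= \int[mu]_x `|f x|.
Proof.
by move=> ?; apply: le_normr_Rintegral => //; exact: bounded_measurable_integrable.
Qed.

(** The form in which exceptional sets are discarded: the difference is supported in [A], where it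
    is at most [2 * C]. *)
Lemma norm_expB_le f g C A : measurable A -> bounded_measurable f ->
  bounded_measurable g -> 0 <= C -> (forall x, `|f x| <= C) ->
  (forall x, `|g x| <= C) ->
  (forall x, ~ A x -> f x = g x) ->
  `|\int[mu]_x f x - \int[mu]_x g x| <= 2 * C * fine (mu A).
Proof.
move=> mA bf bg C0 fC gC fg; rewrite -expB//.
apply: (le_trans (ler_norm_exp (bounded_measurableB bf bg))).
rewrite -exp_indic// -expZ; last exact: bounded_measurable_indic.
apply: le_exp => [||x].
- exact/bounded_measurable_norm/bounded_measurableB.
- apply: bounded_measurableM; first exact: bounded_measurable_cst.
  exact: bounded_measurable_indic.
have [Ax|nAx] := boolP (x \in A).
  rewrite indicE Ax mulr1 (le_trans (ler_normB _ _))//.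
  by rewrite mulr_natl mulr2n lerD.
rewrite fg ?subrr ?normr0; first by rewrite mulr_ge0 ?mulr_ge0// indicE.
by move/negP: nAx; rewrite inE.
Qed.

Lemma measure_bigcap0_lt (F : (set X)^nat) e :
  (forall n, measurable (F n)) -> (forall n, F n.+1 `<=` F n) ->
  mu (\bigcap_n F n) = 0%E -> 0 < e -> exists n, fine (mu (F n)) < e.
Proof.
move=> mF dF F0 e0.
have : mu \o F @ \oo --> mu (\bigcap_n F n).
  apply: nonincreasing_cvg_mu => //.
  - exact: le_lt_trans (probability_le1 _ (mF 0%N)) (ltry _).
  - exact: bigcapT_measurable.
  - by apply/nonincreasing_seqP => n; apply/subsetPset; exact: dF.
rewrite F0 => /fine_cvgP[_ /cvgrPdist_lt/(_ e e0)[n _ /(_ n (leqnn n))/= h]].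
by exists n; move: h; rewrite sub0r normrN; apply: le_lt_trans; rewrite ler_norm.
Qed.

Lemma fine_measureU_le (A B : set X) : measurable A -> measurable B ->
  fine (mu (A `|` B)) <= fine (mu A) + fine (mu B).
Proof.
move=> mA mB; rewrite -lee_fin EFinD !fineK ?fin_num_measure//.
- exact: measureU2.
- exact: measurableU.
Qed.

Lemma fine_measure_le (A B : set X) : measurable A -> measurable B ->
  A `<=` B -> fine (mu A) <= fine (mu B).
Proof.
by move=> mA mB AB; rewrite fine_le ?fin_num_measure// le_measure ?inE.
Qed.

End bounded_functions.

Section measurable_iterates.
Context (dX : measure_display) (X : measurableType dX) (T : X -> X).
Hypothesis mT : measurable_fun setT T.

Lemma measurable_iter n : measurable_fun setT (iter n T).
Proof.
elim: n => [|n IH] /=; first exact: measurable_id.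
exact: measurableT_comp IH.
Qed.

Lemma measurable_iter_preimage n A : measurable A ->
  measurable (iter n T @^-1` A).
Proof. by move=> mA; rewrite -[X in measurable X]setTI; exact: measurable_iter. Qed.

End measurable_iterates.

Section measure_preserving_iterates.
Context (R : realType) (dX : measure_display) (X : measurableType dX).
Variables (mu : probability X R) (T : X -> X).
Hypothesis T_mp : measure_preserving mu T.
Let mT : measurable_fun setT T := T_mp.1.

Lemma measure_iter_preimage n A : measurable A -> mu (iter n T @^-1` A) = mu A.
Proof.
move=> mA; elim: n => [//|n IH].
rewrite -[RHS]IH -[RHS]T_mp.2; last exact: (measurable_iter_preimage mT).
by congr (mu _); apply/seteqP; split => x; rewrite /preimage/= -iterSr.
Qed.

Lemma exp_comp_iter n f : bounded_measurable f ->
  \int[mu]_x f (iter n T x) = \int[mu]_x f x.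
Proof.
move=> bf; have bfT := bounded_measurable_comp (measurable_iter mT n) bf.
rewrite /Rintegral; congr fine.
have -> : (\int[mu]_x (f x)%:E =
    \int[pushforward mu (iter n T)]_x (f x)%:E)%E.
  apply: eq_measure_integral; first exact: (measurable_iter mT).
  by move=> mTn A mA _; apply/esym; exact: measure_iter_preimage.
rewrite integral_pushforward//=; first exact: (measurable_iter mT).
- by apply/measurable_EFinP; case: bf.
- by rewrite preimage_setT; exact: (bounded_measurable_integrable _ bfT).
Qed.

End measure_preserving_iterates.

(* Maximum over the Birkhoff sums of length at most [n], the empty one
   included. *)
Fixpoint max_birkhoff (R : realType) (X : Type) (T : X -> X) (g : X -> R)
    (n : nat) (x : X) : R :=
  if n is n'.+1 then Num.max 0 (g x + max_birkhoff T g n' (T x)) else 0.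

Definition visits (X : Type) (T : X -> X) (M : set X) (k : nat) (x : X) : nat :=
  \sum_(j < k) (iter j T x \in M).

Section maximal_ergodic.
Context (R : realType) (dX : measure_display) (X : measurableType dX).
Variables (mu : probability X R) (T : X -> X) (g : X -> R).
Hypothesis T_mp : measure_preserving mu T.
Hypothesis bg : bounded_measurable g.

Lemma max_birkhoff_ge0 n x : 0 <= max_birkhoff T g n x.
Proof. by case: n => [//|n] /=; rewrite le_max lexx. Qed.

Lemma max_birkhoff_leS n x : max_birkhoff T g n x <= max_birkhoff T g n.+1 x.
Proof.
elim: n x => [|n IH] x; first exact: max_birkhoff_ge0.
by rewrite [leLHS]/= [leRHS]/= ge_max !le_max lexx /= lerD2l IH orbT.
Qed.

Lemma bounded_measurable_max_birkhoff n :
  bounded_measurable (max_birkhoff T g n).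
Proof.
elim: n => [|n IH] /=; first exact: bounded_measurable_cst.
apply: bounded_measurable_max; first exact: bounded_measurable_cst.
apply: bounded_measurableD => //; apply: (bounded_measurable_comp _ IH).
by case: T_mp.
Qed.

Lemma sum_le_max_birkhoff n x :
  \sum_(j < n) g (iter j T x) <= max_birkhoff T g n x.
Proof.
elim: n x => [|n IH] x; first by rewrite big_ord0.
rewrite big_ord_recl /= le_max; apply/orP; right.
rewrite lerD2l; apply: le_trans (IH (T x)).
by rewrite le_eqVlt; apply/orP; left; apply/eqP/eq_bigr => i _; rewrite -iterSr.
Qed.

(** Garsia's argument. Write [P n] for [max_birkhoff T g n]. Where [P n.+1] is positive it equals
    [g + P n \o T], so [g >= P n - P n \o T] there; elsewhere [P n <= P n.+1 <= 0] and the same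
    difference is at most 0. Its integral vanishes by invariance. *)
Lemma maximal_ergodic n :
  0 <= \int[mu]_x (g x * \1_[set y | 0 < max_birkhoff T g n y] x).
Proof.
case: n => [|n].
  under eq_Rintegral => x _.
    rewrite (_ : \1__ x = 0) ?mulr0; last first.
      by rewrite indicE/= memNset//= ltxx.
    over.
  by rewrite exp_cst.
have bP := bounded_measurable_max_birkhoff n.
have E0 : \int[mu]_x (max_birkhoff T g n x - max_birkhoff T g n (T x)) = 0.
  rewrite expB//; last first.
    by apply: (bounded_measurable_comp _ bP); case: T_mp.
  have E : \int[mu]_x max_birkhoff T g n (T x) = \int[mu]_x max_birkhoff T g n x.
    exact: (exp_comp_iter T_mp 1 bP).
  by rewrite E subrr.
rewrite -[leLHS]E0; apply: le_exp.
- by apply: bounded_measurableB => //; apply: (bounded_measurable_comp _ bP); case: T_mp.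
- apply: bounded_measurableM => //; apply: bounded_measurable_indic.
  by apply: measurable_superlevel; case: (bounded_measurable_max_birkhoff n.+1).
move=> x; rewrite indicE; have := max_birkhoff_leS n x.
have := max_birkhoff_ge0 n (T x); rewrite [max_birkhoff T g n.+1]lock.
case: (ltP 0 (max_birkhoff T g n.+1 x)) => [P0|P0]; rewrite -lock.
  rewrite mem_set// mulr1 => _; move: P0 => /=; rewrite lt_max ltxx/= => s0;
  by rewrite (max_r (ltW s0)) lerBlDr.
rewrite memNset ?mulr0; last by apply/negP; rewrite -leNgt.
by move=> PT Pn; rewrite subr_le0 (le_trans Pn)// (le_trans P0).
Qed.

End maximal_ergodic.

Section visits_theory.
Context (dX : measure_display) (X : measurableType dX) (T : X -> X).
Implicit Type A M : set X.

Lemma measurable_visits M k : measurable_fun setT T -> measurable M ->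
  measurable_fun setT (visits T M k).
Proof.
move=> mT mM; elim: k => [|k IH].
  by rewrite /visits; under eq_fun do rewrite big_ord0; exact: measurable_cst.
rewrite /visits; under eq_fun do rewrite big_ord_recr/=.
apply: measurable_fun_addn => //.
apply: (measurableT_comp (f := nat_of_bool)) => //.
apply: (measurable_fun_bool true).
rewrite setTI (_ : _ @^-1` _ = iter k T @^-1` M).
  exact: measurable_iter_preimage.
by apply/seteqP; split => x /=; [move/set_mem|move/mem_set].
Qed.

Lemma visits_Sr A k x :
  visits T A k.+1 x = (visits T A k x + (iter k T x \in A))%N.
Proof. by rewrite /visits big_ord_recr. Qed.

Lemma visits_Sl A k x :
  visits T A k.+1 x = ((x \in A) + visits T A k (T x))%N.
Proof.
rewrite /visits big_ord_recl /=; congr addn.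
by apply: eq_bigr => i _; rewrite -iterSr.
Qed.

Lemma visits_le_index A k x : (visits T A k x <= k)%N.
Proof.
elim: k => [|k IH]; first by rewrite /visits big_ord0.
by rewrite visits_Sr -addn1 leq_add// leq_b1.
Qed.

Lemma leq_visits A k l x : (k <= l)%N -> (visits T A k x <= visits T A l x)%N.
Proof.
move=> /subnK <-; elim: (l - k)%N => [//|n IH]; rewrite addSn visits_Sr.
exact: leq_trans IH (leq_addr _ _).
Qed.

Lemma eq_visits A k l x : (k <= l)%N ->
  (forall j, (k <= j < l)%N -> ~ A (iter j T x)) ->
  visits T A k x = visits T A l x.
Proof.
move=> /subnK <-; elim: (l - k)%N => [//|n IH] h.
rewrite addSn visits_Sr memNset ?addn0; last first.
  by apply: h; rewrite leq_addl addSn ltnS leqnn.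
by apply: IH => j /andP[kj jl]; apply: h; rewrite kj addSn ltnS ltnW.
Qed.

End visits_theory.

Section ergodic_visits.
Context (R : realType) (dX : measure_display) (X : measurableType dX).
Variables (mu : probability X R) (T : X -> X).
Hypothesis T_mp : measure_preserving mu T.
Hypothesis T_erg : ergodic mu T.
Let mT : measurable_fun setT T := T_mp.1.

(* Excess over [c * k] shifts by a bounded amount along [T], so this set is
   strictly invariant. *)
Let unbounded_excess (M : set X) (c : R) : set X :=
  \bigcap_(B : nat) \bigcup_k
    [set x | B%:R < (visits T M k x)%:R - c * k%:R].

Let measurable_excess (M : set X) (c B : R) k : measurable M ->
  measurable [set x | B < (visits T M k x)%:R - c * k%:R].
Proof.
move=> mM; rewrite (_ : [set x | _] =
    visits T M k @^-1` [set m | B < m%:R - c * k%:R])//.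
by rewrite -[X in measurable X]setTI; exact: measurable_visits.
Qed.

Let measurable_unbounded_excess M c : measurable M ->
  measurable (unbounded_excess M c).
Proof.
move=> mM; apply: bigcapT_measurable => B; apply: bigcupT_measurable => k.
exact: measurable_excess.
Qed.

Let unbounded_excess_inv M c : 0 <= c -> T @^-1` unbounded_excess M c = unbounded_excess M c.
Proof.
move=> c0; apply/seteqP; split => x /= h B _.
  (* Going from [T x] back to [x] lengthens the orbit by one step, which lowers the excess by at
     most [c]; the surplus in the level pays for it. *)
  have [k _ /=] := h (B + (Num.truncn c).+1)%N I; rewrite natrD => hk.
  have ct : c < (Num.truncn c).+1%:R by exact: truncnS_gt.
  exists k.+1 => //=; rewrite visits_Sl natrD -natr1 mulrDr mulr1.
  have : 0 <= (x \in M)%:R :> R by [].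
  lra.
have [k _ /=] := h B.+1 I; case: k => [|k].
  by rewrite /visits big_ord0 mulr0 subrr ltNge ler0n.
rewrite visits_Sl natrD -!natr1 mulrDr mulr1 => hk; exists k => //=.
have : (x \in M)%:R <= 1 :> R by rewrite lern1; case: (_ \in _).
lra.
Qed.

(** By ergodicity the mass is 0 or 1. If it were 1, almost every point would have a positive
    Birkhoff sum of [\1_M - c], so the sets [A n] would increase to a set of full measure; but the
    maximal inequality gives [c * mu (A n) <= mu M], and in the limit [c <= mu M]. *)
Lemma unbounded_excess0 M c : measurable M -> fine (mu M) < c ->
  mu (unbounded_excess M c) = 0%E.
Proof.
move=> mM pc.
have c0 : 0 <= c by apply: le_trans (ltW pc); rewrite fine_ge0.
have [//|L1] := T_erg (measurable_unbounded_excess c mM) (unbounded_excess_inv M c0).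
pose g x : R := \1_M x - c.
have bM := bounded_measurable_indic R mM.
have bg : bounded_measurable g.
  by apply: bounded_measurableB => //; exact: bounded_measurable_cst.
pose A n := [set y | 0 < max_birkhoff T g n y].
have mA n : measurable (A n).
  by apply: measurable_superlevel; case: (bounded_measurable_max_birkhoff T_mp bg n).
have A_le n : c * fine (mu (A n)) <= fine (mu M).
  have := maximal_ergodic T_mp bg n.
  rewrite -(exp_indic mu mM) -(exp_indic mu (mA n)) -expZ; last first.
    exact: bounded_measurable_indic.
  rewrite -(subr_ge0 (\int[mu]_x (c * _))) -expB//; last first.
    apply: bounded_measurableM; first exact: bounded_measurable_cst.
    exact: bounded_measurable_indic.
  move/le_trans; apply; apply: le_exp.
  - by apply: bounded_measurableM => //; exact/bounded_measurable_indic/mA.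
  - apply: bounded_measurableB => //.
    apply: bounded_measurableM; first exact: bounded_measurable_cst.
    exact: bounded_measurable_indic.
  - move=> x; rewrite /g mulrBl lerD2r !indicE.
    by do 2 case: (_ \in _); rewrite ?mulr1 ?mulr0 ?mul0r.
have mL := measurable_unbounded_excess c mM.
have cap : mu (\bigcap_n ~` A n) = 0%E.
  apply: (@subset_measure0 _ _ _ mu _ (~` unbounded_excess M c)) => //.
  - by apply: bigcapT_measurable => n; exact: measurableC.
  - exact: measurableC.
  - move=> x h /(_ 0%N I)[k _ /= hk]; apply: (h k I) => /=.
    apply: lt_le_trans (sum_le_max_birkhoff T g k x).
    apply: lt_le_trans hk _; rewrite /g sumrB sumr_const card_ord -(mulr_natr c).
    rewrite /visits natr_sum lerD2r.
    by rewrite le_eqVlt; apply/orP; left; apply/eqP/eq_bigr => i _; rewrite indicE.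
  - by rewrite [LHS]probability_setC// L1 subee.
have c_gt0 : 0 < c by apply: le_lt_trans pc; rewrite fine_ge0.
have [n] : exists n, fine (mu (~` A n)) < (c - fine (mu M)) / c.
  apply: measure_bigcap0_lt => //.
  - by move=> n; exact: measurableC.
  - move=> n; apply: subsetC => x /= h.
    exact: lt_le_trans h (max_birkhoff_leS _ _ _ _).
  - by rewrite divr_gt0// subr_gt0.
rewrite [X in fine X](_ : _ = 1 - mu (A n))%E; last exact: probability_setC.
rewrite fineB ?fin_num_measure//= ltr_pdivlMr// => h.
move: h (A_le n).
rewrite mulrBl mul1r [_ * c]mulrC => h1 h2.
by move: (lt_le_trans h1 (lerB (lexx c) h2)); rewrite ltxx.
Qed.

(** The rate [c] is halfway between [mu M] and [mu M + e]. The sets where some excess over [c * k]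
    passes [B] decrease to a null set, so some [B] is passed only on a set of mass below [d]; once
    [k] is larger than [B / (e / 2)], a deviation by [e * k] forces an excess above [B]. *)
Let visits_upper M e d : measurable M -> 0 < e -> 0 < d -> exists k0, forall k,
  (k0 <= k)%N ->
  fine (mu [set x | e * k%:R < (visits T M k x)%:R - fine (mu M) * k%:R]) <= d.
Proof.
move=> mM e0 d0; pose c := fine (mu M) + e / 2.
have pc : fine (mu M) < c by rewrite /c ltrDl divr_gt0.
pose F B := \bigcup_k [set x | (B%:R : R) < (visits T M k x)%:R - c * k%:R].
have mF B : measurable (F B).
  by apply: bigcupT_measurable => k; exact: measurable_excess.
have [B hB] : exists B, fine (mu (F B)) < d.
  apply: measure_bigcap0_lt => //; last exact: unbounded_excess0.
  move=> B x [k _ /= h]; exists k => //=; apply: lt_trans h.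
  by rewrite ltr_nat.
exists (Num.truncn (B%:R / (e / 2))).+1 => k hk.
apply: le_trans (ltW hB); apply: fine_measure_le => //.
  rewrite (_ : [set x | _] = visits T M k @^-1`
    [set m | e * k%:R < m%:R - fine (mu M) * k%:R])//.
  by rewrite -[X in measurable X]setTI; exact: measurable_visits.
move=> x /= h; exists k => //=; rewrite /c.
have : B%:R / (e / 2) < k%:R.
  by apply: lt_le_trans (truncnS_gt _) _; rewrite ler_nat.
rewrite ltr_pdivrMr ?divr_gt0//; move: h; set v := _%:R; lra.
Qed.

Let visitsC M k x : (visits T M k x + visits T (~` M) k x = k)%N.
Proof.
rewrite /visits -big_split/= -[RHS]card_ord -sum1_card; apply: eq_bigr => i _.
by rewrite in_setC; case: (_ \in M).
Qed.

(** A deficit of visits to [M] is an excess of visits to its complement, so the one-sided bound is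
    applied to both sets. *)
Lemma visits_in_probability M e d : measurable M -> 0 < e -> 0 < d ->
  exists k0, forall k, (k0 <= k)%N ->
  fine (mu [set x | e * k%:R < `|(visits T M k x)%:R - fine (mu M) * k%:R|]) <= d.
Proof.
move=> mM e0 d0; have d20 : 0 < d / 2 by rewrite divr_gt0.
have [k1 h1] := visits_upper mM e0 d20.
have [k2 h2] := visits_upper (measurableC mM) e0 d20.
exists (maxn k1 k2) => k; rewrite geq_max => /andP[/h1 {}h1 /h2 {}h2].
have mV (N : set X) (q : R) : measurable N ->
    measurable [set x | e * k%:R < (visits T N k x)%:R - q * k%:R].
  move=> mN; rewrite (_ : [set x | _] = visits T N k @^-1`
    [set m | e * k%:R < m%:R - q * k%:R])//.
  by rewrite -[X in measurable X]setTI; exact: measurable_visits.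
rewrite (splitr d); apply: le_trans (lerD h1 h2).
apply: le_trans (fine_measureU_le mu _ _); [|exact: mV|exact/mV/measurableC].
have E : fine (mu (~` M)) = 1 - fine (mu M).
  rewrite [X in fine X](_ : _ = 1 - mu M)%E; last exact: probability_setC.
  by rewrite fineB ?fin_num_measure.
apply: fine_measure_le.
- rewrite (_ : [set x | _] = visits T M k @^-1`
    [set m | e * k%:R < `|m%:R - fine (mu M) * k%:R|])//.
  by rewrite -[X in measurable X]setTI; exact: measurable_visits.
- by apply: measurableU; [exact: mV|exact/mV/measurableC].
- move=> x /=; rewrite lter_normr E => /orP[h|h]; [by left|right].
  have := visitsC M k x; move/(congr1 (fun n => n%:R : R)); rewrite natrD.
  move: h; set a := (visits T M k x)%:R; set b := (visits T (~` M) k x)%:R.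
  lra.
Qed.

End ergodic_visits.

(** * Visits of the original and of the induced orbit *)

Section return_map_theory.
Context (dX : measure_display) (X : measurableType dX) (T : X -> X) (M : set X).
Local Notation F := (return_map M T).

Variant return_time_spec (x : X) : nat -> Prop :=
| NoReturn of (forall j, (0 < j)%N -> ~ M (iter j T x)) : return_time_spec x 0
| Return r of (0 < r)%N & M (iter r T x) &
    (forall j, (0 < j < r)%N -> ~ M (iter j T x)) : return_time_spec x r.

Lemma return_timeP x : return_time_spec x (return_time M T x).
Proof.
rewrite /return_time; case: pselect => [h|h].
  case: ex_minnP => r /andP[r0 /asboolP Mr] rmin; constructor => //.
  move=> j /andP[j0 jr] Mj; have := rmin j; rewrite j0 asboolT// => /(_ isT).
  by rewrite leqNgt jr.
by constructor => j j0 Mj; apply: h; exists j; rewrite j0 asboolT.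
Qed.

(** Strong induction on the time, cutting the orbit at the first return: no visit occurs strictly in
    between, so one step of [F] accounts for exactly one visit. The count includes time 0 and
    excludes time [k]. *)
Lemma iter_return_map_visits k x : M x -> M (iter k T x) ->
  iter (visits T M k x) F x = iter k T x.
Proof.
elim/ltn_ind: k x => -[|k] IH x Mx Mk; first by rewrite /visits big_ord0.
rewrite visits_Sl mem_set// add1n iterSr.
case rE : _ / (return_timeP x) => [h|r r0 Mr rmin].
  by case: (h k.+1).
have rk : (r <= k.+1)%N by rewrite leqNgt; apply/negP => kr; apply: (rmin k.+1).
have FE : F x = iter r T x by rewrite /return_map rE.
case: r => // r in r0 Mr rmin rE rk FE *.
have -> : visits T M k (T x) = visits T M (k - r) (iter r.+1 T x).
  have {}rmin : forall j, (j < r)%N -> ~ M (iter j T (T x)).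
    by move=> j jr; rewrite -iterSr; apply: rmin.
  rewrite iterSr; move: rmin rk; clear; rewrite ltnS.
  elim: r k (T x) => [|r IH] k y rmin; first by rewrite subn0.
  case: k => // k rk; rewrite visits_Sl memNset ?add0n; last exact: (rmin 0%N).
  rewrite subSS iterSr -IH// => j jr.
  by rewrite -iterSr; apply: rmin.
have E : iter k.+1 T x = iter (k - r) T (iter r.+1 T x).
  by rewrite -iterD addnS subnK.
rewrite FE E IH -?E//; rewrite ltnS; exact: leq_subr.
Qed.

(** At a time spent in [M] the orbit of [F] is at the same point, so both sides grow together; at
    other times neither moves. The identity is exact: the whole error of the comparison lies in the
    clock [visits T M k x] and in the visits outside [M]. *)
Lemma visits_return_map A k x : M x ->
  visits T (A `&` M) k x = visits F A (visits T M k x) x.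
Proof.
move=> Mx; elim: k => [|k IH]; first by rewrite /visits !big_ord0.
rewrite visits_Sr (visits_Sr T M) IH; have [Mk|nMk] := pselect (M (iter k T x)).
  rewrite [_ \in M]mem_set// addn1 visits_Sr iter_return_map_visits//.
  by congr (_ + nat_of_bool _)%N; rewrite in_setI [_ \in M]mem_set// andbT.
by rewrite [_ \in M]memNset// addn0 memNset ?addn0// => -[].
Qed.

Lemma measurable_return_time j : measurable_fun setT T -> measurable M ->
  measurable [set x | return_time M T x = j].
Proof.
move=> mT mM.
pose B j := [set x | M (iter j T x)] `&`
  \bigcap_i [set x | (0 < i < j)%N -> ~ M (iter i T x)].
have mB i : measurable (B i).
  apply: measurableI; first exact: (measurable_iter_preimage mT).
  apply: bigcapT_measurable => l.
  have [il|nil] := boolP (0 < l < i)%N.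
    rewrite (_ : [set x | _] = ~` (iter l T @^-1` M)).
      exact/measurableC/(measurable_iter_preimage mT).
    by apply/seteqP; split => x /=; [move=> /(_ isT)|move=> h _].
  by rewrite (_ : [set x | _] = setT)//; apply/seteqP; split.
have BE i : (0 < i)%N -> [set x | return_time M T x = i] = B i.
  move=> i0; apply/seteqP; split => x /=.
    case: return_timeP => [_ i00|r r0 Mr rmin <-]; first by rewrite -i00 in i0.
    by split => // l _; exact: rmin.
  case=> Mi imin; case: return_timeP => [/(_ i i0)//|r r0 Mr rmin].
  case: (ltngtP r i) => // ri.
    by have := imin r I => /=; rewrite r0 ri => /(_ isT).
  by have := rmin i; rewrite i0 ri => /(_ isT).
case: j => [|j]; last by rewrite BE.
rewrite (_ : [set x | _] = ~` \bigcup_i B i.+1).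
  by apply: measurableC; exact: bigcupT_measurable.
apply/seteqP; split => x /=.
  by move=> r0 [i _]; rewrite -BE//= r0.
move=> h; case E : (return_time M T x) => [//|i]; case: h; exists i => //.
by rewrite -BE.
Qed.

Lemma measurable_return_map : measurable_fun setT T -> measurable M ->
  measurable_fun setT F.
Proof.
move=> mT mM _ A mA; rewrite setTI.
rewrite (_ : F @^-1` A =
    \bigcup_j ([set x | return_time M T x = j] `&` iter j T @^-1` A)).
  apply: bigcupT_measurable => j; apply: measurableI.
    exact: measurable_return_time.
  exact: (measurable_iter_preimage mT).
apply/seteqP; split => x; rewrite /preimage/=.
  by move=> Ax; exists (return_time M T x).
by move=> [j _ /= [<-]].
Qed.

End return_map_theory.

(** * Rescaled time intervals as ranges of indices *)

Section counting_hits.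
Context (R : realType).

(** The number of naturals [j] with [j < s], for [s] of any sign; half-open real intervals then
    become half-open index ranges. *)
Definition ceiln (s : R) : nat := `|Num.max (0 : int) (Num.ceil s)|%N.

Lemma ltn_ceiln j s : (j < ceiln s)%N = (j%:R < s).
Proof.
rewrite /ceiln -ltz_nat gez0_abs ?le_max ?lexx// lt_max (_ : (Posz j < 0) = false)// orFb.
by rewrite ltNge ceil_le_int -ltNge.
Qed.

Lemma leq_ceiln k s : (ceiln s <= k)%N = (s <= k%:R).
Proof. by rewrite leqNgt ltn_ceiln -leNgt. Qed.

Lemma ceiln_ge s : s <= (ceiln s)%:R.
Proof. by rewrite -leq_ceiln. Qed.

Lemma le_ceiln s t : s <= t -> (ceiln s <= ceiln t)%N.
Proof. by move=> st; rewrite leq_ceiln (le_trans st)// ceiln_ge. Qed.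

Lemma ceiln0 : ceiln 0 = 0%N.
Proof. by apply/eqP; rewrite -leqn0 leq_ceiln. Qed.

Lemma ceiln_lt s : 0 <= s -> (ceiln s)%:R < s + 1.
Proof.
move=> s0; case E : (ceiln s) => [|k]; first by rewrite ltr_wpDl.
by rewrite -natr1 ltrD2r -ltn_ceiln E.
Qed.

Lemma dilate_ico (v a b : R) j : 0 < v ->
  dilate v [set x | a <= x < b] j%:R <->
  (ceiln (v * a) <= j < ceiln (v * b))%N.
Proof.
move=> v0; rewrite leq_ceiln ltn_ceiln; split.
  by move=> [x /= /andP[ax xb] <-]; rewrite ler_pM2l// ltr_pM2l// ax.
move=> /andP[aj jb]; exists (v^-1 * j%:R); last first.
  by rewrite mulVKf ?gt_eqF.
by rewrite /= ler_pdivlMl// ltr_pdivrMl// aj jb.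
Qed.

(** The degenerate time scale that arises when exceedances have measure 0: a nonempty [J] collapses
    to time 0. *)
Lemma dilate0 (J : set R) j : dilate 0 J j%:R <-> (j < `[< J !=set0 >])%N.
Proof.
split=> [[x Jx]|].
  rewrite mul0r => /esym/eqP; rewrite pnatr_eq0 => /eqP ->.
  by rewrite asboolT//; exists x.
case: asboolP => //; rewrite ltnS leqn0 => -[x Jx] /eqP ->.
by exists x => //; rewrite mul0r.
Qed.

End counting_hits.

Section rare_event_visits.
Context (R : realType) (dX : measure_display) (X : measurableType dX).
Variables (mu : probability X R) (T : X -> X) (phi : X -> \bar R) (u : R).
Let U := [set x | (u%:E < phi x)%E].
Let v := (fine (mu U))^-1.

(** Turns the point process into differences of visit counts. When [e <= s] the window is empty and
    truncated subtraction gives 0 as well. *)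
Lemma rare_event_process_visits J (s e : nat) x :
  (forall j, dilate v J j%:R <-> (s <= j < e)%N) ->
  rare_event_process mu T phi u J x =
  (visits T U e x - visits T U s x)%N%:R%:E.
Proof.
move=> Jse; rewrite /rare_event_process.
have -> : [set j | dilate (fine (mu [set x | (u%:E < phi x)%E]))^-1 J j%:R] =
    [set` index_iota s e].
  apply/seteqP; split => j /=; rewrite mem_index_iota => h; exact/Jse.
rewrite esum_fset; [|exact: finite_seq|by move=> i _; rewrite lee_fin].
rewrite -fsbig_seq ?iota_uniq//= sumEFin; congr EFin.
under eq_bigr => j _.
  rewrite (_ : \1__ x = (iter j T x \in U)%:R); last first.
    by rewrite indicE; congr (nat_of_bool _)%:R; apply/asbool_equiv_eq.
  over.
rewrite -natr_sum; congr _%:R.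
have [se|es] := leqP s e.
  apply/eqP; rewrite -(eqn_add2r (visits T U s x)) subnK ?leq_visits//.
  rewrite /visits -!(big_mkord xpredT (fun j => nat_of_bool (iter j T x \in U))).
  by rewrite addnC -big_cat_nat.
have es' := ltnW es.
rewrite big_geq//; apply/esym/eqP; rewrite subn_eq0; exact: leq_visits.
Qed.

End rare_event_visits.

Section hitting_sets.
Context (R : realType) (dX : measure_display) (X : measurableType dX).
Variables (mu : probability X R) (T : X -> X).
Hypothesis T_mp : measure_preserving mu T.
Let mT : measurable_fun setT T := T_mp.1.

Definition hits_between (A : set X) (s n : nat) : set X :=
  [set x | exists2 j, (s <= j < s + n)%N & A (iter j T x)].

Lemma hits_between0 A s : hits_between A s 0 = set0.
Proof.
apply/seteqP; split => x //= -[j /andP[sj]].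
by rewrite addn0 ltnNge sj.
Qed.

Lemma hits_betweenS A s n :
  hits_between A s n.+1 = hits_between A s n `|` iter (s + n) T @^-1` A.
Proof.
apply/seteqP; split => x /=.
  move=> [j /andP[sj]]; rewrite addnS ltnS leq_eqVlt => /predU1P[->|jn] Aj.
    by right.
  by left; exists j => //; rewrite sj.
move=> [[j /andP[sj jn] Aj]|Ax].
  by exists j => //; rewrite sj addnS ltnS ltnW.
by exists (s + n)%N => //; rewrite leq_addr addnS /=.
Qed.

Lemma measurable_hits_between A s n : measurable A ->
  measurable (hits_between A s n).
Proof.
move=> mA; elim: n => [|n IH]; first by rewrite hits_between0.
by rewrite hits_betweenS; apply: measurableU => //; exact: measurable_iter_preimage.
Qed.

Lemma measure_hits_between_le A s n : measurable A ->
  fine (mu (hits_between A s n)) <= n%:R * fine (mu A).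
Proof.
move=> mA; elim: n => [|n IH]; first by rewrite hits_between0 measure0 mul0r.
rewrite hits_betweenS; apply: le_trans (fine_measureU_le mu _ _) _.
- exact: measurable_hits_between.
- exact: measurable_iter_preimage.
- by rewrite -natr1 mulrDl mul1r lerD// measure_iter_preimage.
Qed.

End hitting_sets.

Section induced_counting.
Context (R : realType) (dX : measure_display) (X : measurableType dX).
Variables (mu : probability X R) (T : X -> X).
Hypothesis T_mp : measure_preserving mu T.
Hypothesis T_erg : ergodic mu T.
Variable M : set X.
Hypothesis mM : measurable M.
Hypothesis M_gt0 : 0 < fine (mu M).
Local Notation p := (fine (mu M)).
Local Notation F := (return_map M T).
Let mT : measurable_fun setT T := T_mp.1.

(* Between the visit numbers reached at times [v (t - e)] and [v (t + e)] lie
   both the visit number at time [v t] and the rescaled time [v^ t], by the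
   ergodic theorem for [M]; and the orbit rarely meets [U] in that window. *)
Lemma visits_rescale (t th : R) : 0 <= t -> 0 < th ->
  exists m0 d : R, [/\ 0 < m0, 0 < d & forall U, measurable U ->
    0 < fine (mu U) <= m0 -> fine (mu (U `\` M)) <= d * fine (mu U) ->
    exists B, [/\ measurable B, fine (mu B) <= th & forall x, M x -> ~ B x ->
      visits T U (ceiln ((fine (mu U))^-1 * t)) x =
      visits F U (ceiln ((fine (mu (U `&` M)) / p)^-1 * t)) x]].
Proof.
rewrite le_eqVlt => /predU1P[<- th0|t0 th0].
  exists 1, 1; split => // U mU _ _; exists set0; split => //.
    by rewrite measure0 ltW.
  by move=> x _ _; rewrite !mulr0 ceiln0 /visits !big_ord0.
(* Half-width of the window in units of [v]. The bound [th / 16] keeps the main term [2 * e] of the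
   mean number of hits of [U] in it at most [th / 8]; the bound [t / 2] keeps the window away from
   time 0. *)
pose e := Num.min (t / 2) (th / 16).
have e0 : 0 < e by rewrite lt_min !divr_gt0.
have et : e <= t / 2 by rewrite ge_min lexx.
have eth : e <= th / 16 by rewrite ge_min lexx orbT.
(* The ergodic error over time [v * t] is then a quarter of [p * e * v], the number of visits gained
   by moving the time by [v * e]. *)
pose eta := p * e / (4 * t).
have eta0 : 0 < eta by rewrite divr_gt0 ?mulr_gt0.
have [k0 hk0] := visits_in_probability T_mp T_erg mM eta0 (divr_gt0 th0 (ltr0n _ 8)).
(* In order: [U] keeps positive mass in [M]; the relative error between the two time scales is small
   against [e]; visits to [U] outside [M] up to time [v * t] are rare. *)
pose d := Num.min (Num.min (1 / 2) (e / (4 * t))) (th / (8 * (t + 1))).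
have t10 : 0 < t + 1 by rewrite addr_gt0.
have d0 : 0 < d by rewrite !lt_min !divr_gt0 ?mulr_gt0.
(* The first three bounds absorb the rounding of the window ends, the second one through
   [4 <= v * e]; the last one makes the ergodic estimate available from [k1] on. *)
pose m0 := Num.min (Num.min (th / 8) (e / 4)) (Num.min 1 (t / 2 / (k0%:R + 1))).
have k01 : 0 < k0%:R + 1 :> R by rewrite ltr_wpDl.
have m00 : 0 < m0 by rewrite !lt_min ltr01 !divr_gt0.
exists m0, d; split => // U mU /andP[m_gt0 m_le] UM.
set m := fine (mu U) in m_gt0 m_le UM *.
set w := fine (mu (U `&` M)).
have mUM : measurable (U `&` M) by exact: measurableI.
have mUD : measurable (U `\` M) by exact: measurableD.
have wm : w <= m by apply: fine_measure_le => // x [].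
have mw : m <= w + d * m.
  apply: le_trans (lerD (lexx w) UM).
  rewrite /m -[in X in X <= _](setUIDK U M).
  exact: fine_measureU_le.
have d12 : d <= 1 / 2 by rewrite /d !ge_min lexx.
have dt : d <= e / (4 * t) by rewrite /d !ge_min lexx orbT.
have dth : d <= th / (8 * (t + 1)) by rewrite /d !ge_min lexx orbT.
have mth : m <= th / 8 by rewrite (le_trans m_le)// /m0 !ge_min lexx.
have me : m <= e / 4 by rewrite (le_trans m_le)// /m0 !ge_min lexx orbT.
have m1 : m <= 1 by rewrite (le_trans m_le)// /m0 !ge_min lexx !orbT.
have mk : m <= t / 2 / (k0%:R + 1) by rewrite (le_trans m_le)// /m0 !ge_min lexx !orbT.
have w0 : 0 < w by nra.
set v := m^-1; set vh := (w / p)^-1.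
have v0 : 0 < v by rewrite invr_gt0.
have vm : v * m = 1 by rewrite mulVf ?gt_eqF.
have vhw : vh * w = p by rewrite /vh invf_div divfK ?gt_eqF.
pose k1 := ceiln (v * (t - e)); pose k2 := ceiln (v * (t + e)).
pose kt := ceiln (v * t); pose kh := ceiln (vh * t).
have te0 : 0 <= t - e by lra.
have k12 : (k1 <= k2)%N by apply: le_ceiln; rewrite ler_pM2l//; lra.
have k1t : (k1 <= kt)%N by apply: le_ceiln; rewrite ler_pM2l//; lra.
have kt2 : (kt <= k2)%N by apply: le_ceiln; rewrite ler_pM2l//; lra.
have k0k1 : (k0 <= k1)%N.
  rewrite -(ler_nat R); apply: le_trans (ceiln_ge _).
  rewrite mulrC ler_pdivlMr//.
  have : m * (k0%:R + 1) <= t / 2 by rewrite -ler_pdivlMr.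
  nra.
pose dev k := [set x | eta * k%:R < `|(visits T M k x)%:R - p * k%:R|].
have mdev k : measurable (dev k).
  rewrite (_ : dev k = visits T M k @^-1`
    [set n | eta * k%:R < `|n%:R - p * k%:R|])//.
  by rewrite -[X in measurable X]setTI; exact: measurable_visits.
pose H1 := hits_between T U k1 (k2 - k1).
pose H2 := hits_between T (U `\` M) 0 kt.
have mH1 : measurable H1 by exact: (measurable_hits_between T_mp).
have mH2 : measurable H2 by exact: (measurable_hits_between T_mp).
exists (dev k1 `|` dev k2 `|` (H1 `|` H2)); split.
- by repeat apply: measurableU.
- apply: le_trans (fine_measureU_le mu _ _) _; [exact: measurableU..|].
  apply: le_trans (lerD (fine_measureU_le mu _ _) (fine_measureU_le mu _ _)) _ => //.
  have := hk0 k1 k0k1; have := hk0 k2 (leq_trans k0k1 k12); rewrite -/(dev k1) -/(dev k2).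
  have : fine (mu H1) <= th / 4.
    apply: le_trans (measure_hits_between_le T_mp _ _ mU) _.
    rewrite natrB//; have := ceiln_ge (v * (t - e)).
    have : (k2%:R : R) < v * (t + e) + 1 by apply: ceiln_lt; rewrite mulr_ge0// ?ltW//; lra.
    rewrite -/k1 -/m => h1 h2.
    have : (k2%:R - k1%:R) * m <= (2 * e * v + 1) * m.
      by rewrite ler_pM2r//; lra.
    have -> : (2 * e * v + 1) * m = 2 * e * (v * m) + m by ring.
    rewrite vm; lra.
  have : fine (mu H2) <= th / 4.
    apply: le_trans (measure_hits_between_le T_mp _ _ mUD) _.
    have : (kt%:R : R) < v * t + 1 by apply: ceiln_lt; rewrite mulr_ge0// ltW.
    move=> /ltW h1; apply: le_trans (ler_wpM2l _ UM) _; first by [].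
    have : kt%:R * (d * m) <= (v * t + 1) * (d * m).
      by rewrite ler_wpM2r// mulr_ge0// ltW.
    have -> : (v * t + 1) * (d * m) = d * (t * (v * m) + m) by ring.
    rewrite vm mulr1 => /le_trans; apply.
    apply: le_trans (_ : d * (t + 1) <= _); first by rewrite ler_pM2l// lerD2l.
    move: dth; rewrite ler_pdivlMr ?mulr_gt0//; lra.
  move: (fine (mu H1)) (fine (mu H2)) (fine (mu (dev k1))) (fine (mu (dev k2))).
  by move=> a b c f; lra.
move=> x Mx nB.
have n1 : ~ dev k1 x by move=> h; apply: nB; left; left.
have n2 : ~ dev k2 x by move=> h; apply: nB; left; right.
have n3 : ~ H1 x by move=> h; apply: nB; right; left.
have n4 : ~ H2 x by move=> h; apply: nB; right; right.
have E0 : visits T U kt x = visits T (U `&` M) kt x.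
  rewrite /visits; apply: eq_bigr => j _; congr nat_of_bool; apply/idP/idP.
    rewrite !inE => Uj; split => //; apply: contrapT => nMj; apply: n4.
    by exists j => /=.
  by rewrite !inE => -[].
have E12 : visits T (U `&` M) k1 x = visits T (U `&` M) k2 x.
  apply: eq_visits => // j jk [Uj _]; apply: n3; exists j => //.
  by rewrite subnKC.
have etat : eta * t = p * e / 4.
  by rewrite /eta invfM mulrA -mulrA mulVf ?mulr1// gt_eqF.
have etae : eta * e <= p * e / 8 by move: etat; nra.
have etap : eta <= p / 8 by move: etat; nra.
have ve : 4 <= v * e.
  have : v * m <= v * (e / 4) by rewrite ler_pM2l.
  rewrite vm; lra.
have dte : d * t <= e / 4.
  have : d * (4 * t) <= e by rewrite -ler_pdivlMr ?mulr_gt0.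
  lra.
(* Since [U] has no more mass inside [M] than in all, [p * v <= vh]; the number of visits at the
   early time stays below the rescaled time. *)
have l1 : (visits T M k1 x <= kh)%N.
  rewrite -(ler_nat R); apply: le_trans (ceiln_ge _).
  have vhv : p * v <= vh.
    rewrite -(ler_pM2r w0) vhw -mulrA ger_pMr//.
    by rewrite -[leRHS]vm ler_pM2l.
  have vht : p * v * t <= vh * t by rewrite ler_pM2r.
  apply: le_trans vht.
  move/negP: n1; rewrite -leNgt ler_norml => /andP[_ K1].
  have : (k1%:R : R) < v * (t - e) + 1 by apply: ceiln_lt; rewrite mulr_ge0// ltW.
  move: K1; set K := (visits T M k1 x)%:R; move: (k1%:R : R) => a K1 ha.
  have : (p + eta) * a <= (p + eta) * (v * (t - e) + 1).
    by rewrite ler_pM2l ?addr_gt0// ltW.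
  have pve : p * 4 <= p * (v * e) by rewrite ler_pM2l.
  have evt : eta * t * v = p * e / 4 * v by rewrite etat.
  have eve : 0 <= eta * v * e by apply: mulr_ge0; [apply: mulr_ge0|]; exact: ltW.
  have -> : (p + eta) * (v * (t - e) + 1) = p * v * t - p * (v * e) + p +
    eta * t * v - eta * v * e + eta by ring.
  rewrite evt (_ : p * e / 4 * v = p * (v * e) / 4); last by field.
  lra.
(* Here [vh] may exceed [p * v], but by a factor at most [1 / (1 - d)], which the margin of the
   window covers. *)
have l2 : (kh <= visits T M k2 x)%N.
  rewrite leq_ceiln; move/negP: n2; rewrite -leNgt ler_norml => /andP[K2 _].
  have := ceiln_ge (v * (t + e)); rewrite -/k2.
  move: K2; set K := (visits T M k2 x)%:R; move: (k2%:R : R) => a K2 ha.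
  have peta : 0 < p - eta by lra.
  have : (p - eta) * (v * (t + e)) <= K.
    have : (p - eta) * (v * (t + e)) <= (p - eta) * a by rewrite ler_pM2l.
    lra.
  apply: le_trans.
  rewrite -(ler_pM2r w0) (_ : vh * t * w = vh * w * t); last by ring.
  rewrite vhw (_ : _ * w = (p - eta) * (t + e) * (v * w)); last by ring.
  have vw : 1 - d <= v * w.
    have : v * m <= v * (w + d * m) by rewrite ler_pM2l.
    rewrite mulrDr (_ : v * (d * m) = d * (v * m)); last by ring.
    rewrite vm mulr1.
    lra.
  apply: le_trans (_ : (p - eta) * (t + e) * (1 - d) <= _); last first.
    by rewrite ler_pM2l// mulr_gt0// addr_gt0.
  have de : d * e <= e / 2 by rewrite mulrC ler_pM2l//; lra.
  have h5 : p * t + 5 * (p * e) / 8 <= (p - eta) * (t + e).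
    have -> : (p - eta) * (t + e) = p * t + p * e - eta * t - eta * e by ring.
    rewrite etat; move: etae; lra.
  apply: le_trans (_ : (p * t + 5 * (p * e) / 8) * (1 - d) <= _); last first.
    by rewrite ler_pM2r//; lra.
  have -> : (p * t + 5 * (p * e) / 8) * (1 - d) =
    p * t + 5 * (p * e) / 8 - (p * (d * t) + 5 * (p * (d * e)) / 8) by field.
  have : p * (d * t) <= p * (e / 4) by rewrite ler_pM2l.
  have : p * (d * e) <= p * (e / 2) by rewrite ler_pM2l.
  have : 0 < p * e by rewrite mulr_gt0.
  lra.
(* Both counts are squeezed between the counts of visits to [U] inside [M] at [k1] and at [k2],
   which are equal. *)
rewrite E0 -/kh; apply/eqP; rewrite eqn_leq; apply/andP; split.
  apply: leq_trans (leq_visits T _ _ kt2) _; rewrite -E12 visits_return_map//.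
  exact: leq_visits.
apply: leq_trans (leq_visits _ _ _ l2) _; rewrite -visits_return_map// -E12.
exact: leq_visits.
Qed.

End induced_counting.

(** * Expectations under the induced measure *)

Section induced_expectation.
Context (R : realType) (dX : measure_display) (X : measurableType dX).
Variables (mu : probability X R) (M : set X).
Hypothesis mM : measurable M.
Hypothesis M_gt0 : (0 < mu M)%E.

Lemma fine_measure_gt0 : 0 < fine (mu M).
Proof. by rewrite fine_gt0// M_gt0 ltey_eq fin_num_measure. Qed.

Lemma induced_measureE A :
  induced_measure mu mM A = ((fine (mu M))^-1%:E * mu (A `&` M))%E.
Proof.
rewrite /induced_measure/= /mnormalize/= /mrestr setTI.
have -> : (mu M == 0%E) || (mu M == +oo%E) = false.
  by apply/negbTE; rewrite negb_or gt_eqF//= lt_eqF// ltey_eq fin_num_measure.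
by rewrite muleC.
Qed.

(** [mu] is the sum of its restrictions to [M] and to the complement; [f * \1_M] vanishes almost
    everywhere for the second and agrees with [f] for the first. *)
Let ge0_exp_induced (f : X -> R) : bounded_measurable f ->
  (forall x, 0 <= f x) ->
  \int[induced_measure mu mM]_x f x =
  (fine (mu M))^-1 * \int[mu]_x (f x * \1_M x).
Proof.
move=> bf f0; have p0 := fine_measure_gt0.
pose k : {nonneg R} := NngNum (ltW (etrans (invr_gt0 _) p0)).
have mMc := measurableC mM.
have mf : measurable_fun setT (EFin \o f) by apply/measurable_EFinP; case: bf.
have m1 : measurable_fun setT (EFin \o (\1_M : X -> R)).
  by apply/measurable_EFinP; exact: measurable_indic.
have mf1 : measurable_fun setT (fun x => (f x * \1_M x)%:E).
  by apply/measurable_EFinP; apply: measurable_funM; [case: bf|].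
have f10 x : (0 <= (f x * \1_M x)%:E)%E by rewrite lee_fin mulr_ge0// indicE.
rewrite /Rintegral.
have -> : (\int[induced_measure mu mM]_x (f x)%:E =
    \int[mscale k (mrestr mu mM)]_x (f x)%:E)%E.
  apply: eq_measure_integral => A mA _.
  by rewrite [LHS]induced_measureE.
rewrite ge0_integral_mscale//; last by move=> x _; rewrite lee_fin.
suff -> : (\int[mrestr mu mM]_x (f x)%:E = \int[mu]_x (f x * \1_M x)%:E)%E.
  rewrite fineM//; apply: integrable_fin_num => //.
  apply: (bounded_measurable_integrable mu (f := fun x => f x * \1_M x)).
  by apply: bounded_measurableM => //; exact: bounded_measurable_indic.
have -> : (\int[mu]_x (f x * \1_M x)%:E =
    \int[measure_add (mrestr mu mM) (mrestr mu mMc)]_x (f x * \1_M x)%:E)%E.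
  apply: eq_measure_integral => A mA _.
  rewrite [RHS]measure_addE/= /mrestr -measureU//; [|exact: measurableI..|].
    by rewrite -setIUr setUv setIT.
  by rewrite setIACA setICr setI0.
rewrite ge0_integral_measure_add//.
have -> : (\int[mrestr mu mMc]_x (f x * \1_M x)%:E = 0)%E.
  rewrite (ge0_ae_eq_integral (g := cst 0%E))//; first by rewrite integral0.
  exists M; split => //; first by rewrite [LHS](_ : _ = mu (M `&` ~` M))// setICr measure0.
  move=> x /= h; apply: contrapT => nM; apply: h => _.
  by rewrite indicE memNset// mulr0.
rewrite adde0; apply: ge0_ae_eq_integral => //.
- by move=> x _; rewrite lee_fin.
- exists (~` M); split => //; first by rewrite [LHS](_ : _ = mu (~` M `&` M))// setICl measure0.
  move=> x /= h Mx; apply: h => _.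
  by rewrite indicE mem_set// mulr1.
Qed.

(** Adding a bound [C] makes [f] nonnegative and contributes [C] to both sides. *)
Lemma exp_induced (f : X -> R) : bounded_measurable f ->
  \int[induced_measure mu mM]_x f x =
  (fine (mu M))^-1 * \int[mu]_x (f x * \1_M x).
Proof.
move=> bf; have [mf [C fC]] := bf; have p0 := fine_measure_gt0.
have bC := @bounded_measurable_cst R _ X C.
have b1 := bounded_measurable_indic R mM.
have fC0 x : 0 <= f x + C.
  by rewrite -lerBlDr sub0r; have := fC x; rewrite ler_norml => /andP[].
have := ge0_exp_induced (bounded_measurableD bf bC) fC0.
have -> : \int[mu]_x ((f x + C) * \1_M x) = \int[mu]_x (f x * \1_M x) + C * fine (mu M).
  under eq_Rintegral do rewrite mulrDl.
  by rewrite expD ?expZ ?exp_indic//; exact: bounded_measurableM.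
rewrite expD// exp_cst mulrDr [X in _ = _ + X]mulrCA mulVf ?gt_eqF// mulr1.
exact: addIr.
Qed.

End induced_expectation.

(** The counts form a vector in a countable set, and every union of its fibres is measurable; hence
    [G] may be arbitrary. *)
Lemma measurable_counts (R : realType) (dX : measure_display)
    (X : measurableType dX) (K : finType) (h : K -> X -> nat)
    (G : (K -> nat) -> R) :
  (forall i, measurable_fun setT (h i)) ->
  measurable_fun setT (fun x => G (h ^~ x)).
Proof.
move=> mh _ A mA; rewrite setTI.
rewrite (_ : _ @^-1` A = \bigcup_(t in [set t : {ffun K -> nat} | A (G t)])
   \bigcap_i (h i @^-1` [set t i])); last first.
  apply/seteqP; split => x; rewrite /preimage/=.
    move=> Ax; exists [ffun i => h i x] => [/=|i _ /=]; last by rewrite ffunE.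
    suff -> : [ffun i => h i x] = h ^~ x :> (K -> nat) by [].
    by apply/funext => i; rewrite ffunE.
  move=> [t /= At hx]; suff -> : h ^~ x = t by [].
  by apply/funext => i; exact: (hx i I).
rewrite bigcup_mkcond; apply: countable_bigcupT_measurable => // t.
case: ifP => // _; rewrite -[X in measurable X]setCK setC_bigcap.
apply: measurableC; apply: countable_bigcupT_measurable => // i.
by apply: measurableC; rewrite -[X in measurable X]setTI; exact: mh.
Qed.

(** * From the measure restricted to a set to the whole measure *)

Section transfer.
Context (R : realType) (dX : measure_display) (X : measurableType dX).
Variables (mu : probability X R) (T : X -> X).
Hypothesis T_mp : measure_preserving mu T.
Hypothesis T_erg : ergodic mu T.
Variable M : set X.
Hypothesis mM : measurable M.
Local Notation p := (fine (mu M)).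
Let mT : measurable_fun setT T := T_mp.1.

(* Averaging [1_M] along the orbit costs little because [G] is almost
   invariant, and turns [1_M] into a constant by the ergodic theorem. *)
Lemma exp_almost_invariant (C th : R) : 0 <= C -> 0 < th ->
  exists2 b : R, 0 < b & forall (G : X -> R) (B : set X),
    bounded_measurable G -> (forall x, `|G x| <= C) ->
    measurable B -> fine (mu B) <= b ->
    (forall x, ~ B x -> G (T x) = G x) ->
    `|\int[mu]_x (G x * \1_M x) - p * \int[mu]_x G x| <= th.
Proof.
move=> C0 th0.
have C10 : 0 < C + 1 by rewrite ltr_wpDl.
pose e := th / 4 / (C + 1).
have e0 : 0 < e by rewrite !divr_gt0.
have [k0 /(_ k0.+1 (leqnSn _))] := visits_in_probability T_mp T_erg mM e0 e0.
set k := k0.+1; set dev := [set x | _] => hdev.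
have k_gt0 : 0 < k%:R :> R by rewrite ltr0n.
have mdev : measurable dev.
  rewrite (_ : dev = visits T M k @^-1`
    [set n | e * k%:R < `|n%:R - p * k%:R|])//.
  by rewrite -[X in measurable X]setTI; exact: measurable_visits.
(* [k] depends only on [C], [th] and [M], so the bound on [mu B] may be divided by it: [k] preimages
   of [B] have total mass at most [th / 4 / (C + 1)]. The summand 1 covers [C = 0]. *)
exists (th / 4 / (C + 1) / k%:R); first by rewrite !divr_gt0.
move=> G B bG GC mB Bb GB.
have b1 := bounded_measurable_indic R mM.
have bT j (f : X -> R) : bounded_measurable f -> bounded_measurable (fun x => f (iter j T x)).
  exact: (bounded_measurable_comp (measurable_iter mT j)).
pose S x : R := \sum_(j < k) \1_M (iter j T x).
have bS : bounded_measurable S by apply: bounded_measurable_sum => j; exact: bT.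
have SE x : S x = (visits T M k x)%:R.
  by rewrite /visits natr_sum; apply: eq_bigr => j _; rewrite indicE.
(* By invariance of [mu] the second integral may be taken along [iter j T]; then only [G x] and
   [G (iter j T x)] differ, and only if the orbit meets [B] before time [j]. *)
have shift (j : 'I_k) : `|\int[mu]_x (G x * \1_M (iter j T x)) -
    \int[mu]_x (G x * \1_M x)| <= th / 2.
  rewrite -(exp_comp_iter T_mp j (bounded_measurableM bG b1)).
  have mH := measurable_hits_between T_mp 0 j mB.
  apply: le_trans (norm_expB_le mu mH _ _ C0 _ _ _) _.
  - by apply: bounded_measurableM => //; exact: bT.
  - exact: (bT j (fun x => G x * \1_M x) (bounded_measurableM bG b1)).
  - move=> x; rewrite normrM -[leRHS]mulr1 ler_pM// indicE.
    by case: (_ \in _); rewrite ?normr1 ?normr0.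
  - move=> x; rewrite normrM -[leRHS]mulr1 ler_pM// indicE.
    by case: (_ \in _); rewrite ?normr1 ?normr0.
  - move=> x nH; congr (_ * _).
    have : forall i, (i <= j)%N -> G x = G (iter i T x).
      elim=> // i IH ij; rewrite iterS GB ?IH//; first exact: ltnW.
      by move=> Bi; apply: nH; exists i.
    exact.
  - apply: le_trans (ler_wpM2l _ (measure_hits_between_le T_mp 0 j mB)) _.
      by rewrite mulr_ge0.
    have : j%:R * fine (mu B) <= k%:R * (th / 4 / (C + 1) / k%:R).
      by rewrite ler_pM ?fine_ge0// ler_nat ltnW.
    rewrite mulrCA mulfV ?gt_eqF// mulr1 => h.
    apply: le_trans (_ : 2 * C * (th / 4 / (C + 1)) <= _).
      by rewrite ler_wpM2l// mulr_ge0.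
    rewrite mulrA ler_pdivrMr//; nra.
have avg : `|\int[mu]_x (G x * S x) - k%:R * \int[mu]_x (G x * \1_M x)| <= k%:R * (th / 2).
  have -> : \int[mu]_x (G x * S x) = \sum_(j < k) \int[mu]_x (G x * \1_M (iter j T x)).
    under eq_Rintegral do rewrite mulr_sumr.
    by apply: exp_sum => j; apply: bounded_measurableM => //; exact: bT.
  rewrite mulr_natl -[X in _ *+ X]card_ord -sumr_const -sumrB.
  apply: le_trans (ler_norm_sum _ _ _) _.
  apply: le_trans (ler_sum _ (fun j _ => shift j)) _.
  by rewrite sumr_const card_ord mulr_natl.
have bGS := bounded_measurableM bG bS.
(* Off [dev] the sum [S] is within [e * k] of [p * k]; on [dev] the trivial bound [k] is multiplied
   by a mass at most [e]. *)
have erg : `|\int[mu]_x (G x * S x) - k%:R * (p * \int[mu]_x G x)| <= k%:R * (th / 2).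
  have bpk := @bounded_measurable_cst R _ X (p * k%:R).
  have -> : k%:R * (p * \int[mu]_x G x) = \int[mu]_x (p * k%:R * G x).
    by rewrite expZ//; ring.
  rewrite -expB//; last exact: bounded_measurableM.
  have bd : bounded_measurable (\1_dev : X -> R) by exact: bounded_measurable_indic.
  have bc c : bounded_measurable (fun _ : X => c : R) by exact: bounded_measurable_cst.
  have bdf : bounded_measurable (fun x => G x * S x - p * k%:R * G x).
    by apply: bounded_measurableB => //; exact: bounded_measurableM.
  apply: (le_trans (ler_norm_exp mu bdf)).
  apply: (@le_trans _ _ (\int[mu]_x (C * (e * k%:R) + C * k%:R * \1_dev x))).
    apply: le_exp.
    - exact: bounded_measurable_norm.
    - by apply: bounded_measurableD => //; exact: bounded_measurableM.
    - move=> x; rewrite (_ : _ - _ = G x * (S x - p * k%:R)); last by ring.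
      rewrite (_ : _ + _ = C * (e * k%:R + k%:R * \1_dev x)); last by ring.
      rewrite normrM ler_pM//.
      have [xd|xd] := boolP (x \in dev).
        rewrite indicE xd mulr1 ler_wpDl//; first by rewrite mulr_ge0 ?(ltW e0).
        have p1 : p <= 1.
          by rewrite -lee_fin fineK ?fin_num_measure// probability_le1.
        have p0 : 0 <= p by rewrite fine_ge0.
        have : S x <= k%:R by rewrite SE ler_nat visits_le_index.
        have : 0 <= S x by rewrite SE.
        rewrite ler_norml; nra.
      rewrite indicE (negbTE xd) mulr0 addr0 SE leNgt; apply: contra xd => h.
      by rewrite inE.
  rewrite expD//; last exact: bounded_measurableM.
  rewrite exp_cst expZ// exp_indic//.
  rewrite (_ : _ + _ = k%:R * (C * e + C * fine (mu dev))); last by ring.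
  rewrite ler_pM2l//.
  have : C * fine (mu dev) <= C * e by rewrite ler_wpM2l.
  have : (C + 1) * e = th / 4 by rewrite mulrC divfK ?gt_eqF.
  nra.
have : `|k%:R * (\int[mu]_x (G x * \1_M x) - p * \int[mu]_x G x)| <= k%:R * th.
  move: avg erg; rewrite mulrBr !ler_norml; lra.
by rewrite normrM ger0_norm// ler_pM2l.
Qed.

End transfer.

(** * Transfer of convergence from the induced process *)

Section point_process_transfer.
Context (R : realType) (dX : measure_display) (X : measurableType dX).
Variables (mu : probability X R) (T : X -> X).
Hypothesis T_mp : measure_preserving mu T.
Hypothesis T_erg : ergodic mu T.
Variable M : set X.
Hypothesis mM : measurable M.
Hypothesis M_gt0 : (0 < mu M)%E.
Local Notation p := (fine (mu M)).
Local Notation F := (return_map M T).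
Local Notation muM := (induced_measure mu mM).
Let mT : measurable_fun setT T := T_mp.1.
Let p0 : 0 < p := fine_measure_gt0 mM M_gt0.

Lemma visits_rescale_seq (ts : seq R) (th : R) :
  (forall t, t \in ts -> 0 <= t) -> 0 < th ->
  exists m0 d : R, [/\ 0 < m0, 0 < d & forall U, measurable U ->
    0 < fine (mu U) <= m0 -> fine (mu (U `\` M)) <= d * fine (mu U) ->
    exists B, [/\ measurable B, fine (mu B) <= th &
      forall x, M x -> ~ B x -> forall t, t \in ts ->
      visits T U (ceiln ((fine (mu U))^-1 * t)) x =
      visits F U (ceiln ((fine (mu (U `&` M)) / p)^-1 * t)) x]].
Proof.
elim: ts th => [|t ts IH] th ts0 th0.
  exists 1, 1; split => // U mU _ _; exists set0; split => //.
  by rewrite measure0 ltW.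
have th20 : 0 < th / 2 by rewrite divr_gt0.
have [|m1 [d1 [m10 d10 h1]]] := IH (th / 2) _ th20.
  by move=> s sts; apply: ts0; rewrite inE sts orbT.
have t0 : 0 <= t by apply: ts0; rewrite inE eqxx.
have [m2 [d2 [m20 d20 h2]]] := visits_rescale T_mp T_erg mM p0 t0 th20.
exists (Num.min m1 m2), (Num.min d1 d2); rewrite !lt_min m10 m20 d10 d20.
split => // U mU; rewrite le_min => /and3P[m_gt0 m1_le m2_le] UM.
have [||B1 [mB1 B1th hB1]] := h1 U mU; first by rewrite m_gt0.
  by apply: le_trans UM _; rewrite ler_pM2r// ge_min lexx.
have [||B2 [mB2 B2th hB2]] := h2 U mU; first by rewrite m_gt0.
  by apply: le_trans UM _; rewrite ler_pM2r// ge_min lexx orbT.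
exists (B1 `|` B2); split; first exact: measurableU.
  apply: le_trans (fine_measureU_le mu mB1 mB2) _.
  by rewrite (splitr th) lerD.
move=> x Mx /= nB s; rewrite inE => /predU1P[->|sts].
  by apply: hB2 => // Bx; apply: nB; right.
by apply: hB1 => // Bx; apply: nB; left.
Qed.

Lemma hits_at_seq (cs : seq nat) (U : set X) : measurable U ->
  exists B, [/\ measurable B, fine (mu B) <= (size cs)%:R * fine (mu U) &
    forall x, ~ B x -> forall c, c \in cs -> ~ U (iter c T x)].
Proof.
move=> mU; elim: cs => [|c cs [B [mB Bcs hB]]].
  by exists set0; split => //; rewrite measure0 mul0r.
have mc : measurable (iter c T @^-1` U) by exact: measurable_iter_preimage.
exists (iter c T @^-1` U `|` B); split; first exact: measurableU.
  apply: le_trans (fine_measureU_le mu mc mB) _.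
  by rewrite /= -natr1 mulrDl mul1r addrC lerD// measure_iter_preimage.
move=> x /= nB s; rewrite inE => /predU1P[->|sts].
  by move=> Ux; apply: nB; left.
by apply: hB => // Bx; apply: nB; right.
Qed.

(** Replacing [x] by [T x] shifts the window by one step, which only matters at its two ends. This
    is the almost invariance of the process: an end falls on a hit with probability [mu U] only. *)
Lemma visits_window_invariant (U : set X) s e x :
  ~ U (iter s T x) -> ~ U (iter e T x) ->
  (visits T U e (T x) - visits T U s (T x) = visits T U e x - visits T U s x)%N.
Proof.
have E c : ~ U (iter c T x) ->
    visits T U c x = ((x \in U) + visits T U c (T x))%N.
  by move=> nU; rewrite -visits_Sl visits_Sr memNset// addn0.
by move=> ns ne; rewrite (E s)// (E e)// subnDl.
Qed.

Variables (phi : X -> \bar R) (u : nat -> R).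
Hypothesis mphi : measurable_fun setT phi.
Local Notation U n := [set x | ((u n)%:E < phi x)%E].
Hypothesis cvgU : fine (mu (U n)) @[n --> \oo] --> (0 : R).
Hypothesis density : forall d, 0 < d ->
  \forall n \near \oo, fine (mu (U n `\` M)) <= d * fine (mu (U n)).

Lemma measurable_exceedance n : measurable (U n).
Proof.
have : measurable (phi @^-1` `](u n)%:E, +oo[%classic).
  by rewrite -[X in measurable X]setTI; apply: mphi => //; exact: emeasurable_itv.
congr measurable; apply/seteqP; split => x; rewrite /preimage/= in_itv/= andbT//.
Qed.

Let mF : measurable_fun setT F := measurable_return_map mT mM.

(** The range of indices in [v * [a, b[]. For [v = 0] it consists of the index 0 if [a < b] and is
    empty otherwise, in accordance with [dilate]. *)
Definition window (v : R) (ab : R * R) : nat * nat :=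
  if v == 0 then (0%N, nat_of_bool (ab.1 < ab.2))
  else (ceiln (v * ab.1), ceiln (v * ab.2)).

Lemma windowP (v : R) (ab : R * R) j : 0 <= v ->
  dilate v [set x | ab.1 <= x < ab.2] j%:R <->
  ((window v ab).1 <= j < (window v ab).2)%N.
Proof.
rewrite /window; case: eqVneq => [-> _|vn0 v0]; last first.
  by apply: dilate_ico; rewrite lt_neqAle eq_sym vn0.
suff -> : (ab.1 < ab.2) = `[< [set x | ab.1 <= x < ab.2] !=set0 >] by exact: dilate0.
apply/idP/asboolP => [ab12|[x /= /andP[]]]; last exact: le_lt_trans.
by exists ab.1; rewrite /= lexx.
Qed.

Lemma bounded_measurable_windows (S : X -> X) (A : set X) (k : nat)
    (f : 'rV[R]_k -> R) (s e : 'I_k -> nat) :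
  measurable_fun setT S -> measurable A ->
  (exists C, forall y, `|f y| <= C) ->
  bounded_measurable
    (fun x => f (\row_i (visits S A (e i) x - visits S A (s i) x)%N%:R)).
Proof.
move=> mS mA [C fC]; split; last by exists C => x.
apply: (@measurable_counts _ _ _ _ (fun i x => visits S A (e i) x - visits S A (s i) x)%N
  (fun h => f (\row_i (h i)%:R))) => i.
by apply: measurable_fun_subn; exact: measurable_visits.
Qed.

(** For each bounded test function the two expectations have difference tending to 0. Almost
    invariance compares the expectation of [G n] under [mu] with that of [G n * \1_M] divided by
    [p]; on [M], [G n] equals [Gh n] off a small set by the change of time scale, applied at all
    ends of the intervals at once. *)
Lemma cvg_point_process_of_induced (dO : measure_display)
    (Omega : measurableType dO) (P : probability Omega R)
    (Y : point_process R Omega) :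
  cvg_point_process muM
    (fun n => rare_event_process muM F phi (u n)) P Y ->
  cvg_point_process mu (fun n => rare_event_process mu T phi (u n)) P Y.
Proof.
move=> hyp k J Jint Jbd f cf [C fC].
have := hyp k J Jint Jbd f cf (ex_intro _ C fC).
set a_ := (X in X @ _ --> _ -> _); set b_ := (X in _ -> X @ _ --> _) => a_L.
have C0 : 0 <= C by apply: le_trans (fC 0).
have C10 : 0 < C + 1 by rewrite ltr_wpDl.
pose v n := (fine (mu (U n)))^-1; pose vh n := (fine (muM (U n)))^-1.
have muME n : fine (muM (U n)) = fine (mu (U n `&` M)) / p.
  rewrite induced_measureE// fineM//= 1?mulrC// fin_num_measure//.
  by apply: measurableI => //; exact: measurable_exceedance.
have v0 n : 0 <= v n by rewrite invr_ge0 fine_ge0.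
have vh0 n : 0 <= vh n by rewrite invr_ge0 fine_ge0.
have /choice[ab abP] i : exists c : R * R,
    [/\ 0 <= c.1, 0 <= c.2 & J i = [set x | c.1 <= x < c.2]].
  by have [a [b [a0 b0 JE]]] := Jint i; exists (a, b).
pose se n i := window (v n) (ab i).
pose seh n i := window (vh n) (ab i).
pose G n x := f (\row_i (visits T (U n) (se n i).2 x - visits T (U n) (se n i).1 x)%N%:R).
pose Gh n x := f (\row_i (visits F (U n) (seh n i).2 x - visits F (U n) (seh n i).1 x)%N%:R).
have bG n : bounded_measurable (G n).
  by apply: bounded_measurable_windows; [|exact: measurable_exceedance|exists C].
have bGh n : bounded_measurable (Gh n).
  by apply: bounded_measurable_windows; [|exact: measurable_exceedance|exists C].
have b_E n : b_ n = (\int[mu]_x G n x)%:E.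
  rewrite fineK; last exact/integrable_fin_num/(bounded_measurable_integrable mu (bG n)).
  apply: eq_integral => x _; congr (f _)%:E; apply/rowP => i; rewrite !mxE.
  rewrite (@rare_event_process_visits _ _ _ mu T phi (u n) _ (se n i).1 (se n i).2)// => j.
  by have [_ _ ->] := abP i; apply: windowP; exact: v0.
have a_E n : a_ n = (\int[muM]_x Gh n x)%:E.
  rewrite fineK; last exact/integrable_fin_num/(bounded_measurable_integrable muM (bGh n)).
  apply: eq_integral => x _; congr (f _)%:E; apply/rowP => i; rewrite !mxE.
  rewrite (@rare_event_process_visits _ _ _ muM F phi (u n) _ (seh n i).1 (seh n i).2)// => j.
  by have [_ _ ->] := abP i; apply: windowP; exact: vh0.
suff ab0 : (\int[mu]_x G n x - \int[muM]_x Gh n x) @[n --> \oo] --> (0 : R).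
  have -> : b_ = (fun n => a_ n + (\int[mu]_x G n x - \int[muM]_x Gh n x)%:E)%E.
    by apply/funext => n; rewrite b_E a_E -EFinD addrC subrK.
  rewrite -[X in _ --> X]adde0; apply: cvgeD => //.
  - exact: fin_num_adde_defl.
  - by apply/fine_cvgP; split; [exact: nearW|exact: ab0].
apply/cvgrPdist_le => th th0.
pose ts := flatten [seq [:: (ab i).1; (ab i).2] | i <- enum 'I_k].
have tsP i : ((ab i).1 \in ts) && ((ab i).2 \in ts).
  by apply/andP; split; apply/flatten_mapP; exists i; rewrite ?mem_enum// !inE eqxx ?orbT.
have ts0 t : t \in ts -> 0 <= t.
  move=> /flatten_mapP[i _]; have [a0 b0 _] := abP i.
  by rewrite !inE => /orP[]/eqP ->.
(* Each of the two comparisons may cost [p * th / 2]; the factor [p] compensates the normalization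
   [p^-1] of the induced expectation. *)
have pth0 : 0 < p * th / 2 by rewrite divr_gt0// mulr_gt0.
have [b b0 hb] := exp_almost_invariant T_mp T_erg mM C0 pth0.
have th40 : 0 < p * th / 4 / (C + 1) by rewrite !divr_gt0// mulr_gt0.
have [m0 [d [m00 d0 hmd]]] := visits_rescale_seq ts0 th40.
have d20 : 0 < Num.min d (1 / 2) by rewrite lt_min d0 divr_gt0.
have sz0 : 0 < (size ts).+1%:R :> R by rewrite ltr0n.
have bs0 : 0 < Num.min m0 (b / (size ts).+1%:R) by rewrite lt_min m00 divr_gt0.
move/cvgrPdist_le : cvgU => /(_ _ bs0) cvgU'.
near=> n; rewrite sub0r normrN exp_induced//.
have : fine (mu (U n)) <= Num.min m0 (b / (size ts).+1%:R).
  by near: n; apply: filterS cvgU' => n; rewrite sub0r normrN ger0_norm// fine_ge0.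
have : fine (mu (U n `\` M)) <= Num.min d (1 / 2) * fine (mu (U n)).
  by near: n; exact: density.
have mU := measurable_exceedance n.
(* If [U n] has measure 0, both time scales are 0 by convention and every window contains at most
   time 0; off the null set [U n] all counts vanish. *)
have [m_gt0|] := ltP 0 (fine (mu (U n))); last first.
  rewrite le_eqVlt ltNge fine_ge0// orbF => /eqP mU0 _ _.
  have mUM0 : fine (mu (U n `&` M)) = 0.
    apply/eqP; rewrite eq_le fine_ge0// andbT -mU0.
    by apply: fine_measure_le => //; exact: measurableI.
  have G0 x : ~ U n x -> G n x = f 0.
    move=> nUx; congr f; apply/rowP => i; rewrite !mxE /se /window /v mU0 invr0 eqxx/=.
    by case: (_ < _) => /=; rewrite /visits ?big_ord_recl !big_ord0// memNset.
  have Gh0 x : ~ U n x -> Gh n x = f 0.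
    move=> nUx; congr f; apply/rowP => i; rewrite !mxE /seh /window /vh muME mUM0.
    rewrite mul0r invr0 eqxx/=.
    by case: (_ < _) => /=; rewrite /visits ?big_ord_recl !big_ord0// memNset.
  have b1 := bounded_measurable_indic R mM.
  have bf0 := @bounded_measurable_cst R _ X (f 0).
  have C1 (g : X -> R) x : (forall x, `|g x| <= C) -> `|g x * \1_M x| <= C.
    move=> gC; rewrite normrM -[leRHS]mulr1 ler_pM// indicE.
    by case: (_ \in _); rewrite ?normr1 ?normr0.
  have := norm_expB_le mu mU (bG n) bf0 C0 (fun=> fC _) (fun=> fC _) G0.
  have := norm_expB_le mu mU (bounded_measurableM (bGh n) b1)
    (bounded_measurableM bf0 b1) C0 (fun x => C1 _ x (fun=> fC _)) (fun x => C1 _ x (fun=> fC _))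
    (fun x nU => congr1 (fun c => c * _) (Gh0 x nU)).
  rewrite mU0 !mulr0 !normr_le0 expZ// exp_indic// exp_cst !subr_eq0 => /eqP -> /eqP ->.
  by rewrite mulrCA mulVf ?gt_eqF// mulr1 subrr normr0 ltW.
move=> UMmin; rewrite le_min => /andP[m_le m_leb].
have UM : fine (mu (U n `\` M)) <= d * fine (mu (U n)).
  by apply: le_trans UMmin _; rewrite ler_pM2r// ge_min lexx.
have UM2 : fine (mu (U n `\` M)) <= 1 / 2 * fine (mu (U n)).
  by apply: le_trans UMmin _; rewrite ler_pM2r// ge_min lexx orbT.
have mUM : measurable (U n `&` M) by exact: measurableI.
have w0 : 0 < fine (mu (U n `&` M)).
  have : fine (mu (U n)) <= fine (mu (U n `&` M)) + fine (mu (U n `\` M)).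
    rewrite -[in X in X <= _](setUIDK (U n) M); apply: fine_measureU_le => //.
    exact: measurableD.
  move: (fine (mu (U n `&` M))) UM2 m_gt0 => w; lra.
have vn0 : (v n == 0) = false by apply/negbTE; rewrite invr_eq0 gt_eqF.
have vhn0 : (vh n == 0) = false.
  by apply/negbTE; rewrite /vh muME invr_eq0 mulf_neq0 ?invr_eq0 ?gt_eqF.
have [B1 [mB1 B1b hB1]] := hits_at_seq [seq ceiln (v n * t) | t <- ts] mU.
have GT x : ~ B1 x -> G n (T x) = G n x.
  move=> /hB1 nB; congr f; apply/rowP => i; rewrite !mxE; congr _%:R.
  have /andP[ta tb] := tsP i; rewrite /se /window vn0.
  by apply: visits_window_invariant; apply: nB; apply: map_f.
have {}B1b : fine (mu B1) <= b.
  apply: le_trans B1b _; rewrite size_map.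
  move: m_leb; rewrite ler_pdivlMr// mulrC; apply: le_trans.
  by rewrite ler_pM2r// ler_nat.
have hG := hb (G n) B1 (bG n) (fun=> fC _) mB1 B1b GT.
have [|B2 [mB2 B2th hB2]] := hmd (U n) mU _ UM; first by rewrite m_gt0.
have b1 := bounded_measurable_indic R mM.
have C1 (g : X -> R) x : (forall x, `|g x| <= C) -> `|g x * \1_M x| <= C.
  move=> gC; rewrite normrM -[leRHS]mulr1 ler_pM// indicE.
  by case: (_ \in _); rewrite ?normr1 ?normr0.
have GGh x : ~ B2 x -> G n x * \1_M x = Gh n x * \1_M x.
  move=> nB; rewrite indicE; have [Mx|Mx] := boolP (x \in M); last by rewrite !mulr0.
  congr (_ * _); congr f; apply/rowP => i; rewrite !mxE; congr _%:R.
  have /andP[ta tb] := tsP i; rewrite /se /seh /window vn0 vhn0 /= /vh muME.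
  move/set_mem in Mx.
  by rewrite /v (hB2 x Mx nB _ ta) (hB2 x Mx nB _ tb).
have := norm_expB_le mu mB2 (bounded_measurableM (bG n) b1)
  (bounded_measurableM (bGh n) b1) C0 (fun x => C1 _ x (fun=> fC _))
  (fun x => C1 _ x (fun=> fC _)) GGh.
set I1 := \int[mu]_x (G n x * _) in hG *; set I2 := \int[mu]_x (Gh n x * _).
move: hG; set I0 := \int[mu]_x G n x => hG hGh.
have : `|p * (I0 - p^-1 * I2)| <= p * th.
  rewrite mulrBr mulVKf ?gt_eqF//.
  have : 2 * C * fine (mu B2) <= p * th / 2.
    apply: le_trans (ler_wpM2l _ B2th) _; first by rewrite mulr_ge0.
    by rewrite mulrA ler_pdivrMr//; have := mulr_gt0 p0 th0; nra.
  move: hG hGh; rewrite !ler_norml; lra.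
by rewrite normrM gtr0_norm// ler_pM2l.
Unshelve. all: by end_near.
Qed.

End point_process_transfer.

(** * Density points with respect to boxes *)

(** Lebesgue nullity expressed with cubes rather than boxes, because a Lipschitz map sends a cube
    into a cube of comparable side. *)
Definition cube_null (R : realType) (d : nat) (A : set 'rV[R]_d) : Prop :=
  forall e : R, 0 < e ->
  exists (K : set nat) (c : nat -> 'rV[R]_d) (r : nat -> R),
    [/\ forall k, 0 <= r k,
        A `<=` \bigcup_(k in K) [set z | forall j, `|z 0 j - c k 0 j| <= r k] &
        (\esum_(k in K) ((2 * r k) ^+ d)%:E <= e%:E)%E].

Section dyadic_mesh.
Context (R : realType).

Definition mesh (k : nat) : R := (2 ^+ k)^-1.

Lemma mesh_gt0 k : 0 < mesh k.
Proof. by rewrite invr_gt0 exprn_gt0. Qed.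

Lemma mesh0 : mesh 0 = 1.
Proof. by rewrite /mesh expr0 invr1. Qed.

Lemma meshS k : mesh k = 2 * mesh k.+1.
Proof. by rewrite /mesh exprS invfM mulrA mulfV ?mul1r. Qed.

Lemma le_mesh k l : (k <= l)%N -> mesh l <= mesh k.
Proof. by move=> kl; rewrite lef_pV2 ?posrE ?exprn_gt0// ler_eXn2l ?ltr1n. Qed.

Lemma mesh_lt e : 0 < e -> exists k, mesh k < e.
Proof.
move=> e0; exists (Num.truncn e^-1).+1.
rewrite /mesh invf_plt ?posrE ?exprn_gt0//.
apply: lt_trans (truncnS_gt _) _; rewrite -natrX ltr_nat.
exact: ltn_expl.
Qed.

Lemma mesh_near s : 0 < s < 1 -> exists2 k, mesh k <= s & s < 2 * mesh k.
Proof.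
move=> /andP[s0 s1].
have ex : exists k, mesh k <= s by have [k /ltW] := mesh_lt s0; exists k.
case: (ex_minnP ex) => k ks kmin; exists k => //.
case: k => [|k] in ks kmin *; first by move: ks; rewrite mesh0 leNgt s1.
by rewrite -meshS ltNge; apply/negP => /kmin; rewrite ltnn.
Qed.

End dyadic_mesh.

Section cell_index.
Context (R : realType) (X : Type) (d : nat).
Variable y : X -> 'rV[R]_d.
Local Notation mesh := (mesh R).

Definition cell_index (k : nat) (x : X) : {ffun 'I_d -> int} :=
  [ffun j => Num.floor (2 ^+ k * y x 0 j)].

Lemma floor_mesh k x j : (cell_index k x j)%:~R * mesh k <= y x 0 j <
  ((cell_index k x j)%:~R + 1) * mesh k.
Proof.
rewrite ffunE ler_pdivrMr ?ltr_pdivlMr ?exprn_gt0// ![_ * 2 ^+ k]mulrC.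
by have := floor_itv (2 ^+ k * y x 0 j); rewrite ?num_real// intrD.
Qed.

(** Nestedness of dyadic cells: [Num.floor s] is determined by [Num.floor (2 * s)]. *)
Lemma eq_cell_index_le k l x x' : (k <= l)%N ->
  cell_index l x = cell_index l x' -> cell_index k x = cell_index k x'.
Proof.
move=> /subnK <-; elim: (l - k)%N => [//|n IH]; rewrite addSn => E; apply: IH.
apply/ffunP => j; move/ffunP/(_ j): E; rewrite !ffunE.
set m := (n + k)%N; rewrite exprS -!mulrA.
move: (2 ^+ m * y x 0 j) (2 ^+ m * y x' 0 j) => s s' E; apply: floor_def.
have /andP[h1 h2] : (Num.floor s')%:~R <= s' < (Num.floor s' + 1)%:~R by exact: floor_itv.
have /andP[g1 g2] : (Num.floor (2 * s))%:~R <= 2 * s < (Num.floor (2 * s) + 1)%:~R.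
  exact: floor_itv.
have e1 : 2 * Num.floor s' <= Num.floor (2 * s).
  by rewrite E floor_ge_int intrM ler_pM2l.
have e2 : Num.floor (2 * s) < 2 * (Num.floor s' + 1).
  by rewrite E floor_lt_int intrM ltr_pM2l.
rewrite -(ler_pM2l (ltr0n R 2)) -(ltr_pM2l (ltr0n R 2)) -!(intrM _ 2).
rewrite -floor_ge_int -floor_lt_int//.
by rewrite e1.
Qed.

Lemma cell_index_dist k x x' j : cell_index k x = cell_index k x' ->
  `|y x 0 j - y x' 0 j| < mesh k.
Proof.
move=> E; have /andP[] := floor_mesh k x j; have /andP[] := floor_mesh k x' j.
rewrite E; set q := (_%:~R); rewrite mulrDl mul1r ltr_norml; lra.
Qed.

End cell_index.

Section dyadic_cells.
Context (R : realType) (dX : measure_display) (X : measurableType dX).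
Variables (d : nat) (D : set X) (y : X -> 'rV[R]_d).
Hypothesis mD : measurable D.
Hypothesis my : forall j, measurable_fun D (fun x => y x 0 j).
Local Notation mesh := (mesh R).
Local Notation cell_index := (cell_index y).

Definition cell (k : nat) (q : {ffun 'I_d -> int}) : set X :=
  D `&` [set x | cell_index k x = q].

Definition coord_ball (x : X) (r : R) : set X :=
  D `&` [set x' | forall j, `|y x' 0 j - y x 0 j| < r].

Lemma measurable_cell k q : measurable (cell k q).
Proof.
rewrite (_ : cell k q = (~` \bigcup_j ~` (D `&` (fun x => y x 0 j) @^-1`
    `[(q j)%:~R * mesh k, (q j + 1)%:~R * mesh k[%classic)) `&` D); last first.
  apply/seteqP; split => x.
    move=> [Dx <-]; split => //; rewrite setC_bigcup => j _; rewrite setCK; split => //=.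
    rewrite in_itv/= ffunE ler_pdivrMr ?ltr_pdivlMr ?exprn_gt0//.
    by rewrite ![_ * 2 ^+ k]mulrC; have := floor_itv (2 ^+ k * y x 0 j); rewrite ?num_real.
  move=> [+ Dx]; rewrite setC_bigcup => h; split => //=; apply/ffunP => j.
  have := h j Logic.I; rewrite setCK => -[_]/=; rewrite in_itv/= ffunE.
  rewrite ler_pdivrMr ?ltr_pdivlMr ?exprn_gt0//.
  by rewrite ![_ * 2 ^+ k]mulrC; exact: floor_def.
apply: measurableI => //; apply: measurableC.
apply: countable_bigcupT_measurable => // j; apply: measurableC.
by apply: my => //; exact: measurable_itv.
Qed.

Lemma measurable_cell_index k (P : {ffun 'I_d -> int} -> Prop) :
  measurable (D `&` [set x | P (cell_index k x)]).
Proof.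
rewrite (_ : D `&` _ = \bigcup_(q in [set q | P q]) cell k q).
  rewrite bigcup_mkcond; apply: countable_bigcupT_measurable => // q.
  by case: ifP => _ //; exact: measurable_cell.
apply/seteqP; split => x; first by move=> [Dx Px]; exists (cell_index k x).
by move=> [q Pq [Dx /= E]]; split => //=; rewrite E.
Qed.

End dyadic_cells.

Lemma negligible_bigcup_countable (R : realType) (dX : measure_display)
    (X : measurableType dX) (mu : probability X R) (K : countType)
    (A : K -> set X) :
  (forall q, mu.-negligible (A q)) -> mu.-negligible (\bigcup_q A q).
Proof.
move=> hA; pose B (n : nat) := if @choice.unpickle K n is Some q then A q else set0.
apply: (negligibleS (A := \bigcup_n B n)).
  by move=> x [q _ Aq]; exists (choice.pickle q) => //; rewrite /B choice.pickleK.
apply: negligible_bigcup => n; rewrite /B; case: choice.unpickle => // .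
exact: negligible_set0.
Qed.

Lemma negligible_fine_le (R : realType) (dX : measure_display)
    (X : measurableType dX) (mu : probability X R) (A : set X) :
  (forall e : R, 0 < e -> exists2 B, measurable B /\ A `<=` B & fine (mu B) <= e) ->
  mu.-negligible A.
Proof.
move=> h; have h' n : exists B, [/\ measurable B, A `<=` B & fine (mu B) <= n.+1%:R^-1].
  by have [|B [mB AB] Be] := h n.+1%:R^-1; [rewrite invr_gt0|exists B].
have {h'}/choice[B hB] := h'.
have mB n : measurable (B n) by have [] := hB n.
exists (\bigcap_n B n); split; [exact: bigcapT_measurable| |]; last first.
  by move=> x Ax n _; have [_ AB _] := hB n; exact: AB.
apply/eqP; rewrite eq_le measure_ge0 andbT; apply/lee_addgt0Pr => e e0.
rewrite add0e; have [n ne] : exists n : nat, n.+1%:R^-1 <= e.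
  exists (Num.truncn e^-1); rewrite invf_ple ?posrE// ltW//; exact: truncnS_gt.
apply: (@le_trans _ _ (mu (B n))).
  by apply: le_measure; rewrite ?inE//; [exact: bigcapT_measurable|move=> x; exact].
rewrite -[leLHS]fineK ?fin_num_measure// lee_fin; apply: le_trans ne.
by have [] := hB n.
Qed.

Lemma fine_measure_cover_le (R : realType) (dX : measure_display)
    (X : measurableType dX) (mu : probability X R) (I : finType)
    (A : set X) (B : I -> set X) : measurable A -> (forall i, measurable (B i)) ->
  A `<=` \bigcup_i B i -> fine (mu A) <= \sum_i fine (mu (B i)).
Proof.
move=> mA mB AB.
have h (r : seq I) : measurable (\big[setU/set0]_(i <- r) B i) /\
    fine (mu (\big[setU/set0]_(i <- r) B i)) <= \sum_(i <- r) fine (mu (B i)).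
  elim: r => [|i r [mr IH]]; first by rewrite !big_nil measure0.
  rewrite !big_cons; split; first exact: measurableU.
  by apply: le_trans (fine_measureU_le mu (mB i) mr) _; rewrite lerD2l.
have [mI hI] := h (index_enum I); apply: le_trans hI; apply: fine_measure_le => //.
move=> x /AB[i _ Bx]; rewrite -bigcup_seq; exists i => //=.
by rewrite mem_index_enum.
Qed.

Section cell_measures.
Context (R : realType) (dX : measure_display) (X : measurableType dX).
Variables (mu : probability X R) (d : nat) (D : set X) (y : X -> 'rV[R]_d).
Hypothesis mD : measurable D.
Hypothesis my : forall j, measurable_fun D (fun x => y x 0 j).
Local Notation mesh := (mesh R).
Local Notation idx := (cell_index y).
Local Notation cell := (cell D y).

Let mcell k q : measurable (cell k q) := measurable_cell mD my k q.

Definition light (e : R) (k : nat) (q : {ffun 'I_d -> int}) : Prop :=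
  fine (mu (cell k q)) <= e * mesh k ^+ d.

Let light_below e k q m : set X :=
  cell k q `&` [set x | exists2 i, (i <= m)%N & light e (k + i) (idx (k + i) x)].

Let measurable_light_below e k q m : measurable (light_below e k q m).
Proof.
rewrite (_ : light_below e k q m = \bigcup_(i in [set i | (i <= m)%N])
   (cell k q `&` (D `&` [set x | light e (k + i) (idx (k + i) x)]))).
  apply: bigcup_measurable => i _; apply: measurableI => //.
  exact: measurable_cell_index.
apply/seteqP; split => x.
  by move=> [cx [i im Lx]]; exists i => //; split => //; split => //; case: cx.
by move=> [i im [cx [_ Lx]]]; split => //; exists i.
Qed.

(** Induction on the depth. A light cell obeys the bound by definition; any other is divided into
    its [2 ^ d] children, one for each choice [b] of halves, whose volumes add up to its own. *)
Let measure_light_below e k q m : 0 <= e ->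
  fine (mu (light_below e k q m)) <= e * mesh k ^+ d.
Proof.
move=> e0; elim: m k q => [|m IH] k q.
  have [lq|nlq] := pselect (light e k q).
    apply: le_trans lq; apply: fine_measure_le; [|exact: mcell|by move=> x []].
    exact: measurable_light_below.
  rewrite (_ : light_below _ _ _ _ = set0); last first.
    apply/seteqP; split => // x [[_ /= xq] [i]]; rewrite leqn0 => /eqP ->.
    by rewrite addn0 xq.
  by rewrite measure0 mulr_ge0// exprn_ge0// ltW// mesh_gt0.
have [lq|nlq] := pselect (light e k q).
  apply: le_trans lq; apply: fine_measure_le; [|exact: mcell|by move=> x []].
  exact: measurable_light_below.
pose child (b : {ffun 'I_d -> bool}) : {ffun 'I_d -> int} :=
  [ffun j => 2 * q j + (b j : nat)%:Z].
have cov : light_below e k q m.+1 `<=` \bigcup_b light_below e k.+1 (child b) m.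
  move=> x [cx [i im lx]]; have [Dx qx] := cx.
  case: i => [|i] in im lx.
    by exfalso; apply: nlq; move: lx; rewrite addn0 qx.
  pose b : {ffun 'I_d -> bool} := [ffun j => idx k.+1 x j != 2 * q j].
  exists b => //; split; last by exists i => //; rewrite addSnnS.
  split => //=; apply/ffunP => j; rewrite !ffunE/=.
  move/ffunP/(_ j): qx; rewrite !ffunE exprS -mulrA.
  move: (2 ^+ k * y x 0 j) => s qs.
  have /andP[h1 h2] : (q j)%:~R <= s < (q j + 1)%:~R by rewrite -qs; exact: floor_itv.
  have e1 : 2 * q j <= Num.floor (2 * s) by rewrite floor_ge_int intrM ler_pM2l.
  have e2 : Num.floor (2 * s) < 2 * (q j + 1) by rewrite floor_lt_int intrM ltr_pM2l.
  move: e1 e2; move: (Num.floor _) (q j) => a c; case: eqVneq => /=; lia.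
apply: le_trans (fine_measure_cover_le mu _ _ cov) _.
- exact: measurable_light_below.
- by move=> b; exact: measurable_light_below.
- apply: le_trans (ler_sum _ (fun b _ => IH k.+1 (child b))) _.
  rewrite sumr_const card_ffun card_bool card_ord [mesh k]meshS exprMn -(mulr_natl (e * _)) natrX.
  by rewrite mulrCA.
Qed.

(** In a unit cell, the points lying in some cell of mass at most [e / 2] times its volume have
    total mass at most [e / 2], at whatever depth these cells occur. Hence the cells around almost
    every point have mass bounded below by a multiple of their volume. *)
Lemma negligible_light :
  mu.-negligible (D `&` [set x | forall e, 0 < e -> exists k, light e k (idx k x)]).
Proof.
set N := _ `&` _.
apply: (negligibleS (A := \bigcup_q (N `&` cell 0 q))).
  by move=> x Nx; exists (idx 0 x) => //; split => //; split => //; case: Nx.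
apply: negligible_bigcup_countable => q; apply: negligible_fine_le => e e0.
pose L m := light_below (e / 2) 0 q m.
have mL m : measurable (L m) by exact: measurable_light_below.
exists (\bigcup_m L m).
  split; first exact: bigcupT_measurable.
  move=> x [[Dx /(_ (e / 2)) h] cx]; have [|k lk] := h; first by rewrite divr_gt0.
  by exists k => //; split => //; exists k.
have : mu \o L @ \oo --> mu (\bigcup_m L m).
  apply: nondecreasing_cvg_mu => //; first exact: bigcupT_measurable.
  apply/nondecreasing_seqP => m; apply/subsetPset => x [cx [i im lx]].
  by split => //; exists i => //; exact: leqW.
rewrite -lee_fin fineK; last by rewrite fin_num_measure//; exact: bigcupT_measurable.
move=> cL; rewrite -(cvg_lim _ cL)//; apply: lime_le; first by apply/cvg_ex; eexists; exact: cL.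
apply: nearW => m /=; rewrite -[leLHS]fineK ?fin_num_measure// lee_fin.
have e20 : 0 <= e / 2 by rewrite divr_ge0// ltW.
apply: le_trans (measure_light_below 0 q m e20) _.
by rewrite mesh0 expr1n mulr1; lra.
Qed.

End cell_measures.

(** Numbers the [2 * k + 3] integers at distance at most [k.+1] from [t]; the cells near a given one
    are thereby indexed by a finite type. *)
Lemma int_ball_offset (s t : int) (k : nat) : `|s - t| <= k.+1%:Z ->
  (absz (s - t + k.+1%:Z)%R < 2 * k + 3)%N /\
  s = t + (absz (s - t + k.+1%:Z)%R)%:Z - k.+1%:Z.
Proof. lia. Qed.

Lemma esum_nat_le (R : realType) (K : pred nat) (a : nat -> R) (e : R) :
  (forall k, 0 <= a k) -> (forall n, \sum_(k < n | K k) a k <= e) ->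
  (\esum_(k in [set k | K k]) (a k)%:E <= e%:E)%E.
Proof.
move=> a0 ae; rewrite -nneseries_esum; last by move=> k _; rewrite lee_fin.
apply: lime_le; first by apply: is_cvg_nneseries => k _ _; rewrite lee_fin.
by apply: nearW => n; rewrite big_mkord sumEFin lee_fin.
Qed.

Section density.
Context (R : realType) (dX : measure_display) (X : measurableType dX).
Variables (mu : probability X R) (d : nat) (D : set X) (y : X -> 'rV[R]_d).
Hypothesis mD : measurable D.
Hypothesis my : forall j, measurable_fun D (fun x => y x 0 j).
Variable M : set X.
Hypothesis mM : measurable M.
Hypothesis outer_regular : forall e : R, 0 < e ->
  exists V, [/\ measurable V, fine (mu (V `\` M)) <= e &
    forall x, D x -> M x -> exists2 r, 0 < r & coord_ball D y x r `<=` V].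
Hypothesis abs_cont : forall A, cube_null A -> mu.-negligible (D `&` y @^-1` A).
Local Notation mesh := (mesh R).
Local Notation idx := (cell_index y).
Local Notation cell := (cell D y).
Local Notation ball := (coord_ball D y).

Let mcell k q : measurable (cell k q) := measurable_cell mD my k q.

Definition heavy (e : R) (k : nat) (q : {ffun 'I_d -> int}) : Prop :=
  e * mesh k ^+ d < fine (mu (cell k q `\` M)).

(** The heavy cell need not contain [x]: a box centred at [x] also meets neighbouring cells, at a
    distance proportional to the mesh. *)
Definition near_heavy (e kappa : R) : set X :=
  [set x | [/\ D x, M x & forall k0, exists k x', [/\ (k0 <= k)%N, D x',
     forall j, `|y x 0 j - y x' 0 j| <= kappa * mesh k & heavy e k (idx k x')]]].

(* The maximal heavy cells inside an open superset [V] of [M] are disjoint, so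
   their total volume is at most [mu (V \ M) / e]. *)
Lemma cube_null_near_heavy e kappa : 0 < e -> 0 <= kappa ->
  cube_null (y @` near_heavy e kappa).
Proof.
(* [L] is the ratio between the volume of the cube of half-side [(kappa + 1) * mesh k], which covers
   the points near a cell, and the volume of the cell. *)
move=> e0 kappa0 eps eps0; pose L := (2 * (kappa + 1)) ^+ d.
have L0 : 0 < L by rewrite exprn_gt0// mulr_gt0// ltr_wpDl.
have [V [mV VM openV]] := outer_regular (divr_gt0 (mulr_gt0 eps0 e0) L0).
pose good k q := cell k q `<=` V /\ heavy e k q.
pose maxgood (kq : nat * {ffun 'I_d -> int}) := good kq.1 kq.2 /\
  forall x, cell kq.1 kq.2 x -> forall k, (k < kq.1)%N -> ~ good k (idx k x).
pose code n := @choice.pickle_inv (nat * {ffun 'I_d -> int})%type n.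
pose K n := if code n is Some kq then `[< maxgood kq >] else false.
pose c n : 'rV[R]_d := if code n is Some kq then \row_j ((kq.2 j)%:~R * mesh kq.1) else 0.
pose r n : R := if code n is Some kq then (kappa + 1) * mesh kq.1 else 0.
exists [set n | K n], c, r; split.
- move=> n; rewrite /r; case: (code n) => // kq.
  by rewrite mulr_ge0 ?addr_ge0// ltW// mesh_gt0.
- move=> _ [x [Dx Mx hx] <-].
  have [rho rho0 rhoV] := openV x Dx Mx.
  have k10 : 0 < kappa + 1 by rewrite ltr_wpDl.
  have [k0 hk0] := mesh_lt (divr_gt0 rho0 k10).
  have [k [x' [k0k Dx' xx' hv]]] := hx k0.
  have kr : (kappa + 1) * mesh k < rho.
    rewrite mulrC -ltr_pdivlMr//; apply: le_lt_trans hk0; exact: le_mesh.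
  (* Every point of this cell is within [(kappa + 1) * mesh k < rho] of [x], so the cell lies in
     [V]. *)
  have gk : good k (idx k x').
    split => // z [Dz zx']; apply: rhoV; split => // j.
    apply: le_lt_trans kr; rewrite mulrDl mul1r [kappa * _ + _]addrC.
    have -> : y z 0 j - y x 0 j = (y z 0 j - y x' 0 j) - (y x 0 j - y x' 0 j) by ring.
    apply: le_trans (ler_normB _ _) _; apply: lerD => //.
    exact/ltW/cell_index_dist.
  (* Levels start at 0, so there is a coarsest good cell around [x']; its enlarged cube still covers
     [x], the mesh being larger. *)
  have ex : exists l, `[< good l (idx l x') >] by exists k; exact/asboolP.
  case: (ex_minnP ex) => l /asboolP gl lmin.
  have lk : (l <= k)%N by apply: lmin; exact/asboolP.
  have codeE : code (choice.pickle (l, idx l x')) = Some (l, idx l x').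
    exact: choice.pickleK_inv.
  exists (choice.pickle (l, idx l x')) => /=.
    rewrite /K codeE; apply/asboolP; split => //= z [_ zx'] m ml gm.
    have := lmin m; rewrite asboolT; last by rewrite -(eq_cell_index_le (ltnW ml) zx').
    by move=> /(_ isT); rewrite leqNgt ml.
  move=> j; rewrite /c /r codeE mxE/= mulrDl mul1r.
  have -> : y x 0 j - (idx l x' j)%:~R * mesh l =
    (y x 0 j - y x' 0 j) + (y x' 0 j - (idx l x' j)%:~R * mesh l) by ring.
  apply: le_trans (ler_normD _ _) _; apply: lerD.
    by apply: le_trans (xx' j) _; rewrite ler_wpM2l// le_mesh.
  have /andP[f1 f2] := floor_mesh y l x' j.
  by rewrite ger0_norm ?subr_ge0// lerBlDr -[X in X + _]mul1r -mulrDl addrC ltW.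
- apply: esum_nat_le => [n|N].
    rewrite exprn_ge0// mulr_ge0// /r; case: (code n) => // kq.
    by rewrite mulr_ge0 ?addr_ge0// ltW// mesh_gt0.
  pose A n := if code n is Some kq then cell kq.1 kq.2 `\` M else set0.
  have mA n : measurable (A n).
    by rewrite /A; case: (code n) => // kq; exact: measurableD.
  have codeI m n kq : code m = Some kq -> code n = Some kq -> m = n.
    move=> mq nq; have := @choice.pickle_invK (nat * {ffun 'I_d -> int})%type m.
    have := @choice.pickle_invK (nat * {ffun 'I_d -> int})%type n.
    by rewrite -/(code m) -/(code n) /oapp mq nq => <- <-.
  have tA : trivIset [set n | K n] A.
    suff h m n x : K m -> K n -> A m x -> A n x -> m = n.
      by move=> m n Km Kn [x [Am An]]; exact: h Km Kn Am An.
    rewrite /K /A; case Em : (code m) => [[k q]|//]; case En : (code n) => [[l p]|//].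
    move=> /asboolP[/= gm hm] /asboolP[/= gn hn] [[Dx /= xq] _] [[_ /= xp] _].
    have kl : k = l.
      case: (ltngtP k l) => // kl.
        by exfalso; apply: (hn x _ k kl) => //; rewrite xq.
      by exfalso; apply: (hm x _ l kl) => //; rewrite xp.
    by move: Em; rewrite kl -xq kl xp => Em; apply: codeI Em En.
  have -> : eps = L / e * (eps * e / L).
    by field; rewrite !gt_eqF.
  apply: (@le_trans _ _ (L / e * \sum_(n < N | K n) fine (mu (A n)))).
    rewrite mulr_sumr; apply: ler_sum => n; rewrite /K /r /A.
    case: (code n) => // kq /asboolP[[_ hv] _].
    rewrite mulrA exprMn -/L -mulrA ler_pM2l// [e^-1 * _]mulrC.
    by rewrite ler_pdivlMr// mulrC ltW.
  rewrite ler_pM2l ?divr_gt0//; apply: le_trans VM.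
  rewrite -lee_fin -sumEFin fineK; last by rewrite fin_num_measure//; exact: measurableD.
  under eq_bigr do rewrite fineK ?fin_num_measure//.
  have tA' : trivIset [set n : 'I_N | K n] (fun n : 'I_N => A n).
    by move=> m n Km Kn mn; apply: val_inj; exact: tA Km Kn mn.
  rewrite -(@measure_bigsetU_ord_cond _ _ _ mu N (fun n : 'I_N => K n) (fun n => A n))//.
  apply: le_measure; rewrite ?inE; [exact: bigsetU_measurable|exact: measurableD|].
  apply: (big_ind (fun B => B `<=` V `\` M)) => //.
  + by move=> B C BV CV x [/BV|/CV].
  + move=> n; rewrite /K /A; case: (code n) => // kq /asboolP[[cV _] _].
    by apply: setSD.
Qed.

Lemma negligible_near_heavy e kappa : 0 < e -> 0 <= kappa ->
  mu.-negligible (near_heavy e kappa).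
Proof.
move=> e0 kappa0; apply: negligibleS (abs_cont (cube_null_near_heavy e0 kappa0)).
by move=> x hx; split; [case: hx|exists x].
Qed.

(** Two radii appear because a superlevel set is only known to contain the small box and to lie in
    the large one; the ratio is compared with the small box since [mu] need not be doubling. *)
Definition coord_density_point (x : X) : Prop :=
  forall c C e : R, 0 < c -> 0 < C -> 0 < e -> exists2 rho, 0 < rho &
    forall r, 0 < r < rho -> 0 < fine (mu (ball x (c * r))) /\
      fine (mu (ball x (C * r) `\` M)) <= e * fine (mu (ball x (c * r))).

Lemma measurable_coord_ball x r : measurable (ball x r).
Proof.
rewrite (_ : ball x r = (~` \bigcup_j ~` (D `&` (fun x' => y x' 0 j) @^-1`
    `]y x 0 j - r, y x 0 j + r[%classic)) `&` D); last first.
  apply/seteqP; split => z.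
    move=> [Dz h]; split => //; rewrite setC_bigcup => j _; rewrite setCK; split => //=.
    by rewrite in_itv/= -ltr_distl.
  move=> [+ Dz]; rewrite setC_bigcup => h; split => //= j.
  by have := h j Logic.I; rewrite setCK => -[_]/=; rewrite in_itv/= -ltr_distl.
apply: measurableI => //; apply: measurableC.
apply: countable_bigcupT_measurable => // j; apply: measurableC.
by apply: my => //; exact: measurable_itv.
Qed.

(** Choose [k] with [mesh k] comparable to [c * r]. The small box contains the cell of [x], of mass
    more than [e1] times its volume; the large box meets at most [N] cells, each with mass at most
    [e2] times this volume outside [M], and [N * e2 = e * e1]. *)
Lemma coord_density_point_of_cells x : D x ->
  (exists2 e, 0 < e & forall k, ~ light mu D y e k (idx k x)) ->
  (forall m kappa : nat, ~ near_heavy m.+1%:R^-1 kappa%:R x) ->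
  M x -> coord_density_point x.
Proof.
move=> Dx [e1 e10 he1] nheavy Mx c C e c0 C0 e0.
(* The scale will satisfy [c * r < 2 * mesh k], so that [C * r <= kappa * mesh k]. *)
pose kappa := (Num.truncn (2 * C / c)).+1.
have kC : 2 * C / c < kappa%:R by exact: truncnS_gt.
pose J := {ffun 'I_d -> 'I_(2 * kappa + 3)}.
pose N := #|J|.
have N0 : 0 < N%:R :> R.
  by rewrite ltr0n /N card_ffun !card_ord expn_gt0 addnS.
pose e2 := e * e1 / N%:R.
have e20 : 0 < e2 by rewrite divr_gt0// mulr_gt0.
pose m := Num.truncn e2^-1.
have me2 : m.+1%:R^-1 <= e2.
  by rewrite invf_ple ?posrE// ltW//; exact: truncnS_gt.
have [k0 hk0] : exists k0, forall k x', (k0 <= k)%N -> D x' ->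
    (forall j, `|y x 0 j - y x' 0 j| <= kappa%:R * mesh k) ->
    fine (mu (cell k (idx k x') `\` M)) <= e2 * mesh k ^+ d.
  apply: contrapT => /forallNP h; apply: (nheavy m kappa); split => // k0.
  have /existsNP[k /existsNP[x' /not_implyP[k0k /not_implyP[Dx' /not_implyP[xx' hv]]]]] := h k0.
  exists k, x'; split => //; rewrite /heavy ltNge; apply/negP => hv'; apply: hv.
  by apply: le_trans hv' _; rewrite ler_pM2r// exprn_gt0// mesh_gt0.
exists (Num.min (mesh k0) 1 / c); first by rewrite divr_gt0// lt_min mesh_gt0/=.
move=> r /andP[r0]; rewrite ltr_pdivlMr// mulrC lt_min => /andP[crk0 cr1].
have [|k kcr crk] := @mesh_near R (c * r); first by rewrite mulr_gt0.
have k0k : (k0 <= k)%N.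
  rewrite leqNgt; apply/negP => kk0.
  have : mesh k0 <= mesh k by apply: le_mesh; exact: ltnW.
  by rewrite leNgt (le_lt_trans kcr).
have mball := measurable_coord_ball.
have cellb : e1 * mesh k ^+ d < fine (mu (ball x (c * r))).
  apply: (@lt_le_trans _ _ (fine (mu (cell k (idx k x))))).
    by rewrite ltNge; apply/negP; exact: he1.
  apply: fine_measure_le => // z [Dz zx]; split => // j.
  by apply: lt_le_trans kcr; exact: cell_index_dist.
split; first by apply: lt_trans cellb; rewrite mulr_gt0// exprn_gt0// mesh_gt0.
have Crk : C * r <= kappa%:R * mesh k.
  have h1 : C * (c * r) <= C * (2 * mesh k) by rewrite ler_pM2l// ltW.
  rewrite -(ler_pM2r c0).
  have h2 : 2 * C < kappa%:R * c by rewrite -ltr_pdivrMr.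
  have mk := @mesh_gt0 R k.
  have : 2 * C * mesh k <= kappa%:R * c * mesh k by rewrite ler_pM2r// ltW.
  have -> : C * r * c = C * (c * r) by ring.
  move: h1; lra.
pose q (b : J) : {ffun 'I_d -> int} :=
  [ffun j => idx k x j + (b j)%:Z - (kappa.+1)%:Z].
(* Only cells that contain a point within [kappa * mesh k] of [x] are kept; for these the bound of
   [hk0] is available. *)
pose A b := if pselect (exists x', [/\ D x', idx k x' = q b &
  forall j, `|y x 0 j - y x' 0 j| <= kappa%:R * mesh k]) then cell k (q b) `\` M else set0.
have mA b : measurable (A b).
  by rewrite /A; case: pselect => h; [exact: measurableD|exact: measurable0].
have cov : ball x (C * r) `\` M `<=` \bigcup_b A b.
  move=> z [[Dz zx] nMz].
  have zx' j : `|y x 0 j - y z 0 j| <= kappa%:R * mesh k.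
    by rewrite distrC; apply: le_trans (ltW (zx j)) Crk.
  have dq j : (`|idx k z j - idx k x j| <= kappa.+1)%R.
    have /andP[f1 f2] := floor_mesh y k z j; have /andP[g1 g2] := floor_mesh y k x j.
    have mk := @mesh_gt0 R k; move: (zx' j); rewrite ler_norml => /andP[z1 z2].
    have kE : (kappa.+1%:Z)%:~R = kappa%:R + 1 :> R by rewrite -pmulrn -natr1.
    rewrite ler_norml -!(ler_int R) rmorphN/= rmorphB/= kE.
    move: f1 f2 g1 g2 z1 z2.
    set a := (idx k z j)%:~R; set b := (idx k x j)%:~R => f1 f2 g1 g2 z1 z2.
    apply/andP; split; rewrite -(ler_pM2r mk); lra.
  have J0 : (0 < 2 * kappa + 3)%N by rewrite addnS.
  pose b : J := [ffun j => insubd (Ordinal J0) (absz (idx k z j - idx k x j + kappa.+1%:Z)%R)].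
  exists b => //.
  have qb : idx k z = q b.
    apply/ffunP => j; rewrite [RHS]ffunE [b j]ffunE val_insubd.
    have [lt_off {1}->] := int_ball_offset (dq j).
    by rewrite lt_off.
  rewrite /A; case: pselect => [h|[]]; first by split.
  by exists z.
apply: le_trans (fine_measure_cover_le mu _ mA cov) _; first exact: measurableD.
apply: (@le_trans _ _ (\sum_(b : J) e2 * mesh k ^+ d)).
  apply: ler_sum => b _; rewrite /A; case: pselect => h /=.
    by have [x' [Dx' <- xx']] := h; exact: hk0.
  by rewrite measure0 mulr_ge0// ?exprn_ge0// ltW// mesh_gt0.
rewrite sumr_const -/N -(mulr_natl (e2 * _)) mulrA /e2 mulrCA mulfV ?gt_eqF// mulr1.
by rewrite -mulrA ler_pM2l// ltW.
Qed.

Lemma negligible_not_density_point :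
  mu.-negligible [set x | [/\ D x, M x & ~ coord_density_point x]].
Proof.
pose L := D `&` [set x | forall e, 0 < e -> exists k, light mu D y e k (idx k x)].
pose H m := \bigcup_(kappa : nat) near_heavy (m : nat).+1%:R^-1 kappa%:R.
apply: (negligibleS (A := L `|` \bigcup_m H m)).
  move=> x [Dx Mx nd]; apply: contrapT => nLH; apply: nd.
  apply: coord_density_point_of_cells => //.
    apply: contrapT => h; apply: nLH; left; split => // e e0.
    apply: contrapT => /forallNP nk; apply: h; exists e => //.
  by move=> m kappa hx; apply: nLH; right; exists m => //; exists kappa.
apply: negligibleU; first exact: negligible_light.
apply: negligible_bigcup => m; apply: negligible_bigcup => kappa.
by apply: negligible_near_heavy.
Qed.

End density.

(** * Metric balls in charts *)

Section row_norm.
Context (R : realType) (d : nat).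
Implicit Types (x : 'rV[R]_d) (e : R).

Lemma rV_norm_le x e : 0 <= e -> (`|x| <= e) <-> (forall j, `|x 0 j| <= e).
Proof.
move=> e0; rewrite [leLHS]/Num.Def.normr/= mx_normrE; split.
  by move/bigmax_leP => [_ h] j; exact: (h (0, j)).
by move=> h; apply/bigmax_leP; split => // -[i j] _; rewrite ord1.
Qed.

Lemma rV_norm_lt x e : 0 < e -> (`|x| < e) <-> (forall j, `|x 0 j| < e).
Proof.
move=> e0; rewrite [ltLHS]/Num.Def.normr/= mx_normrE; split.
  by move/bigmax_ltP => [_ h] j; exact: (h (0, j)).
by move=> h; apply/bigmax_ltP; split => // -[i j] _; rewrite ord1.
Qed.

Lemma rV_coord_norm_le x j : `|x 0 j| <= `|x|.
Proof. exact: (rV_norm_le x (normr_ge0 x)).1. Qed.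

End row_norm.

(** * Differentiability from continuous partial derivatives *)

Section continuous_partials.
Context (R : realType).

Lemma increment_le (g dg : R -> R) (L e t : R) :
  (forall s : R, `|s| <= `|t| -> is_derive s 1 g (dg s)) ->
  (forall s : R, `|s| <= `|t| -> `|dg s - L| <= e) ->
  `|g t - g 0 - t * L| <= e * `|t|.
Proof.
move=> hg hdg.
have key a b : a <= b -> (forall s, a <= s <= b -> `|s| <= `|t|) ->
    `|g b - g a - (b - a) * L| <= e * (b - a).
  move=> ab hab; have [||c] := @MVT_segment R g dg a b ab.
  - move=> x; rewrite in_itv/= => /andP[/ltW ax /ltW xb].
    by apply: hg; apply: hab; rewrite ax xb.
  - apply: derivable_within_continuous => x; rewrite in_itv/= => xab.
    by have [] := hg x (hab x xab).
  - rewrite in_itv/= => cab ->.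
    rewrite [_ * L]mulrC -mulrBl normrM [ `|b - a|]ger0_norm ?subr_ge0//.
    by rewrite ler_wpM2r ?subr_ge0//; apply: hdg; exact: hab.
have [t0|/ltW t0] := leP 0 t.
  have /key : (0 : R) <= t by [].
  rewrite subr0 ger0_norm//; apply => s /andP[s0 st].
  by rewrite !ger0_norm.
have := key t 0 t0; rewrite sub0r => h.
rewrite (ler0_norm t0) -normrN; apply: le_trans (h _).
  by rewrite le_eqVlt; apply/orP; left; apply/eqP; congr `|_|; ring.
by move=> s /andP[ts s0]; rewrite !ler0_norm// lerN2.
Qed.

Lemma is_derive_line (V W : normedModType R) (f : V -> W) (z e : V) (t : R) :
  derivable f (z + t *: e) e ->
  is_derive t 1 (fun s => f (z + s *: e)) ('D_e f (z + t *: e)).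
Proof.
have E : (fun h : R => h^-1 *: (((fun s => f (z + s *: e)) \o shift t) (h *: 1) - f (z + t *: e))) =
    (fun h : R => h^-1 *: ((f \o shift (z + t *: e)) (h *: e) - f (z + t *: e))).
  apply/funext => h /=; congr (_ *: (f _ - _)).
  by rewrite scaler1 scalerDl addrCA.
by move=> df; split; rewrite /derivable /derive E.
Qed.

(** Moves from [x] to [x + h] along one coordinate at a time, [hk k] retaining the first [k]
    coordinates of [h], and applies the mean value theorem to each step. In the sup norm the path
    stays in the ball of radius [r]. *)
Lemma continuous_partials_increment (d : nat) (f : 'rV[R]_d -> R) (x : 'rV[R]_d) :
  (\forall z \near x, forall j, derivable f z (delta_mx 0 j)) ->
  (forall j, {for x, continuous ('D_(delta_mx 0 j) f)}) ->
  forall e : R, 0 < e -> exists2 r : R, 0 < r & forall h, `|h| < r ->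
    `|f (x + h) - f x - \sum_j h 0 j * 'D_(delta_mx 0 j) f x| <= e * `|h|.
Proof.
move=> df cf e e0; pose e' := e / d.+1%:R.
have e'0 : 0 < e' by rewrite divr_gt0.
have : \forall z \near x, (forall j, derivable f z (delta_mx 0 j)) /\
    forall j, `|'D_(delta_mx 0 j) f x - 'D_(delta_mx 0 j) f z| <= e'.
  near=> z; split; first by near: z.
  near: z; apply: filter_forall => j.
  by have /cvgrPdist_le/(_ e' e'0) := cf j.
move=> /nbhs_ballP[r /= r0 hr]; exists r => // h hr'.
pose hk k : 'rV[R]_d := \row_j (if (j < k)%N then h 0 j else 0).
have hk0 : hk 0%N = 0 by apply/rowP => j; rewrite !mxE ltn0.
have hkd : hk d = h by apply/rowP => j; rewrite !mxE ltn_ord.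
have hkS (k : 'I_d) : hk k.+1 = hk k + h 0 k *: delta_mx 0 k.
  apply/rowP => j; rewrite !mxE ltnS leq_eqVlt eqxx/=.
  have [->|kj] := eqVneq j k; first by rewrite eqxx ltnn mulr1 add0r.
  by rewrite (inj_eq val_inj) (negbTE kj)/= mulr0 addr0.
have step (k : 'I_d) : `|f (x + hk k.+1) - f (x + hk k) -
    h 0 k * 'D_(delta_mx 0 k) f x| <= e' * `|h|.
  have inball s : `|s| <= `|h 0 k| -> ball x r (x + hk k + s *: delta_mx 0 k).
    move=> sh; rewrite mx_norm_ball /ball_ /= -addrA opprD addNKr normrN.
    apply: le_lt_trans hr'; apply/rV_norm_le => // j; rewrite !mxE eqxx/=.
    have [->|jk] := eqVneq j k.
      by rewrite ltnn add0r mulr1 (le_trans sh)// rV_coord_norm_le.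
    rewrite mulr0 addr0; case: ifP => _; first exact: rV_coord_norm_le.
    by rewrite normr0.
  have := @increment_le (fun s => f (x + hk k + s *: delta_mx 0 k))
    (fun s => 'D_(delta_mx 0 k) f (x + hk k + s *: delta_mx 0 k))
    ('D_(delta_mx 0 k) f x) e' (h 0 k).
  have E : x + hk k + h 0 k *: delta_mx 0 k = x + hk k.+1 by rewrite -addrA -hkS.
  rewrite /= E scale0r addr0 => H.
  apply: le_trans (H _ _) _.
  - by move=> s sh; apply: is_derive_line; apply: (hr _ (inball s sh)).1.
  - by move=> s sh; rewrite distrC; apply: (hr _ (inball s sh)).2.
  - by rewrite ler_pM2l//; exact: rV_coord_norm_le.
have -> : f (x + h) - f x = \sum_(k < d) (f (x + hk k.+1) - f (x + hk k)).
  rewrite -(big_mkord xpredT (fun k => f (x + hk k.+1) - f (x + hk k))).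
  by rewrite telescope_sumr// hkd hk0 addr0.
rewrite -sumrB; apply: le_trans (ler_norm_sum _ _ _) _.
apply: le_trans (ler_sum _ (fun k _ => step k)) _.
rewrite sumr_const card_ord -mulr_natl mulrA ler_wpM2r//.
by rewrite /e' mulrCA ger_pMr// ler_pdivrMr// mul1r ler_nat.
Unshelve. all: by end_near. Qed.

Lemma differentiable_of_increment (V W : normedModType R) (f : V -> W)
    (df : {linear V -> W}) (x : V) : continuous df ->
  (forall e : R, 0 < e -> \forall h \near (0 : V), `|f (x + h) - f x - df h| <= e * `|h|) ->
  differentiable f x.
Proof.
move=> cdf H; have E : f \o shift x = cst (f x) + df +o_ 0 id.
  apply/eqaddoP => _/posnumP[e]; have e0 : 0 < e%:num by [].
  apply: filter_app (H _ e0); near=> h; rewrite /= !fctE.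
  by rewrite [h + x]addrC opprD addrA.
by apply/diff_locallyP; rewrite (diff_unique cdf E).
Unshelve. all: by end_near. Qed.

(** Smoothness of transition maps is given through partial derivatives, while the chain rule along
    curves uses the total derivative. *)
Lemma continuous_partials_differentiable (d m : nat) (f : 'rV[R]_d -> 'rV[R]_m)
    (x : 'rV[R]_d) :
  (forall k, \forall z \near x, forall j, derivable (fun y => f y 0 k) z (delta_mx 0 j)) ->
  (forall k j, {for x, continuous ('D_(delta_mx 0 j) (fun y => f y 0 k))}) ->
  differentiable f x.
Proof.
move=> df cf.
pose A : 'M[R]_(d, m) := \matrix_(j, k) 'D_(delta_mx 0 j) (fun y => f y 0 k) x.
pose df0 : {linear 'rV[R]_d -> 'rV[R]_m} := mulmxr A.
have cdf : continuous df0.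
  apply: bounded_linear_continuous; apply/bounded_funP => r.
  exists (\sum_j `|r| * \sum_k `|A j k|) => v vr.
  have nn : 0 <= \sum_j `|r| * \sum_k `|A j k|.
    by apply: sumr_ge0 => j _; rewrite mulr_ge0// sumr_ge0.
  apply/(rV_norm_le _ nn) => k; rewrite mxE.
  apply: le_trans (ler_norm_sum _ _ _) _; apply: ler_sum => j _.
  rewrite normrM ler_pM//.
    by rewrite (le_trans (rV_coord_norm_le _ _))// (le_trans vr)// ler_norm.
  by rewrite (bigD1 k)//= lerDl sumr_ge0.
apply: (differentiable_of_increment cdf) => e e0.
have : forall k, \forall h \near (0 : 'rV[R]_d),
    `|f (x + h) 0 k - f x 0 k - (h *m A) 0 k| <= e * `|h|.
  move=> k; have [r r0 hr] := continuous_partials_increment (df k) (cf k) e0.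
  apply/nbhs_ballP; exists r => //= h; rewrite mx_norm_ball /ball_/= sub0r normrN => hr'.
  by rewrite mxE; under eq_bigr do rewrite mxE; exact: hr.
move/filter_forall; apply: filter_app; near=> h => hk.
have eh0 : 0 <= e * `|h| by rewrite mulr_ge0// ltW.
by apply/(rV_norm_le _ eh0) => k; have := hk k; rewrite !mxE.
Unshelve. all: by end_near. Qed.

End continuous_partials.

Lemma cvg_sumr (R : realType) (T : Type) (F : set_system T) {FF : Filter F}
    (I : Type) (r : seq I) (f : I -> T -> R) (l : I -> R) :
  (forall i, f i t @[t --> F] --> l i) ->
  (\sum_(i <- r) f i t) @[t --> F] --> \sum_(i <- r) l i.
Proof.
move=> fl; elim: r => [|i r IH].
  by rewrite big_nil; under eq_fun do rewrite big_nil; exact: cvg_cst.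
by rewrite big_cons; under eq_fun do rewrite big_cons; exact: cvgD.
Qed.

Section quadratic_forms.
Context (R : realType) (d : nat).
Implicit Types (G : 'M[R]_d) (v w : 'rV[R]_d).

Definition qform G v : R := (v *m G *m v^T) 0 0.

Lemma qformE G v : qform G v = \sum_l (\sum_k v 0 k * G k l) * v 0 l.
Proof. by rewrite /qform mxE; apply: eq_bigr => l _; rewrite !mxE. Qed.

Lemma qformZ G (t : R) v : qform G (t *: v) = t ^+ 2 * qform G v.
Proof. by rewrite /qform linearZ/= -!scalemxAl -scalemxAr !mxE; ring. Qed.

Lemma qformB G G' v : qform G v - qform G' v = qform (G - G') v.
Proof. by rewrite /qform mulmxBr mulmxBl !mxE. Qed.

Lemma qform_norm_le G v e : (forall k l, `|G k l| <= e) ->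
  `|qform G v| <= (d%:R ^+ 2 * e) * `|v| ^+ 2.
Proof.
move=> Ge; rewrite qformE; apply: le_trans (ler_norm_sum _ _ _) _.
have h l : `|(\sum_k v 0 k * G k l) * v 0 l| <= d%:R * e * `|v| ^+ 2.
  rewrite normrM expr2 mulrA ler_pM ?rV_coord_norm_le//.
  apply: le_trans (ler_norm_sum _ _ _) _.
  apply: (@le_trans _ _ (\sum_(k < d) (e * `|v|))).
    by apply: ler_sum => k _; rewrite normrM mulrC ler_pM// rV_coord_norm_le.
  by rewrite sumr_const card_ord -(mulr_natl (e * _)) mulrA.
apply: le_trans (ler_sum _ (fun l _ => h l)) _.
by rewrite sumr_const card_ord -(mulr_natl (d%:R * e * _)) expr2 !mulrA.
Qed.

Lemma continuous_qform (T : topologicalType) (G : T -> 'M[R]_d) (v : T -> 'rV[R]_d) (t : T) :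
  (forall k l, {for t, continuous (fun s => G s k l)}) ->
  (forall k, {for t, continuous (fun s => v s 0 k)}) ->
  {for t, continuous (fun s => qform (G s) (v s))}.
Proof.
move=> cG cv; rewrite /prop_for/= /continuous_at/= qformE.
under eq_fun do rewrite qformE.
apply: cvg_sumr => l; apply: cvgM; last exact: cv.
by apply: cvg_sumr => k; apply: cvgM; [exact: cv|exact: cG].
Qed.

(** The minimum over the compact unit sphere, extended by homogeneity. The sphere is empty when
    [d = 0], and then only [v = 0] is left. *)
Lemma posdef_qform_ge G : (forall v, v != 0 -> 0 < qform G v) ->
  exists2 a : R, 0 < a & forall v, a * `|v| ^+ 2 <= qform G v.
Proof.
move=> Gpos; pose Sph : set 'rV[R]_d := [set v | `|v| = 1].
have [[v0 Sv0]|noS] := pselect (Sph !=set0); last first.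
  exists 1 => // v; have [->|vn0] := eqVneq v 0.
    by rewrite normr0 expr0n mulr0 /qform !mul0mx mxE.
  exfalso; apply: noS; exists (`|v|^-1 *: v); rewrite /Sph/= normrZ normfV normr_id.
  by rewrite mulVf// normr_eq0.
have cS : compact Sph.
  apply: bounded_closed_compact.
    exists 1; split; first exact: num_real.
    by move=> x x1 v vS; rewrite /= (vS : `|v| = 1); exact: ltW.
  rewrite (_ : Sph = (fun v : 'rV[R]_d => `|v|) @^-1` [set 1]); last by [].
  by apply: preimage_closed => [v _|]; [exact: norm_continuous|exact: closed_eq].
have cq : continuous (qform G).
  move=> v; apply: (@continuous_qform _ (fun=> G) id v) => [k l|k]; first exact: cst_continuous.
  exact: coord_continuous.
have cqS : {within Sph, continuous (qform G)} by exact: continuous_subspaceT.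
have [w Sw wmin] := EVT_min_rV (ex_intro _ v0 Sv0) cS cqS.
have wn0 : w != 0 by rewrite -normr_eq0 (set_mem Sw) oner_eq0.
exists (qform G w); first exact: Gpos.
move=> v; have [->|vn0] := eqVneq v 0.
  by rewrite normr0 expr0n mulr0 /qform !mul0mx mxE.
have nv0 : 0 < `|v| by rewrite normr_gt0.
have := wmin (`|v|^-1 *: v); rewrite qformZ => h.
have : qform G w <= `|v|^-1 ^+ 2 * qform G v.
  apply: h; rewrite inE /Sph/= normrZ normfV normr_id mulVf// gt_eqF//.
by rewrite exprVn mulrC ler_pdivlMr// exprn_gt0.
Qed.

End quadratic_forms.

Section charts.
Context (R : realType) (d : nat) (S : topologicalType).
Variable g : riemannian_manifold R d S.

Lemma overlap_near (i j : chart_index g) y :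
  (@chart _ _ _ g i @` (dom i `&` dom j)) y ->
  \forall z \near y, (@chart _ _ _ g i @` (dom i `&` dom j)) z.
Proof.
move=> [x [ix jx] <-].
have ci : (@chart _ _ _ g i @` dom i) (chart i x) by exists x.
have : \forall z \near chart i x, dom j (chart_inv i z).
  apply: (chart_inv_continuous ci); rewrite chartK//.
  by apply: open_nbhs_nbhs; split => //; exact: dom_open.
have : \forall z \near chart i x, (@chart _ _ _ g i @` dom i) z.
  by apply: open_nbhs_nbhs; split => //; exact: chart_image_open.
apply: filterS2 => z [x' ix' <-]; rewrite chartK// => jx'.
by exists x'.
Qed.

Lemma transition_differentiable (i j : chart_index g) y :
  (@chart _ _ _ g i @` (dom i `&` dom j)) y ->
  differentiable (fun z => chart j (chart_inv i z)) y.
Proof.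
move=> Uy; apply: continuous_partials_differentiable.
  move=> k; have [_ h] := @transition_smooth _ _ _ g i j k 1%N.
  by apply: filterS (overlap_near Uy) => z Uz l; have [hl _] := h l; exact: hl.
move=> k l; have [_ h] := @transition_smooth _ _ _ g i j k 1%N.
by have [_ [hl _]] := h l; exact: hl.
Qed.

(** Entries that move by at most [e] change the form by at most [d ^ 2 * e * |v| ^ 2]; [e] is chosen
    to make this at most half of the lower bound at [y0]. *)
Lemma metric_comparable (i : chart_index g) y0 : (@chart _ _ _ g i @` dom i) y0 ->
  exists a b rho : R, [/\ 0 < a, 0 < b, 0 < rho & forall y, `|y - y0| <= rho ->
    (@chart _ _ _ g i @` dom i) y /\
    forall v, a * `|v| ^+ 2 <= qform (@metric _ _ _ g i y) v <= b * `|v| ^+ 2].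
Proof.
move=> Uy0; have [a a0 ha] := posdef_qform_ge (@metric_posdef _ _ _ g i y0 Uy0).
pose e := a / 2 / (d%:R ^+ 2 + 1).
have d1 : 0 < d%:R ^+ 2 + 1 :> R by rewrite ltr_wpDl// exprn_ge0.
have e0 : 0 < e by rewrite !divr_gt0.
pose B := \sum_kl `|@metric _ _ _ g i y0 kl.1 kl.2|.
have B0 : 0 <= B by apply: sumr_ge0.
have : \forall y \near y0, (@chart _ _ _ g i @` dom i) y /\
    forall kl, `|@metric _ _ _ g i y0 kl.1 kl.2 - @metric _ _ _ g i y kl.1 kl.2| <= e.
  near=> y; split.
    by near: y; apply: open_nbhs_nbhs; split => //; exact: chart_image_open.
  near: y; apply: filter_forall => -[k l] /=.
  have [cm _] := @metric_smooth _ _ _ g i k l 0%N.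
  by have /cvgrPdist_le/(_ e e0) := cm y0 Uy0.
move=> /nbhs_ballP[r /= r0 hr].
exists (a / 2), (d%:R ^+ 2 * (B + e) + 1), (r / 2).
have dBe : 0 <= d%:R ^+ 2 * (B + e) by rewrite mulr_ge0 ?exprn_ge0// addr_ge0// ltW.
split; rewrite ?divr_gt0//; first by rewrite ltr_wpDl.
move=> y yr; have [|Uy hy] := hr y.
  rewrite mx_norm_ball /ball_/= distrC (le_lt_trans yr)//.
  by rewrite ltr_pdivrMr// ltr_pMr// ltr1n.
split=> // v.
have hB : `|qform (@metric _ _ _ g i y0) v - qform (@metric _ _ _ g i y) v| <=
    (d%:R ^+ 2 * e) * `|v| ^+ 2.
  rewrite qformB; apply: qform_norm_le => k l.
  by have := hy (k, l); rewrite !mxE.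
have hG : `|qform (@metric _ _ _ g i y) v| <= (d%:R ^+ 2 * (B + e)) * `|v| ^+ 2.
  apply: qform_norm_le => k l; rewrite -[@metric _ _ _ g i y k l](subrK (@metric _ _ _ g i y0 k l)).
  rewrite addrC; apply: le_trans (ler_normD _ _) _; apply: lerD.
    by rewrite /B (bigD1 (k, l))//= lerDl sumr_ge0.
  by rewrite distrC; exact: (hy (k, l)).
have v0 : 0 <= `|v| ^+ 2 by rewrite exprn_ge0.
apply/andP; split.
  have de : d%:R ^+ 2 * e <= a / 2.
    rewrite /e mulrA ler_pdivrMr// mulrC ler_pM2l ?divr_gt0//.
    by rewrite lerDl.
  have : d%:R ^+ 2 * e * `|v| ^+ 2 <= a / 2 * `|v| ^+ 2 by rewrite ler_wpM2r.
  have := ha v; move: hB; rewrite ler_norml => /andP[_].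
  lra.
move: hG; rewrite ler_norml => /andP[_] /le_trans; apply.
by rewrite mulrDl mul1r lerDl.
Unshelve. all: by end_near. Qed.

End charts.

(** * Curves seen in a fixed chart *)

Section arcs.
Context (R : realType) (d : nat) (S : topologicalType).
Variable g : riemannian_manifold R d S.
Local Notation chart := (@chart _ _ _ g).
Local Notation metric := (@metric _ _ _ g).

Definition admissible_arc (i : chart_index g) (c : R -> 'rV[R]_d) : Prop :=
  [/\ forall t, derivable c t 1, continuous (derive1 c) &
      forall t, 0 <= t <= 1 -> (chart i @` dom i) (c t)].

Definition speed (i : chart_index g) (c : R -> 'rV[R]_d) (t : R) : R :=
  Num.sqrt (qform (metric i (c t)) (derive1 c t)).

Section one_arc.
Variables (i : chart_index g) (c : R -> 'rV[R]_d).
Hypothesis adm : admissible_arc i c.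

Lemma arc_continuous : continuous c.
Proof.
move=> t; apply: differentiable_continuous; apply/derivable1_diffP.
by have [dc _ _] := adm; exact: dc.
Qed.

Lemma speed_continuous (t : R) : 0 <= t <= 1 -> {for t, continuous (speed i c)}.
Proof.
move=> t01; have [_ cdc Uc] := adm.
apply: (@continuous_comp _ _ _ (fun s => qform (metric i (c s)) (derive1 c s)) Num.sqrt).
  apply: continuous_qform => [k l|k].
    have [cm _] := @metric_smooth _ _ _ g i k l 0%N.
    apply: (@continuous_comp _ _ _ c (fun y => metric i y k l)).
      exact: arc_continuous.
    exact: cm (Uc t t01).
  apply: (@continuous_comp _ _ _ (derive1 c) (fun v : 'rV[R]_d => v 0 k)).
    exact: cdc.
  exact: coord_continuous.
exact: sqrt_continuous.
Qed.

Lemma speed_integrable : lebesgue_measure.-integrable `[0 : R, 1] (EFin \o speed i c).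
Proof.
apply: continuous_compact_integrable; first exact: segment_compact.
apply: continuous_in_subspaceT => t; rewrite inE/= in_itv/= => t01.
exact: speed_continuous.
Qed.

Definition partial_length (t : R) : R := \int[lebesgue_measure]_(s in `[0, t]) speed i c s.

Lemma arc_lengthE : arc_length i c = partial_length 1.
Proof. by []. Qed.

Lemma partial_length0 : partial_length 0 = 0.
Proof. by rewrite /partial_length set_itv1 Rintegral_set1. Qed.

Lemma partial_length_derive (t : R) : 0 < t < 1 ->
  is_derive t 1 partial_length (speed i c t).
Proof.
move=> /andP[t0 t1].
have [|d1 d2] := continuous_FTC1_closed t1 speed_integrable t0 _.
  by apply: speed_continuous; rewrite !ltW.
split; [exact: d1|rewrite -derive1E; exact: d2].
Qed.

Lemma partial_length_continuous : {within `[0, 1], continuous partial_length}.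
Proof. exact: (parameterized_integral_continuous ler01 speed_integrable). Qed.

Lemma partial_length_ge0 t : 0 <= partial_length t.
Proof. by apply: Rintegral_ge0 => s _; exact: sqrtr_ge0. Qed.

Lemma partial_length_le (s t : R) : 0 <= s -> s <= t -> t <= 1 ->
  partial_length s <= partial_length t.
Proof.
move=> s0 st t1; apply: (@ger0_derive1_le_cc _ partial_length 0 1) => //.
- move=> x; rewrite in_itv/= => x01.
  by have [] := partial_length_derive x01.
- move=> x; rewrite in_itv/= => x01; have [_ E] := partial_length_derive x01.
  by rewrite derive1E E sqrtr_ge0.
- exact: partial_length_continuous.
- by rewrite in_itv/= s0 (le_trans st).
- by rewrite in_itv/= (le_trans s0).
Qed.

Lemma arc_length_ge0 : 0 <= arc_length i c.
Proof. by rewrite arc_lengthE partial_length_ge0. Qed.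

End one_arc.

Section chart_box.
Variables (i : chart_index g) (y0 : 'rV[R]_d) (a b rho : R).
Hypothesis a0 : 0 < a.
Hypothesis box : forall y, `|y - y0| <= rho -> (chart i @` dom i) y /\
  forall v, a * `|v| ^+ 2 <= qform (metric i y) v <= b * `|v| ^+ 2.

(** By the lower bound in [box], the coordinate norm of a velocity is at most [K] times its
    Riemannian norm. *)
Let K := (Num.sqrt a)^-1.

Lemma K_gt0 : 0 < K.
Proof. by rewrite invr_gt0 sqrtr_gt0. Qed.

(** The image of a compact box under the continuous inverse chart, in a Hausdorff space. Closedness
    in all of [S] is the point: a curve cannot leave the domain of the chart without leaving the
    box. *)
Lemma chart_box_closed r : 0 <= r -> r <= rho ->
  closed [set x | dom i x /\ `|chart i x - y0| <= r].
Proof.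
move=> r0 r_rho.
have -> : [set x | dom i x /\ `|chart i x - y0| <= r] =
    chart_inv i @` [set y | `|y - y0| <= r].
  apply/seteqP; split => x /=.
    by move=> [ix xr]; exists (chart i x) => //; exact: chartK.
  move=> [y yr <-]; have [[z iz zy] _] := box (le_trans yr r_rho).
  by rewrite -zy chartK// zy.
apply: compact_closed; first exact: manifold_hausdorff g.
apply: continuous_compact.
  apply: continuous_in_subspaceT => y; rewrite inE => /= yr.
  by apply: chart_inv_continuous; have [] := box (le_trans yr r_rho).
rewrite (_ : [set y | _] = [set y : 'rV[R]_d | forall k,
  `[y0 0 k - r, y0 0 k + r]%classic (y 0 k)]).
  apply: (@rV_compact R d (fun k => `[y0 0 k - r, y0 0 k + r]%classic)) => k.
  exact: segment_compact.
apply/seteqP; split => y /=.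
  by move/(rV_norm_le _ r0) => h k; have := h k; rewrite !mxE in_itv/= ler_distl.
move=> h; apply/(rV_norm_le _ r0) => k; have := h k.
by rewrite !mxE in_itv/= ler_distl.
Qed.

Variables (j : chart_index g) (c : R -> 'rV[R]_d).
Hypothesis adm : admissible_arc j c.
Let curve t := chart_inv j (c t).
Let coord t := chart i (curve t).
Let inside t := dom i (curve t) /\ `|coord t - y0| < rho.

Lemma curve_continuous (t : R) : 0 <= t <= 1 -> {for t, continuous curve}.
Proof.
move=> t01; have [_ _ Uc] := adm.
apply: (@continuous_comp _ _ _ c (chart_inv j)).
  exact: arc_continuous adm _.
exact: chart_inv_continuous (Uc t t01).
Qed.

Lemma curve_overlap (t : R) : 0 <= t <= 1 -> dom i (curve t) ->
  (chart j @` (dom j `&` dom i)) (c t).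
Proof.
move=> t01 it; have [_ _ Uc] := adm; have [z jz cz] := Uc t t01.
by exists z => //; split => //; move: it; rewrite /curve -cz chartK.
Qed.

Lemma coord_derivable (t : R) : 0 <= t <= 1 -> dom i (curve t) ->
  derivable coord t 1 /\
  derive1 coord t = derive1 c t *m 'J (fun z => chart i (chart_inv j z)) (c t).
Proof.
move=> t01 it; have [dc _ _] := adm.
have df := transition_differentiable (curve_overlap t01 it).
have dct : differentiable c t by apply/derivable1_diffP; exact: dc.
have dcoord : differentiable coord t.
  exact: (@differentiable_comp _ _ _ _ c (fun z => chart i (chart_inv j z))).
split; first exact/derivable1_diffP.
rewrite derive1E deriveE// /coord /curve.
rewrite (_ : (fun t => _) = (fun z => chart i (chart_inv j z)) \o c)//.
rewrite diff_comp//= derive1E deriveE//.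
by rewrite /jacobian mul_rV_lin1.
Qed.

(** The arc is given in its own chart [j]; by [metric_transition] its speed is the same when read in
    the chart [i], where [box] applies. *)
Lemma speed_coord (t : R) : 0 <= t <= 1 -> inside t ->
  `|derive1 coord t| <= K * speed j c t.
Proof.
move=> t01 [it yt]; have [_ ->] := coord_derivable t01 it.
have /= mt := @metric_transition _ _ _ g j i (c t) (curve_overlap t01 it).
rewrite /speed mt /qform; set w := derive1 c t; set J := 'J _ _.
have -> : w *m (J *m metric i (chart i (chart_inv j (c t))) *m J^T) *m w^T =
    (w *m J) *m metric i (coord t) *m (w *m J)^T.
  by rewrite trmx_mul !mulmxA.
have [_ /(_ (w *m J))/andP[h _]] := box (ltW yt).
rewrite mulrC ler_pdivlMr ?sqrtr_gt0// mulrC.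
rewrite -[ `|w *m J|]ger0_norm// -sqrtr_sqr -sqrtrM ?(ltW a0)//.
exact: ler_wsqrtr.
Qed.

(** For each coordinate and each sign [e], the function [K * partial_length j c s - e * coord s 0 k]
    of [s] has nonnegative derivative by [speed_coord]. *)
Lemma coord_dist (t : R) : 0 <= t <= 1 -> (forall s, 0 <= s <= t -> inside s) ->
  `|coord t - coord 0| <= K * partial_length j c t.
Proof.
move=> /andP[t0 t1] ins.
have K0 := ltW K_gt0.
apply/rV_norm_le; first by rewrite mulr_ge0// partial_length_ge0.
move=> k; rewrite !mxE.
have s01 s : 0 <= s <= t -> 0 <= s <= 1.
  by move=> /andP[-> /le_trans]; apply.
have dk s : 0 <= s <= t -> is_derive s 1 (fun s => coord s 0 k) (derive1 coord s 0 k).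
  move=> st; have [it _] := ins s st; have [dc _] := coord_derivable (s01 s st) it.
  split; first by have /derivable_mxP := dc; exact.
  by rewrite derive1E (derive_mx dc) mxE.
have mono (e : R) : `|e| <= 1 ->
    e * (coord t 0 k - coord 0 0 k) <= K * partial_length j c t.
  move=> e1; pose phi s := K * partial_length j c s - e * coord s 0 k.
  suff : phi 0 <= phi t by rewrite /phi partial_length0; lra.
  have dphi s : s \in `]0, t[ -> is_derive s 1 phi (K * speed j c s - e * derive1 coord s 0 k).
    rewrite in_itv/= => /andP[s0 st].
    have st' : 0 <= s <= t by rewrite !ltW.
    have s1 : 0 < s < 1 by rewrite s0 (lt_le_trans st).
    have h1 := partial_length_derive adm s1; have h2 := dk s st'.
    exact: is_deriveB.
  apply: (@ger0_derive1_le_cc _ phi 0 t) => //; rewrite ?in_itv/= ?lexx ?t0//.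
  - by move=> s /dphi[].
  - move=> s sin; have [_ E] := dphi s sin; rewrite derive1E E subr_ge0.
    move: sin; rewrite in_itv/= => /andP[s0 st].
    have st' : 0 <= s <= t by rewrite !ltW.
    apply: le_trans (speed_coord (s01 s st') (ins s st')).
    apply: le_trans (ler_norm _) _; rewrite normrM -[leRHS]mul1r.
    by rewrite ler_pM// rV_coord_norm_le.
  - have cP : {within `[0, t], continuous (partial_length j c)}.
      apply: continuous_subspaceW (partial_length_continuous adm).
      by move=> s /=; rewrite !in_itv/= => /s01.
    have cC : {within `[0, t], continuous (fun s => coord s 0 k)}.
      apply: continuous_in_subspaceT => s; rewrite inE/= in_itv/= => st.
      have [ds _] := dk s st.
      by apply: differentiable_continuous; apply/derivable1_diffP.
    move=> s; apply: cvgB; apply: cvgM; [exact: cvg_cst|exact: cP|exact: cvg_cst|exact: cC].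
rewrite ler_norml; apply/andP; split.
  have := mono (-1); rewrite normrN1 lexx => /(_ isT); lra.
by have := mono 1; rewrite normr1 lexx mul1r; exact.
Qed.

Lemma inside_near (t : R) : 0 <= t <= 1 -> inside t -> \forall s \near t, inside s.
Proof.
move=> t01 [it yt].
have cc : {for t, continuous coord}.
  apply: differentiable_continuous; apply/derivable1_diffP.
  by have [] := coord_derivable t01 it.
have e0 : 0 < rho - `|coord t - y0| by rewrite subr_gt0.
move/cvgrPdist_lt : cc => /(_ _ e0) cc.
have ci : \forall s \near t, dom i (curve s).
  apply: (curve_continuous t01); apply: open_nbhs_nbhs.
  by split => //; exact: dom_open.
near=> s; split; first by near: s.
apply: le_lt_trans (ler_distD (coord t) _ _) _.
by rewrite distrC -ltrBrDr; near: s.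
Unshelve. all: by end_near. Qed.

(** Let [sg] be the supremum of the times up to which the curve stays inside. Before [sg] it stays
    within [r < rho] of [y0] by [coord_dist]; the closed box of radius [r] then contains the point
    at time [sg], and openness would allow a later time unless [sg = 1]. *)
Lemma curve_stays_inside : inside 0 ->
  `|coord 0 - y0| + K * arc_length j c < rho ->
  forall t, 0 <= t <= 1 -> inside t.
Proof.
move=> in0 Krho.
pose A := [set t : R | 0 <= t <= 1 /\ forall s, 0 <= s <= t -> inside s].
have A0 : A 0.
  split; first by rewrite lexx ler01.
  by move=> s s0; rewrite (_ : s = 0)//; apply/eqP; rewrite eq_le andbC.
have hsA : has_sup A by split; [exists 0|exists 1 => t [/andP[]]].
pose sg := sup A.
have sg0 : 0 <= sg by apply: sup_upper_bound.
have sg1 : sg <= 1 by apply: ge_sup => [|t [/andP[]]]; first by exists 0.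
have sg01 : 0 <= sg <= 1 by rewrite sg0.
have below s : 0 <= s < sg -> inside s.
  move=> /andP[s0 ssg]; have e0 : 0 < sg - s by rewrite subr_gt0.
  have [t [_ ht]] := sup_adherent e0 hsA; rewrite -/sg opprB addrC subrK => st.
  by apply: ht; rewrite s0 ltW.
set r := `|coord 0 - y0| + K * arc_length j c in Krho.
have bound s : 0 <= s < sg -> `|coord s - y0| <= r.
  move=> /andP[s0 ssg]; have s1 : s <= 1 by rewrite (le_trans (ltW ssg)).
  apply: le_trans (ler_distD (coord 0) _ _) _.
  rewrite addrC; apply: lerD => //.
  apply: le_trans (coord_dist _ _) _; first by rewrite s0.
    by move=> u /andP[u0 us]; apply: below; rewrite u0 (le_lt_trans us).
  by rewrite ler_pM2l ?K_gt0// arc_lengthE; exact: partial_length_le.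
have insg : inside sg.
  move: (sg0); rewrite le_eqVlt => /predU1P[<-//|sgp].
  have : [set x | dom i x /\ `|chart i x - y0| <= r] (curve sg).
    apply: contrapT => nE.
    have : \forall t \near sg, (~` [set x | dom i x /\ `|chart i x - y0| <= r]) (curve t).
      apply: (curve_continuous sg01); apply: open_nbhs_nbhs; split => //.
      rewrite openC; apply: chart_box_closed; last exact: ltW.
      by rewrite addr_ge0// mulr_ge0 ?(ltW K_gt0)// arc_length_ge0.
    move=> /nbhs_ballP[e /= e0 he].
    pose s := Num.max 0 (sg - e / 2).
    have s_sg : 0 <= s < sg by rewrite le_max lexx gt_max sgp ltrBlDr ltrDl divr_gt0.
    have : ball sg e s.
      rewrite /ball/= ger0_norm ?subr_ge0; last by case/andP: s_sg => _ /ltW.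
      rewrite ltrBlDr -ltrBlDl lt_max; apply/orP; right.
      by rewrite ltrD2l ltrN2 ltr_pdivrMr// ltr_pMr// ltr1n.
    move/he; apply; split; first by have [] := below s s_sg.
    exact: bound.
  by move=> [isg h]; split => //; apply: le_lt_trans h Krho.
have upto s : 0 <= s <= sg -> inside s.
  by move=> /andP[s0]; rewrite le_eqVlt => /predU1P[->//|ssg]; apply: below; rewrite s0.
have sgE : sg = 1.
  apply/eqP; rewrite eq_le sg1 leNgt; apply/negP => sgl.
  have /nbhs_ballP[e /= e0 he] := inside_near sg01 insg.
  pose t := Num.min 1 (sg + e / 2).
  have sgt : sg < t by rewrite lt_min sgl ltrDl divr_gt0.
  have : A t.
    split; first by rewrite (le_trans sg0 (ltW sgt)) ge_min lexx.
    move=> s /andP[s0 st]; have [ssg|sgs] := leP s sg; first by apply: upto; rewrite s0.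
    apply: he; rewrite /ball/= distrC ger0_norm ?subr_ge0 ?ltW//.
    rewrite ltrBlDl; apply: le_lt_trans st _; rewrite gt_min; apply/orP; right.
    by rewrite ltrD2l ltr_pdivrMr// ltr_pMr// ltr1n.
  by move=> /(sup_upper_bound hsA); rewrite leNgt sgt.
by move=> t t01; apply: upto; rewrite sgE.
Qed.

Lemma arc_coord_dist : inside 0 ->
  `|coord 0 - y0| + K * arc_length j c < rho ->
  dom i (curve 1) /\ `|coord 1 - coord 0| <= K * arc_length j c.
Proof.
move=> in0 Krho; have ins := curve_stays_inside in0 Krho.
have [i1 _] : inside 1 by apply: ins; rewrite ler01 lexx.
by split => //; apply: coord_dist => //; rewrite ler01 lexx.
Qed.

End chart_box.
End arcs.

Section riemannian_balls.
Context (R : realType) (d : nat) (S : topologicalType).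
Variable g : riemannian_manifold R d S.
Local Notation chart := (@chart _ _ _ g).
Local Notation metric := (@metric _ _ _ g).

Lemma joined_ge0 x z l : joined g x z l -> 0 <= l.
Proof. by elim => // *; rewrite addr_ge0// arc_length_ge0. Qed.

(** Induction on the arcs with a moving starting point: the distance to [y0] gained along an arc is
    at most [K] times the length used up, for the same factor [K], so the bound by [rho]
    persists. *)
Lemma joined_coord_dist (i : chart_index g) (y0 : 'rV[R]_d) (a b rho : R) x z l :
  0 < a ->
  (forall y, `|y - y0| <= rho -> (chart i @` dom i) y /\
    forall v, a * `|v| ^+ 2 <= qform (metric i y) v <= b * `|v| ^+ 2) ->
  joined g x z l -> dom i x ->
  `|chart i x - y0| + (Num.sqrt a)^-1 * l < rho ->
  dom i z /\ `|chart i z - chart i x| <= (Num.sqrt a)^-1 * l.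
Proof.
move=> a0 box; have K0 : 0 < (Num.sqrt a)^-1 by rewrite invr_gt0 sqrtr_gt0.
elim=> {x z l} [x|j c z l dc cdc Uc jn IH] ix; first by rewrite subrr normr0 mulr0.
rewrite mulrDr addrA => lt_rho.
have l0 : 0 <= (Num.sqrt a)^-1 * l by rewrite mulr_ge0 ?(ltW K0)// (joined_ge0 jn).
have arc0 : 0 <= (Num.sqrt a)^-1 * arc_length j c.
  by rewrite mulr_ge0 ?(ltW K0)// arc_length_ge0.
have adm : admissible_arc j c by [].
have [||i1 d1] := arc_coord_dist a0 box adm.
- by split => //; apply: le_lt_trans lt_rho; rewrite -addrA lerDl addr_ge0.
- by apply: le_lt_trans lt_rho; rewrite lerDl.
have [|iz dz] := IH i1.
  apply: le_lt_trans lt_rho; rewrite lerD2r.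
  apply: le_trans (ler_distD (chart i (chart_inv j (c 0))) _ _) _.
  by rewrite [leLHS]addrC lerD2l.
split => //; apply: le_trans (ler_distD (chart i (chart_inv j (c 1))) _ _) _.
by rewrite [leLHS]addrC lerD.
Qed.

(** The witness is the straight segment in the chart, whose speed is at most [b]. *)
Lemma joined_segment (i : chart_index g) (b : R) x x' :
  dom i x -> dom i x' -> 0 <= b ->
  (forall t : R, 0 <= t <= 1 ->
    (chart i @` dom i) (chart i x + t *: (chart i x' - chart i x)) /\
    qform (metric i (chart i x + t *: (chart i x' - chart i x)))
      (chart i x' - chart i x) <= b ^+ 2) ->
  exists2 l, joined g x x' l & l <= b.
Proof.
move=> ix ix' b0 hseg; pose w := chart i x' - chart i x.
pose c (t : R) : 'rV[R]_d := chart i x + t *: w.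
have dc (t : R) : is_derive t 1 (c : R -> 'rV[R]_d) (w : 'rV[R]_d).
  have h : derivable (fun y : 'rV[R]_d => y) (chart i x + t *: w) w by exact: derivable_id.
  by have := is_derive_line h; rewrite derive_id.
have dcE : derive1 c = cst w.
  by apply/funext => t; rewrite derive1E; have [_ ->] := dc t.
have adm : admissible_arc i c.
  split; first by move=> t; have [] := dc t.
    by rewrite dcE; exact: cst_continuous.
  by move=> t t01; have [] := hseg t t01.
exists (arc_length i c + 0); last first.
  rewrite addr0; apply: (@le_trans _ _ (\int[lebesgue_measure]_(t in `[0 : R, 1]) b)).
    apply: le_Rintegral => //.
    - exact: speed_integrable adm.
    - apply: continuous_compact_integrable; first exact: segment_compact.
      by apply: continuous_subspaceT; exact: cst_continuous.
    - move=> t; rewrite /= in_itv/= => t01; have [_ h] := hseg t t01.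
      rewrite /speed dcE -[leRHS]ger0_norm// -sqrtr_sqr; exact: ler_wsqrtr.
  have L1 : lebesgue_measure (`[0 : R, 1]%classic : set R) = 1%E.
    by rewrite lebesgue_measure_itv/= lte_fin ltr01 sube0.
  by rewrite Rintegral_cst// [X in fine X]L1 mulr1.
have -> : x = chart_inv i (c 0) by rewrite /c scale0r addr0 chartK.
have -> : x' = chart_inv i (c 1) by rewrite /c scale1r addrC subrK chartK.
have [h1 h2 h3] := adm; apply: joined_arc => //.
exact: joined_refl.
Qed.

Lemma riemannian_dist_lt x z (r : R) : (riemannian_dist g x z < r%:E)%E ->
  exists2 l, joined g x z l & l < r.
Proof.
by move=> /ereal_inf_lt[_ [l jl <-]]; rewrite lte_fin => lr; exists l.
Qed.

Lemma riemannian_dist_le x z (l : R) : joined g x z l ->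
  (riemannian_dist g x z <= l%:E)%E.
Proof. by move=> jl; apply: ereal_inf_lbound; exists l. Qed.

Lemma riemannian_ball_chart (i : chart_index g) x : dom i x ->
  exists c C r0 : R, [/\ 0 < c, 0 < C, 0 < r0 & forall r, 0 < r < r0 ->
    (forall z, dom i z -> (forall k, `|chart i z 0 k - chart i x 0 k| < c * r) ->
       (riemannian_dist g x z < r%:E)%E) /\
    (forall z, (riemannian_dist g x z < r%:E)%E ->
       dom i z /\ forall k, `|chart i z 0 k - chart i x 0 k| < C * r)].
Proof.
move=> ix; have Ux : (chart i @` dom i) (chart i x) by exists x.
have [a [b [rho [a0 b0 rho0 box]]]] := metric_comparable Ux.
have sa0 : 0 < Num.sqrt a by rewrite sqrtr_gt0.
have sb0 : 0 < Num.sqrt b by rewrite sqrtr_gt0.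
(* The two bounds on [r] keep curves of length below [r], respectively the segments, in the box of
   radius [rho] where the metric is comparable to the Euclidean one. *)
exists (Num.sqrt b)^-1, (Num.sqrt a)^-1, (Num.min (Num.sqrt a * rho) (Num.sqrt b * rho)).
rewrite !invr_gt0 lt_min !mulr_gt0//; split => // r /andP[r0]; rewrite lt_min => /andP[ra rb].
split=> z.
- move=> iz zx; set w := chart i z - chart i x.
  have wr : `|w| < (Num.sqrt b)^-1 * r.
    apply/rV_norm_lt; first by rewrite mulr_gt0 ?invr_gt0.
    by move=> k; rewrite !mxE.
  have w_rho : `|w| <= rho.
    by apply: le_trans (ltW wr) _; rewrite ler_pdivrMl// ltW.
  have bw0 : 0 <= Num.sqrt b * `|w| by rewrite mulr_ge0// ltW.
  have [t t01|l jl lb] := joined_segment ix iz bw0.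
  + have tw : `|chart i x + t *: w - chart i x| <= rho.
      rewrite addrAC subrr add0r normrZ; apply: le_trans w_rho; rewrite ler_piMl//.
      by case/andP: t01 => t0 t1; rewrite ger0_norm.
    have [U /(_ w)/andP[_ h]] := box _ tw; split => //.
    by rewrite exprMn sqr_sqrtr ?(ltW b0).
  + apply: le_lt_trans (riemannian_dist_le jl) _; rewrite lte_fin.
    by apply: le_lt_trans lb _; rewrite -ltr_pdivlMl.
- move=> /riemannian_dist_lt[l jl lr].
  have [|iz dz] := joined_coord_dist a0 box jl ix.
    rewrite subrr normr0 add0r -ltr_pdivlMl ?invr_gt0// invrK.
    exact: lt_trans ra.
  split => // k; apply: le_lt_trans (_ : `|chart i z - chart i x| < _); last first.
    by apply: le_lt_trans dz _; rewrite ltr_pM2l ?invr_gt0.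
  by have := rV_coord_norm_le (chart i z - chart i x) k; rewrite !mxE.
Qed.

End riemannian_balls.

(** * The measure in charts *)

Lemma countable_enum (T : Type) (B : set T) : countable B ->
  exists e : nat -> option T, (forall b, B b -> exists n, e n = Some b) /\
    (forall n b, e n = Some b -> B b).
Proof.
move=> /countable_injP[f finj].
exists (fun n => if pselect (exists b, B b /\ f b = n) is left h
  then Some (projT1 (cid h)) else None); split.
  move=> b Bb; exists (f b); case: pselect => [h|[]]; last by exists b.
  case: cid => b' /= [Bb' fb']; congr Some.
  by apply: finj; rewrite ?inE.
by move=> n b; case: pselect => // h [<-]; case: cid => b' /= [].
Qed.

Lemma negligible_bigcup_countable_set (R : realType) (dX : measure_display)
    (X : measurableType dX) (mu : probability X R) (T : Type) (B : set T)
    (A : T -> set X) : countable B ->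
  (forall b, B b -> mu.-negligible (A b)) -> mu.-negligible (\bigcup_(b in B) A b).
Proof.
move=> /countable_enum[e [eB Be]] hA.
apply: (negligibleS (A := \bigcup_n (if e n is Some b then A b else set0))).
  by move=> x [b Bb Ab]; have [n en] := eB b Bb; exists n => //; rewrite en.
apply: negligible_bigcup => n; case E : (e n) => [b|]; last exact: negligible_set0.
exact: hA (Be _ _ E).
Qed.

(** * Regularity of the measure on Borel sets *)

Section borel_regularity.
Context (R : realType) (d : nat) (S : topologicalType).
Variable g : riemannian_manifold R d S.
Context (dX : measure_display) (X : measurableType dX) (iota : X -> S).
Hypothesis X_embedded : borel_embedding iota.
Variable mu : probability X R.

Lemma measurable_iota_borel B : borel S B -> measurable (iota @^-1` B).
Proof. by move=> bB; apply/(X_embedded.2); exists B. Qed.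

Lemma borel_open B : open B -> borel S B.
Proof. exact: sub_gen_smallest. Qed.

Lemma borel_setC B : borel S B -> borel S (~` B).
Proof.
by have [_ hC _] := @smallest_sigma_algebra _ [set: S] open; rewrite -setTD; exact: hC.
Qed.

Lemma borel_closed B : closed B -> borel S B.
Proof.
move=> cB; rewrite -[B]setCK; apply: borel_setC; apply: borel_open.
by rewrite openC.
Qed.

Lemma borel_bigcup (B : nat -> set S) : (forall n, borel S (B n)) ->
  borel S (\bigcup_n B n).
Proof. by have [_ _ h] := @smallest_sigma_algebra _ [set: S] open; exact: h. Qed.

Lemma borel_bigcap (B : nat -> set S) : (forall n, borel S (B n)) ->
  borel S (\bigcap_n B n).
Proof.
move=> hB; rewrite -[X in borel S X]setCK setC_bigcap.
by apply: borel_setC; apply: borel_bigcup => n; exact: borel_setC.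
Qed.

Lemma borel_setI B C : borel S B -> borel S C -> borel S (B `&` C).
Proof.
move=> bB bC; rewrite -bigcap2E; apply: borel_bigcap => -[|[|n]] //=.
by apply: borel_open; exact: openT.
Qed.

Lemma borel_setD B C : borel S B -> borel S C -> borel S (B `\` C).
Proof. by move=> bB bC; rewrite setDE; apply: borel_setI => //; exact: borel_setC. Qed.

Lemma manifold_regular (O : set S) x : open O -> O x ->
  exists V, [/\ open V, V x & exists C, [/\ closed C, V `<=` C & C `<=` O]].
Proof.
move=> oO Ox; have [i ix] := dom_cover g x.
have Ux : (@chart _ _ _ g i @` dom i) (chart i x) by exists x.
have [a [b [rho [a0 b0 rho0 box]]]] := metric_comparable Ux.
have : \forall y \near chart i x, O (chart_inv i y).
  apply: (chart_inv_continuous Ux); rewrite chartK//.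
  exact: open_nbhs_nbhs.
move=> /nbhs_ballP[r /= r0 hr]; pose s := Num.min rho (r / 2).
have s0 : 0 < s by rewrite lt_min rho0 divr_gt0.
exists (interior [set z | dom i z /\ `|chart i z - chart i x| <= s]); split.
- exact: open_interior.
- have cx := @chart_continuous _ _ _ g i x ix.
  near=> z; split; first by near: z; apply: open_nbhs_nbhs; split => //; exact: dom_open.
  rewrite distrC; near: z; move/cvgrPdist_le : cx; exact.
- exists [set z | dom i z /\ `|chart i z - chart i x| <= s]; split.
  + apply: (chart_box_closed box); first exact: ltW.
    by rewrite ge_min lexx.
  + exact: interior_subset.
  + move=> z [iz zs]; rewrite -(chartK iz); apply: hr.
    rewrite mx_norm_ball /ball_/= distrC (le_lt_trans zs)// gt_min.
    by apply/orP; right; rewrite ltr_pdivrMr// ltr_pMr// ltr1n.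
Unshelve. all: by end_near. Qed.

(** By regularity of the space, the members of a countable base whose closure lies in [O] already
    cover [O]. *)
Lemma open_bigcup_closed (O : set S) : open O ->
  exists C : nat -> set S, (forall n, closed (C n)) /\ O = \bigcup_n C n.
Proof.
move=> oO; have [Bs cB [Bopen Bbasis]] := manifold_second_countable g.
have [e [eB Be]] := countable_enum cB.
exists (fun n => if e n is Some b then
  (if pselect (closure b `<=` O) then closure b else set0) else set0); split.
  move=> n; case: (e n) => [b|]; last exact: closed0.
  by case: pselect => h; [exact: closed_closure|exact: closed0].
apply/seteqP; split => x.
  move=> Ox; have [V [oV Vx [C [cC VC CO]]]] := manifold_regular oO Ox.
  have [b [Bb bx] bV] := Bbasis x V (open_nbhs_nbhs (conj oV Vx)).
  have bO : closure b `<=` O.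
    apply: subset_trans CO; rewrite closureE => z; apply; split => //.
    exact: subset_trans bV VC.
  have [n en] := eB b Bb; exists n => //; rewrite en; case: pselect => // h.
  exact: subset_closure.
move=> [n _]; case: (e n) => [b|//]; case: pselect => // h; exact: h.
Qed.

(** Only the open set is used later; the closed one is carried along because it makes the property
    stable under complements. *)
Definition sandwiched (B : set S) : Prop := forall e : R, 0 < e ->
  exists U C, [/\ open U, closed C, C `<=` B, B `<=` U &
    fine (mu (iota @^-1` (U `\` C))) <= e].

Let mUC U C : open U -> closed C -> measurable (iota @^-1` (U `\` C)).
Proof.
move=> oU cC; apply: measurable_iota_borel; apply: borel_setD.
- exact: borel_open.
- exact: borel_closed.
Qed.

Let closed_bigcup_lt (C : nat -> set S) N : (forall n, closed (C n)) ->
  closed (\bigcup_(n in `I_N) C n).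
Proof. by move=> cC; apply: closed_bigcup => //; exact: finite_II. Qed.

(* Closed sets are only stable under finite unions; the tail of the union is
   absorbed by continuity of the measure. *)
Lemma sandwich_tail (C : nat -> set S) (U : set S) (e d' : R) :
  open U -> (forall n, closed (C n)) ->
  fine (mu (iota @^-1` (U `\` \bigcup_n C n))) <= e -> 0 < d' ->
  exists N, fine (mu (iota @^-1` (U `\` \bigcup_(n in `I_N) C n))) <= e + d'.
Proof.
move=> oU cC UC d'0.
pose F N := iota @^-1` (U `\` \bigcup_(n in `I_N) C n).
have mF N : measurable (F N) by apply: mUC => //; exact: closed_bigcup_lt.
pose G := iota @^-1` (U `\` \bigcup_n C n).
have mG : measurable G.
  apply: measurable_iota_borel; apply: borel_setD; first exact: borel_open.
  by apply: borel_bigcup => n; exact: borel_closed.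
have [N hN] : exists N, fine (mu (F N `\` G)) < d'.
  apply: measure_bigcap0_lt => //.
  - by move=> n; exact: measurableD.
  - move=> n x [[Ux nC] nG]; split => //; split => // -[m /= mn Cm]; apply: nC.
    by exists m => //=; exact: ltnW.
  - rewrite (_ : \bigcap_n _ = set0) ?measure0//.
    apply/seteqP; split => // x h; have [[Ux _] nG] := h 0%N I.
    apply: nG; split => // -[m _ Cm]; have [[_ nC] _] := h m.+1 I.
    by apply: nC; exists m => /=.
exists N; apply: le_trans (lerD UC (ltW hN)).
rewrite -/G -/(F N); have mFG : measurable (F N `\` G) by exact: measurableD.
apply: le_trans (fine_measureU_le mu mG mFG).
apply: fine_measure_le => //; first exact: measurableU.
by move=> x Fx; have [Gx|nGx] := pselect (G x); [left|right].
Qed.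

(** These sets form a sigma-algebra containing the open sets. Open sets are countable unions of
    closed ones; complements exchange [U] and [C]; for a union, half of [e] goes to the geometric
    series of errors and half to the tail. *)
Lemma borel_sandwiched B : borel S B -> sandwiched B.
Proof.
apply: smallest_sub; last first.
  move=> O oO e e0; have [C [cC OC]] := open_bigcup_closed oO.
  have [|N hN] := @sandwich_tail C O 0 e oO cC _ e0.
    by rewrite OC setDv preimage_set0 measure0.
  exists O, (\bigcup_(n in `I_N) C n); split => //; first exact: closed_bigcup_lt.
    by rewrite OC => x [n _ Cn]; exists n.
  by rewrite add0r in hN.
split.
- move=> e e0; exists set0, set0; split => //; [exact: open0|exact: closed0|].
  by rewrite setD0 preimage_set0 measure0 ltW.
- move=> A hA e e0; have [U [C [oU cC CA AU UC]]] := hA e e0.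
  exists (~` C), (~` U); split.
  + by rewrite openC.
  + by rewrite closedC.
  + by rewrite setTD; exact: subsetC.
  + by rewrite setTD; exact: subsetC.
  + by rewrite setDE setCK setIC -setDE.
- move=> A hA e e0.
  have e2 n : 0 < (e / 2) / (2 ^ n.+1)%:R by rewrite !divr_gt0.
  have /choice[UC hUC] n : exists UC : set S * set S, [/\ open UC.1, closed UC.2,
      UC.2 `<=` A n, A n `<=` UC.1 &
      fine (mu (iota @^-1` (UC.1 `\` UC.2))) <= (e / 2) / (2 ^ n.+1)%:R].
    by have [U [C h]] := hA n _ (e2 n); exists (U, C).
  have oU n : open (UC n).1 by have [] := hUC n.
  have cC n : closed (UC n).2 by have [] := hUC n.
  pose U := \bigcup_n (UC n).1.
  have oUU : open U by exact: bigcup_open.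
  have h : fine (mu (iota @^-1` (U `\` \bigcup_n (UC n).2))) <= e / 2.
    have mC : measurable (iota @^-1` (U `\` \bigcup_n (UC n).2)).
      apply: measurable_iota_borel; apply: borel_setD; first exact: borel_open.
      by apply: borel_bigcup => n; exact: borel_closed.
    have mn n : measurable (iota @^-1` ((UC n).1 `\` (UC n).2)) by exact: mUC.
    rewrite -lee_fin fineK ?fin_num_measure//.
    apply: (@le_trans _ _ (\sum_(n <oo) mu (iota @^-1` ((UC n).1 `\` (UC n).2)))%E).
      apply: measure_sigma_subadditive => // x [[n _ Un] nC].
      by exists n => //; split => // Cn; apply: nC; exists n.
    have e20 : 0 <= e / 2 by rewrite divr_ge0// ltW.
    apply: le_trans (epsilon_trick0 xpredT e20).
    apply: lee_nneseries => // n _.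
    rewrite -[leLHS]fineK ?fin_num_measure// lee_fin.
    by have [] := hUC n.
  have e20 : 0 < e / 2 by rewrite divr_gt0.
  have [N hN] := sandwich_tail oUU cC h e20.
  exists U, (\bigcup_(n in `I_N) (UC n).2); split => //.
  + exact: closed_bigcup_lt.
  + by move=> x [n _ Cn]; exists n => //; have [_ _ CA _ _] := hUC n; exact: CA.
  + by move=> x [n _ An]; exists n => //; have [_ _ _ AU _] := hUC n; exact: AU.
  + by rewrite (splitr e).
Qed.

End borel_regularity.

(** * Lebesgue null sets and changes of chart *)

Section cube_null_theory.
Context (R : realType) (d : nat).
Implicit Types A B : set 'rV[R]_d.

Lemma cube_null_sub A B : A `<=` B -> cube_null B -> cube_null A.
Proof.
move=> AB nB e e0; have [K [c [r [r0 cov Ke]]]] := nB e e0.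
by exists K, c, r; split => //; exact: subset_trans AB cov.
Qed.

Lemma cube_null_bigcup (A : nat -> set 'rV[R]_d) :
  (forall n, cube_null (A n)) -> cube_null (\bigcup_n A n).
Proof.
move=> nA e e0.
have en n : 0 < e / (2 ^ n.+1)%:R by rewrite divr_gt0.
have /choice[K hK] n := nA n _ (en n).
have /choice[c hc] := hK; have /choice[r hr] := hc.
pose code (ik : nat * nat) : nat := choice.pickle ik.
pose dec m : nat * nat := odflt (0%N, 0%N) (choice.unpickle m).
have codeK ik : dec (code ik) = ik by rewrite /dec /code choice.pickleK.
pose P := [set ik : nat * nat | K ik.1 ik.2].
exists (code @` P), (fun m => c (dec m).1 (dec m).2), (fun m => r (dec m).1 (dec m).2).
split.
- by move=> m; have [h _ _] := hr (dec m).1; exact: h.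
- move=> z [n _ Az]; have [_ cov _] := hr n; have [k Kk zk] := cov z Az.
  by exists (code (n, k)); [exists (n, k)|rewrite codeK].
- rewrite esum_image; last by move=> p q _ _ /(congr1 dec); rewrite !codeK.
  rewrite (_ : P = setT `*`` K); last by apply/seteqP; split => x //= [].
  under eq_esum do rewrite codeK.
  rewrite -(@esum_esum R nat nat setT K (fun n k => ((2 * r n k) ^+ d)%:E)); last first.
    by move=> n k _ _; rewrite lee_fin exprn_ge0// mulr_ge0//; have [h _ _] := hr n; exact: h.
  apply: (@le_trans _ _ (\esum_(n in setT) (e / (2 ^ n.+1)%:R)%:E)).
    by apply: le_esum => n _; have [] := hr n.
  rewrite -nneseries_esumT; last by move=> n; rewrite lee_fin ltW.
  by apply: epsilon_trick0; exact: ltW.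
Qed.

Lemma lebesgue_outer_cube_null A : cube_null A -> lebesgue_outer A = 0%E.
Proof.
move=> nA; apply/eqP; rewrite eq_le; apply/andP; split; last first.
  apply: le_ereal_inf_tmp => _ [K [a [b [ab _ ->]]]].
  apply: esum_ge0 => k _; rewrite lee_fin; apply: prodr_ge0 => j _.
  by rewrite subr_ge0.
apply/lee_addgt0Pr => e e0; rewrite add0e.
have [K [c [r [r0 cov Ke]]]] := nA e e0.
apply: le_trans Ke; apply: ereal_inf_lbound.
exists K, (fun k => \row_j (c k 0 j - r k)), (fun k => \row_j (c k 0 j + r k)); split.
- by move=> k j; rewrite !mxE lerD2l (le_trans _ (r0 k))// oppr_le0.
- move=> z /cov[k Kk zk]; exists k => // j; rewrite !mxE -ler_distl; exact: zk.
- apply: eq_esum => k _; congr EFin.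
  rewrite -[d in LHS]card_ord -prodr_const; apply: eq_bigr => j _.
  by rewrite !mxE; ring.
Qed.

(** [f] is controlled only on [A], so each cube meeting [A] is recentred at a point [p k] of [A],
    which doubles its radius; whence the factor [(2 * L) ^ d]. *)
Lemma cube_null_lipschitz A (f : 'rV[R]_d -> 'rV[R]_d) (L : R) : 0 < L ->
  (forall x y, A x -> A y -> forall r, 0 <= r -> (forall j, `|x 0 j - y 0 j| <= r) ->
     forall j, `|f x 0 j - f y 0 j| <= L * r) ->
  cube_null A -> cube_null (f @` A).
Proof.
move=> L0 fL nA e e0; have L20 : 0 < (2 * L) ^+ d by rewrite exprn_gt0// mulr_gt0.
have [K [c [r [r0 cov Ke]]]] := nA _ (divr_gt0 e0 L20).
pose p k := if pselect (exists z, A z /\ forall j, `|z 0 j - c k 0 j| <= r k) is left h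
  then projT1 (cid h) else 0.
exists K, (fun k => f (p k)), (fun k => L * (2 * r k)); split.
- by move=> k; rewrite mulr_ge0 ?mulr_ge0// ltW.
- move=> _ [z Az <-]; have [k Kk zk] := cov z Az; exists k => //.
  rewrite /p; case: pselect => [h|[]]; last by exists z.
  case: cid => q /= [Aq qk]; apply: fL => // [|j]; first by rewrite mulr_ge0.
  apply: le_trans (ler_distD (c k 0 j) _ _) _; rewrite mulr_natl mulr2n lerD//.
  by rewrite distrC.
- rewrite (_ : \esum_(k in K) _ = ((2 * L) ^+ d)%:E * \esum_(k in K) ((2 * r k) ^+ d)%:E)%E.
    by rewrite -lee_pdivlMl// -EFinM mulrC.
  have L2r k : (((2 * (L * (2 * r k))) ^+ d)%:E = ((2 * L) ^+ d)%:E * ((2 * r k) ^+ d)%:E)%E.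
    by rewrite -EFinM -exprMn; congr (_ ^+ _)%:E; ring.
  have r2 k : (0 <= ((2 * r k) ^+ d)%:E)%E by rewrite lee_fin exprn_ge0// mulr_ge0.
  under eq_esum do rewrite L2r.
  rewrite -(set_mem_set K) -!nneseries_esum//; last first.
    by move=> k _; rewrite mule_ge0// lee_fin ltW.
  by rewrite nneseriesZl.
Qed.

End cube_null_theory.

Section transition_null.
Context (R : realType) (d : nat) (S : topologicalType).
Variable g : riemannian_manifold R d S.
Local Notation chart := (@chart _ _ _ g).

Lemma transition_lipschitz (i j : chart_index g) x0 :
  (chart i @` (dom i `&` dom j)) x0 ->
  exists L r : R, [/\ 0 < L, 0 < r & forall x y, `|x - x0| < r -> `|y - x0| < r ->
    (chart i @` (dom i `&` dom j)) x /\
    `|chart j (chart_inv i x) - chart j (chart_inv i y)| <= L * `|x - y| ].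
Proof.
move=> Ux0; pose f z := chart j (chart_inv i z).
have hk k := @transition_smooth _ _ _ g i j k 1%N.
pose B := \sum_kl `|'D_(delta_mx 0 kl.2) (fun z => f z 0 kl.1) x0| + 1.
have B0 : 0 < B by rewrite ltr_wpDl// sumr_ge0.
have : \forall z \near x0, (chart i @` (dom i `&` dom j)) z /\
   forall kl : 'I_d * 'I_d, `|'D_(delta_mx 0 kl.2) (fun z => f z 0 kl.1) z| <= B.
  near=> z; split; first by near: z; exact: overlap_near.
  near: z; apply: filter_forall => -[k l] /=.
  have [_ /(_ l)[_ [/(_ x0 Ux0) cD _]]] := hk k.
  move/cvgrPdist_le : cD => /(_ 1 ltr01); apply: filterS => z hz.
  rewrite -[X in `|X|](subrK ('D_(delta_mx 0 l) (fun z => f z 0 k) x0)) addrC.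
  apply: le_trans (ler_normD _ _) _; apply: lerD; last by rewrite distrC.
  by rewrite (bigD1 (k, l))//= lerDl sumr_ge0.
move=> /nbhs_ballP[r /= r0 hr].
(* With [r / 3] the points [y + s *: (x - y)], for [s] of either sign and at most 1 in absolute
   value, remain in the ball of radius [r]. The summand 1 keeps the constant positive when
   [d = 0]. *)
exists (d%:R * B + 1), (r / 3); split; [|by rewrite divr_gt0|].
  by rewrite ltr_wpDl// mulr_ge0// ltW.
have inball z : `|z - x0| < r -> ball x0 r z.
  by rewrite mx_norm_ball /ball_/= distrC.
move=> x y xr yr.
have r3 : r / 3 <= r by rewrite ler_pdivrMr// ler_peMr ?(ltW r0)// ler1n.
have [Ux _] := hr x (inball x (lt_le_trans xr r3)); split => //.
apply: (@le_trans _ _ ((d%:R * B) * `|x - y|)); last by rewrite ler_wpM2r// lerDl.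
apply/rV_norm_le; first by rewrite mulr_ge0// mulr_ge0// ltW.
move=> k; rewrite !mxE.
pose v := x - y.
have seg s : `|s| <= 1 -> `|y + s *: v - x0| < r.
  move=> s1; rewrite addrAC; apply: le_lt_trans (ler_normD _ _) _; rewrite normrZ.
  have vr : `|v| < r / 3 + r / 3.
    rewrite /v -[x](subrK x0) -addrA; apply: le_lt_trans (ler_normD _ _) _.
    by apply: ltrD => //; rewrite distrC.
  have : `|s| * `|v| <= `|v| by rewrite ler_piMl.
  move: vr yr; lra.
have dfv s : `|s| <= 1 -> differentiable f (y + s *: v).
  by move=> s1; apply: transition_differentiable; have [] := hr _ (inball _ (seg s s1)).
have := @increment_le R (fun s => f (y + s *: v) 0 k)
  (fun s => ('D_v f (y + s *: v)) 0 k) 0 (d%:R * B * `|v|) 1.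
have yv : y + v = x by rewrite /v addrC subrK.
rewrite normr1 !mulr0 !subr0 mulr1 scale1r scale0r addr0 yv; apply.
- move=> s s1; have df := dfv s s1; have dv : derivable f (y + s *: v) v by exact: diff_derivable.
  have [dl El] := @is_derive_line R _ _ f y v s dv.
  split; first by have /derivable_mxP := dl; exact.
  by rewrite -El (derive_mx dl) mxE.
- move=> s s1; rewrite subr0; have df := dfv s s1.
  have [_ hB] := hr _ (inball _ (seg s s1)).
  rewrite deriveEjacobian// mxE; apply: le_trans (ler_norm_sum _ _ _) _.
  apply: (@le_trans _ _ (\sum_(l < d) (B * `|v|))); last first.
    by rewrite sumr_const card_ord -(mulr_natl (B * _)) mulrA.
  apply: ler_sum => l _; rewrite normrM mulrC ler_pM//; last exact: rV_coord_norm_le.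
  have -> : 'J f (y + s *: v) l k = 'D_(delta_mx 0 l) (fun z => f z 0 k) (y + s *: v).
    have de : derivable f (y + s *: v) (delta_mx 0 l) by exact: diff_derivable.
    have := deriveEjacobian (delta_mx 0 l) df; rewrite -rowE => /rowP/(_ k).
    by rewrite (derive_mx de) !mxE => ->.
  exact: (hB (k, l)).
Unshelve. all: by end_near. Qed.

End transition_null.

Section chart_measure.
Context (R : realType) (d : nat) (S : topologicalType).
Variable g : riemannian_manifold R d S.
Local Notation chart := (@chart _ _ _ g).

Lemma cube_null_set0 : cube_null (set0 : set 'rV[R]_d).
Proof.
move=> e e0; exists set0, (fun=> 0), (fun=> 0); split => //.
by rewrite esum_set0 lee_fin ltW.
Qed.

(** Transition maps are only locally Lipschitz; the dyadic cells on which the map is Lipschitz are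
    countably many and cover the overlap. *)
Lemma cube_null_transition (i j : chart_index g) A : cube_null A ->
  cube_null ((fun z => chart j (chart_inv i z)) @`
             (A `&` (chart i @` (dom i `&` dom j)))).
Proof.
move=> nA; pose f z := chart j (chart_inv i z).
pose Q (kq : nat * {ffun 'I_d -> int}) : set 'rV[R]_d :=
  [set z | cell_index (fun z => z) kq.1 z = kq.2].
pose good kq := exists2 L, 0 < L &
  forall x y, Q kq x -> Q kq y -> `|f x - f y| <= L * `|x - y|.
pose P n := if @choice.unpickle (nat * {ffun 'I_d -> int})%type n is Some kq then
  (if pselect (good kq) then f @` (A `&` Q kq) else set0) else set0.
apply: (@cube_null_sub _ _ _ (\bigcup_n P n)).
  move=> _ [x0 [Ax Wx] <-]; have [L [r [L0 r0 hr]]] := transition_lipschitz Wx.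
  have [k kr] := mesh_lt r0.
  pose kq := (k, cell_index (fun z : 'rV[R]_d => z) k x0).
  have near z : Q kq z -> `|z - x0| < r.
    move=> Qz; apply: lt_trans kr; apply/rV_norm_lt; first exact: mesh_gt0.
    by move=> l; rewrite !mxE; exact: (cell_index_dist l Qz).
  exists (choice.pickle kq) => //; rewrite /P choice.pickleK.
  case: pselect => [h|[]]; first by exists x0.
  exists L => // x y /near xr /near yr.
  by have [] := hr x y xr yr.
apply: cube_null_bigcup => n; rewrite /P.
case: choice.unpickle => [kq|]; last exact: cube_null_set0.
case: pselect => [[L L0 hL]|h]; last exact: cube_null_set0.
apply: (cube_null_lipschitz L0); last by apply: cube_null_sub nA => x [].
move=> x y [_ Qx] [_ Qy] r r0 xy l.
have := rV_coord_norm_le (f x - f y) l; rewrite !mxE => /le_trans; apply.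
apply: le_trans (hL x y Qx Qy) _; rewrite ler_pM2l//.
by apply/rV_norm_le => // k; rewrite !mxE.
Qed.

Lemma chart_preimage_open (i : chart_index g) (O : set 'rV[R]_d) : open O ->
  open [set z | dom i z /\ O (chart i z)].
Proof.
move=> oO; rewrite openE => z [iz Oz]; rewrite /interior.
have cz : {for z, continuous (chart i)} by exact: chart_continuous.
apply: filterI; first by apply: open_nbhs_nbhs; split => //; exact: dom_open.
by apply: cz; exact: open_nbhs_nbhs.
Qed.

Lemma closed_cube (c : 'rV[R]_d) (r : R) :
  closed [set z : 'rV[R]_d | forall j, `|z 0 j - c 0 j| <= r].
Proof.
apply: compact_closed; first exact: norm_hausdorff.
rewrite (_ : [set z | _] =
    [set z : 'rV[R]_d | forall k, `[c 0 k - r, c 0 k + r]%classic (z 0 k)]).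
  apply: (@rV_compact R d (fun k => `[c 0 k - r, c 0 k + r]%classic)) => k.
  exact: segment_compact.
by apply/seteqP; split => y /= h k; have := h k; rewrite /= in_itv/= ler_distl.
Qed.

Context (dX : measure_display) (X : measurableType dX) (iota : X -> S).
Hypothesis X_embedded : borel_embedding iota.
Variable mu : probability X R.
Variable i : chart_index g.

Lemma measurable_chart_dom : measurable (iota @^-1` dom i).
Proof. by apply: (measurable_iota_borel X_embedded); apply: borel_open; exact: dom_open. Qed.

Lemma measurable_chart_coord k :
  measurable_fun (iota @^-1` dom i) (fun x => chart i (iota x) 0 k).
Proof.
move=> mD; apply: (measurability _ (RGenOInfty.measurableE R)) => //.
move=> _ [_ [a ->] <-].
rewrite (_ : _ `&` _ = iota @^-1` [set z | dom i z /\ [set v : 'rV[R]_d | a < v 0 k] (chart i z)]).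
  apply: (measurable_iota_borel X_embedded); apply: borel_open.
  apply: chart_preimage_open.
  rewrite (_ : [set v | _] = (fun v : 'rV[R]_d => v 0 k) @^-1` [set x | a < x])//.
  apply: open_comp; last exact: open_gt.
  by move=> v _; exact: coord_continuous.
by apply/seteqP; split => x; rewrite /preimage/= in_itv/= andbT.
Qed.

(** A null set need not be Borel, so it is enlarged to [A'], a countable intersection of unions of
    closed cubes, which is still null. Since [lebesgue_null] refers to every chart, the nullity seen
    in chart [i] is carried to the others by the transition maps. *)
Lemma chart_abs_cont : lebesgue_abs_cont g iota mu ->
  forall A, cube_null A ->
  mu.-negligible ((iota @^-1` dom i) `&` (fun x => chart i (iota x)) @^-1` A).
Proof.
move=> ac A nA.
have em m : 0 < m.+1%:R^-1 :> R by rewrite invr_gt0.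
have /choice[K hK] m := nA _ (em m).
have /choice[c hc] := hK; have /choice[r hr] := hc.
pose cube m k : set 'rV[R]_d := [set z | forall j, `|z 0 j - c m k 0 j| <= r m k].
pose A' := \bigcap_m \bigcup_(k in K m) cube m k.
have nA' : cube_null A'.
  move=> e e0; pose m := Num.truncn e^-1.
  have me : m.+1%:R^-1 <= e by rewrite invf_ple ?posrE// ltW//; exact: truncnS_gt.
  have [r0 cov Ke] := hr m; exists (K m), (c m), (r m); split => //.
    by move=> z /(_ m I).
  by apply: le_trans Ke _; rewrite lee_fin.
pose B := [set z | dom i z /\ A' (chart i z)].
have bB : borel S B.
  rewrite (_ : B = \bigcap_m \bigcup_k
    (if pselect (K m k) then [set z | dom i z /\ cube m k (chart i z)] else set0)).
    apply: borel_bigcap => m; apply: borel_bigcup => k.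
    case: pselect => h; last by apply: borel_open; exact: open0.
    rewrite (_ : [set z | _] = dom i `\` [set z | dom i z /\ (~` cube m k) (chart i z)]).
      apply: borel_setD; apply: borel_open; first exact: dom_open.
      by apply: chart_preimage_open; rewrite openC; exact: closed_cube.
    apply/seteqP; split => z /=; first by move=> [iz cz]; split => // -[].
    by move=> [iz h']; split => //; apply: contrapT => ncz; apply: h'.
  apply/seteqP; split => z /=.
    move=> [iz Az] m _; have [k Kk zk] := Az m I.
    by exists k => //; case: pselect.
  move=> h; have iz : dom i z.
    by have [k _] := h 0%N I; case: pselect => // Kk [].
  split => // m _; have [k _] := h m I; case: pselect => // Kk [_ ck].
  by exists k.
have B0 : lebesgue_null g B.
  move=> j; apply: lebesgue_outer_cube_null.
  apply: cube_null_sub (cube_null_transition i j nA').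
  move=> _ [z [[iz Az] jz] <-]; exists (chart i z); last by rewrite chartK.
  by split => //; exists z.
exists (iota @^-1` B); split; [exact: (measurable_iota_borel X_embedded)|exact: ac|].
move=> x [ix Ax]; split => // m _; have [_ cov _] := hr m; exact: cov.
Qed.

Lemma chart_outer_regular (M : set X) : measurable M ->
  forall e : R, 0 < e ->
  exists V, [/\ measurable V, fine (mu (V `\` M)) <= e &
    forall x, (iota @^-1` dom i) x -> M x -> exists2 r, 0 < r &
      coord_ball (iota @^-1` dom i) (fun x => chart i (iota x)) x r `<=` V].
Proof.
move=> mM e e0; have [B bB ME] := (X_embedded.2 M).1 mM.
have [U [C [oU cC CB BU UC]]] := borel_sandwiched g X_embedded mu bB e0.
have bU := borel_open oU; have bC := borel_closed cC.
have mU := measurable_iota_borel X_embedded bU.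
exists (iota @^-1` U); split => //.
  apply: le_trans UC; apply: fine_measure_le.
  - exact: measurableD.
  - by apply: (measurable_iota_borel X_embedded); exact: borel_setD.
  - by rewrite ME => x [Ux nBx]; split => // Cx; apply: nBx; exact: CB.
move=> x ix Mx; have Ux : U (iota x) by apply: BU; move: Mx; rewrite ME.
have Cx : (chart i @` dom i) (chart i (iota x)) by exists (iota x).
have : \forall y \near chart i (iota x), U (chart_inv i y).
  apply: (chart_inv_continuous Cx); rewrite chartK//.
  exact: open_nbhs_nbhs.
move=> /nbhs_ballP[r /= r0 hr]; exists r => // z [iz zr].
rewrite /preimage/= -(chartK iz); apply: hr.
rewrite mx_norm_ball /ball_/=; apply/rV_norm_lt => // k.
by rewrite !mxE distrC; exact: zr.
Qed.

End chart_measure.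

(** * Exceedances near the maximum *)

(** Replaces the neighbourhoods of a finite maximum and of [+oo] by one real threshold, as the
    levels are real. *)
Lemma near_max_real (R : realType) (z : \bar R) (Q : \bar R -> Prop) :
  z != -oo%E -> (\forall v \near z, (v < z)%E -> Q v) ->
  exists2 u0 : R, (u0%:E < z)%E &
    forall v : R, u0 <= v -> (v%:E < z)%E -> Q v%:E.
Proof.
case: z => [z||] // _ nearQ.
- have [e /= e0 eQ] : \forall v \near z, (v%:E < z%:E)%E -> Q v%:E.
    exact: nearQ.
  exists (z - e / 2); first by rewrite lte_fin; lra.
  move=> v zv vz; apply: eQ => //=.
  move: vz; rewrite lte_fin => vz.
  by rewrite ger0_norm; lra.
- have [A [_ AQ]] := nearQ.
  exists (A + 1); first exact: ltry.
  move=> v Av vy; apply: AQ => //.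
  by rewrite lte_fin; lra.
Qed.

Section exceedances_near_maximum.
Context {R : realType} {d : nat} {S : topologicalType}.
Context {g : riemannian_manifold R d S}.
Context {dX : measure_display} {X : measurableType dX} {iota : X -> S}.
Hypothesis X_embedded : borel_embedding iota.
Context {mu : probability X R} {i : chart_index g} {zeta : X}.
Let D := iota @^-1` dom i.
Let y := fun x => chart i (iota x).
Hypothesis Dzeta : D zeta.
Context {M : set X}.
Hypothesis mM : measurable M.
Hypothesis density_zeta : coord_density_point mu D y M zeta.
Context {phi : X -> \bar R} {u : nat -> R}.
Hypothesis phi_adm : admissible g iota mu zeta phi.
Hypothesis mphi : measurable_fun setT phi.
Let U n := [set x | ((u n)%:E < phi x)%E].
Hypothesis cvgU : fine (mu (U n)) @[n --> \oo] --> (0 : R).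

Let mU n : measurable (U n). Proof. exact: measurable_exceedance. Qed.

Let mB r : measurable (coord_ball D y zeta r).
Proof.
apply: measurable_coord_ball; first exact: measurable_chart_dom.
by move=> j; exact: measurable_chart_coord.
Qed.

(* Small superlevel sets are small metric balls, squeezed between coordinate
   boxes whose radii have a bounded ratio. *)
Lemma exceedance_density (e : R) : 0 < e ->
  \forall n \near \oo, fine (mu (U n `\` M)) <= e * fine (mu (U n)).
Proof.
move=> e0; have [phi_max nearball _] := phi_adm.
(* In this case [phi] is [-oo] everywhere and no real level is exceeded. *)
have [phiN|phiN] := eqVneq (phi zeta) -oo%E.
  near=> n; have -> : U n = set0.
    apply/seteqP; split => // x /= ux.
    by have := lt_le_trans ux (phi_max x); rewrite phiN ltNge leNye.
  by rewrite set0D measure0 /= mulr0.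
have [u0 u0z ballU] := near_max_real phiN nearball.
have [c [C [r0 [c0 C0 r00 box]]]] := riemannian_ball_chart Dzeta.
have [rho rho0 dens] := density_zeta c0 C0 e0.
set R0 := Num.min rho r0.
have R00 : 0 < R0 by rewrite lt_min rho0.
have R0rho : R0 <= rho by rewrite ge_min lexx.
have R0r0 : R0 <= r0 by rewrite ge_min lexx orbT.
have box_in s r : 0 < s < R0 -> s <= r ->
    coord_ball D y zeta (c * s) `<=`
    [set x | (riemannian_dist g (iota zeta) (iota x) < r%:E)%E].
  move=> /andP[s0 sR] sr x [Dx yx] /=.
  have [|+ _] := box s; first by rewrite s0 (lt_le_trans sR).
  move=> /(_ (iota x) Dx yx) /lt_le_trans; apply.
  by rewrite lee_fin.
have [s1 s10 U1] := ballU u0 (lexx _) u0z.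
set t1 := Num.min s1 (R0 / 2).
have t1P : 0 < t1 < R0.
  by rewrite lt_min s10 gt_min /= [R0 / 2 < R0](_ : _ = true) ?orbT ?andbT; lra.
have hP : 0 < R0 / 2 < R0 by lra.
have m1 : 0 < fine (mu (coord_ball D y zeta (c * t1))).
  have [/andP[a b]] := (t1P, tt).
  by have [|//] := dens t1; rewrite a (lt_le_trans b).
have m2 : 0 < fine (mu (coord_ball D y zeta (c * (R0 / 2)))).
  have [/andP[a b]] := (hP, tt).
  by have [|//] := dens (R0 / 2); rewrite a (lt_le_trans b).
near=> n.
have [U0|/set0P[x0 Ux0]] := eqVneq (U n) set0.
  by rewrite U0 set0D measure0 /= mulr0.
have unz : ((u n)%:E < phi zeta)%E by exact: lt_le_trans Ux0 (phi_max _).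
have small1 : fine (mu (U n)) < fine (mu (coord_ball D y zeta (c * t1))).
  by near: n; apply: cvgr_lt cvgU _ m1.
have small2 : fine (mu (U n)) < fine (mu (coord_ball D y zeta (c * (R0 / 2)))).
  by near: n; apply: cvgr_lt cvgU _ m2.
(* A level below [u0] would make [U n] contain the ball of radius [s1], hence a box of fixed
   positive mass, whereas [U n] has smaller mass. The radius [r] of [U n] is bounded below by the
   same argument, with the box of parameter [R0 / 2], to be less than [R0 / 2]. *)
have u0n : u0 <= u n.
  rewrite leNgt; apply/negP => un0.
  move: small1; rewrite ltNge; apply/negP; rewrite negbK.
  apply: fine_measure_le => // x /(box_in _ s1 t1P) h.
  have : (u0%:E < phi x)%E.
    suff : [set x | (u0%:E < phi x)%E] x by [].
    by rewrite U1; apply: h; rewrite ge_min lexx.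
  by apply: lt_trans; rewrite lte_fin.
have [r r_gt0 Ur] := ballU (u n) u0n unz.
have UE : U n = [set x | (riemannian_dist g (iota zeta) (iota x) < r%:E)%E].
  exact: Ur.
have rR : r < R0 / 2.
  rewrite ltNge; apply/negP => Rr.
  move: small2; rewrite ltNge; apply/negP; rewrite negbK.
  by apply: fine_measure_le => //; rewrite UE; exact: box_in.
have rP : 0 < r < rho by lra.
have [_ densr] := dens r rP.
have [|_ out] := box r; first by lra.
apply: (@le_trans _ _ (fine (mu (coord_ball D y zeta (C * r) `\` M)))).
  apply: fine_measure_le; [exact: measurableD|exact: measurableD|].
  by move=> x []; rewrite UE => /out[Dx yx] nMx; split.
apply: (le_trans densr); rewrite ler_pM2l//.
by apply: fine_measure_le => //; rewrite UE; apply: box_in => //; lra.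
Unshelve. all: by end_near.
Qed.

End exceedances_near_maximum.

Lemma cvg_exceedance0 {R : realType} {dX : measure_display}
    {X : measurableType dX} (mu : probability X R) (U : nat -> set X)
    (tau : R) : (forall n, measurable (U n)) ->
  (n%:R%:E * mu (U n))%E @[n --> \oo] --> tau%:E ->
  fine (mu (U n)) @[n --> \oo] --> (0 : R).
Proof.
move=> mU cvgtau.
have cvgt : n%:R * fine (mu (U n)) @[n --> \oo] --> tau.
  rewrite (_ : (fun n => _) = fine \o (fun n => n%:R%:E * mu (U n))%E).
    exact: fine_cvg cvgtau.
  by apply/funext => n /=; rewrite fineM// fin_num_measure.
rewrite -cvg_shiftS /= (_ : (fun n => _) = (fun n =>
  @harmonic R n * (n.+1%:R * fine (mu (U n.+1))))).
  have cvgtS : n.+1%:R * fine (mu (U n.+1)) @[n --> \oo] --> tau.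
    by rewrite (cvg_shiftS (fun n => n%:R * fine (mu (U n)))).
  have := cvgM (@cvg_harmonic R) cvgtS; rewrite mul0r; exact.
by apply/funext => n; rewrite /harmonic /= mulKf// pnatr_eq0.
Qed.

(* By second countability, countably many charts suffice. *)
Lemma negligible_not_chart_density {R : realType} {d : nat}
    {S : topologicalType} (g : riemannian_manifold R d S)
    {dX : measure_display} {X : measurableType dX} {iota : X -> S}
    (X_embedded : borel_embedding iota) {mu : probability X R}
    (mu_ac : lebesgue_abs_cont g iota mu) {M : set X} (mM : measurable M) :
  mu.-negligible [set x | M x /\ ~ exists2 i : chart_index g,
     dom i (iota x) & coord_density_point mu (iota @^-1` dom i)
                        (fun x => chart i (iota x)) M x].
Proof.
have [Bs cBs [Bopen Bbasis]] := manifold_second_countable g.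
pose bad (i : chart_index g) := [set x | [/\ dom i (iota x), M x &
  ~ coord_density_point mu (iota @^-1` dom i) (fun x => chart i (iota x)) M x]].
have bad0 i : mu.-negligible (bad i).
  apply: negligible_not_density_point => //.
  - exact: measurable_chart_dom.
  - by move=> j; exact: measurable_chart_coord.
  - by move=> e e0; exact: chart_outer_regular.
  - by move=> A; exact: chart_abs_cont.
pose A (b : set S) := if pselect (exists i : chart_index g, b `<=` dom i) is
  left h then bad (sval (cid h)) else set0.
have A0 b : Bs b -> mu.-negligible (A b).
  by move=> _; rewrite /A; case: pselect => h //=; exact: negligible_set0.
apply: (negligibleS _ (negligible_bigcup_countable_set cBs A0)).
move=> x [Mx notdens]; have [i Di] := dom_cover g (iota x).
have [b [/= Bb bx] bi] := Bbasis (iota x) (dom i) (open_nbhs_nbhs (conj (dom_open i) Di)).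
exists b => //; rewrite /A; case: pselect => h /=; last by case: h; exists i.
have Dx := svalP (cid h) _ bx.
by split=> // densx; apply: notdens; exists (sval (cid h)).
Qed.

Lemma negligible_of_induced {R : realType} {dX : measure_display}
    {X : measurableType dX} {mu : probability X R} {M : set X}
    {mM : measurable M} (M_gt0 : (0 < mu M)%E) {A : set X} :
  (induced_measure mu mM).-negligible A -> mu.-negligible (A `&` M).
Proof.
move=> [B [mB B0 AB]]; exists (B `&` M); split.
- exact: measurableI.
- move: B0; rewrite induced_measureE// => /eqP; rewrite mule_eq0 eqe invr_eq0.
  by rewrite gt_eqF ?fine_measure_gt0//= => /eqP.
- exact: setSI.
Qed.

Theorem proposition2p6 (R : realType)
    (d : nat) (S : topologicalType) (g : riemannian_manifold R d S)
    (dX : measure_display) (X : measurableType dX) (iota : X -> S)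
    (X_embedded : borel_embedding iota)
    (mu : probability X R) (mu_ac : lebesgue_abs_cont g iota mu)
    (T : X -> X) (T_mp : measure_preserving mu T) (T_erg : ergodic mu T)
    (M : set X) (mM : measurable M) (M_gt0 : (0 < mu M)%E)
    (phi : X -> X -> \bar R)
    (phi_meas : forall zeta, M zeta -> measurable_fun setT (phi zeta))
    (phi_adm : forall zeta, M zeta -> admissible g iota mu zeta (phi zeta))
    (u : X -> nat -> R)
    (u_lim : forall zeta, M zeta -> exists2 tau : R, 0 <= tau &
       (fun n => n%:R%:E * mu [set x | (u zeta n)%:E < phi zeta x])%E @ \oo
         --> tau%:E)
    (dO : measure_display) (Omega : measurableType dO)
    (P : probability Omega R) (W : nat -> {RV P >-> R})
    (W_iid : iid_exponential1 W) :
  {ae induced_measure mu mM, forall zeta, M zeta ->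
     cvg_point_process (induced_measure mu mM)
       (fun n => rare_event_process (induced_measure mu mM) (return_map M T)
                   (phi zeta) (u zeta n))
       P (poisson_process W)} ->
  {ae mu, forall zeta, M zeta ->
     cvg_point_process mu
       (fun n => rare_event_process mu T (phi zeta) (u zeta n))
       P (poisson_process W)}.
Proof.
move=> /(negligible_of_induced M_gt0) induced_ae.
apply: (negligibleS _ (negligibleU induced_ae
  (negligible_not_chart_density X_embedded mu_ac mM))).
move=> zeta /not_implyP[Mz not_cvg]; apply: contrapT => /not_orP[].
move=> /not_andP[/contrapT hat_cvg|//] /not_andP[//|/contrapT[i Di dens]].
apply: not_cvg; have [tau _ cvgtau] := u_lim _ Mz.
have mphi := phi_meas _ Mz.
have cvgU := cvg_exceedance0 (measurable_exceedance (u zeta) mphi) cvgtau.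
apply: (cvg_point_process_of_induced T_mp T_erg M_gt0 mphi cvgU) (hat_cvg Mz).
by move=> e; exact: (exceedance_density X_embedded Di mM dens (phi_adm _ Mz)).
Qed.
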